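(* Fix integers $d\geq 2$ and $1\leq \ell\leq d-1$. (i) For any $\beta\geq -1$ and $\gamma>0$, the sectional tessellation $\mathcal V_{d,\beta,\gamma}\cap\mathbb R^\ell$ has the same distribution as $\mathcal V_{\ell,\beta+\frac{d-\ell}{2},\gamma}$. (ii) For any $\beta>\frac d2+1$ and $\gamma>0$, the sectional tessellation $\mathcal V'_{d,\beta,\gamma}\cap\mathbb R^\ell$ has the same distribution as $\mathcal V'_{\ell,\beta-\frac{d-\ell}{2},\gamma}$. (iii) For any $\lambda>0$, the sectional tessellation $\mathcal G_{d,\lambda}\cap\mathbb R^\ell$ has the same distribution as $\mathcal G_{\ell,\lambda}$.
   Context: A tessellation in $\mathbb R^n$ is a countable, locally finite collection of $n$-dimensional convex polytopes (cells) with disjoint interiors covering $\mathbb R^n$. A random tessellation is a particle process (a point process on the space of non-empty compact subsets of $\mathbb R^n$) whose support is almost surely a face-to-face tessellation; distributions are understood in this sense. Laguerre tessellation: for a countable set $X\subset\mathbb R^n\times\mathbb R$ of points $(v,h)$, the Laguerre cell of $(v,h)\in X$ is $C((v,h),X)=\{w\in\mathbb R^n:\|w-v\|^2+h\leq\|w-v'\|^2+h'\text{ for all }(v',h')\in X\}$, and $\mathcal L(X)$ is the collection of all non-empty Laguerre cells. The three families, for each dimension $n\ge 1$ (it is known that these Laguerre diagrams are almost surely stationary isotropic normal face-to-face tessellations of $\mathbb R^n$): - $\beta$-Voronoi: for $\beta>-1$, $\gamma>0$, $\mathcal V_{n,\beta,\gamma}=\mathcal L(\eta_{n,\beta,\gamma})$,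 where $\eta_{n,\beta,\gamma}$ is a Poisson point process on $\mathbb R^n\times[0,\infty)$ whose intensity measure has Lebesgue density $(v,h)\mapsto\gamma\,c_{n+1,\beta}h^\beta$, $c_{n+1,\beta}=\frac{\Gamma(\frac{n+1}{2}+\beta+1)}{\pi^{(n+1)/2}\Gamma(\beta+1)}$. For $\beta=-1$, $\mathcal V_{n,-1,\gamma}$ is by definition the classical Poisson-Voronoi tessellation of $\mathbb R^n$ generated by a homogeneous Poisson point process of intensity $\Gamma(\frac{n+1}{2})\pi^{-\frac{n+1}{2}}\gamma$. - $\beta'$-Voronoi: for $\beta>\frac n2+1$, $\gamma>0$, $\mathcal V'_{n,\beta,\gamma}=\mathcal L(\eta'_{n,\beta,\gamma})$, where $\eta'_{n,\beta,\gamma}$ is a Poisson point process on $\mathbb R^n\times(-\infty,0)$ with Lebesgue density $(v,h)\mapsto\gamma\,c'_{n+1,\beta}(-h)^{-\beta}$ of its intensity measure, $c'_{n+1,\beta}=\frac{\Gamma(\beta)}{\pi^{(n+1)/2}\Gamma(\beta-\frac{n+1}{2})}$. - Gaussian-Voronoi: for $\lambda>0$, $\mathcal G_{n,\lambda}=\mathcal L(\zeta_{n,\lambda,\gamma})$, where $\zeta_{n,\lambda,\gamma}$ is a Poisson point process on $\mathbb R^n\times\mathbb R$ with Lebesgue density $(v,h)\mapsto\gamma e^{\lambda h}$ of its intensity measure; here $\gamma>0$ is arbitrary (the distribution of $\mathcal G_{n,\lambda}$ does not depend on $\gamma$). $\mathbb R^\ell$ is identified with the linear subspace of $\mathbb R^d$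 spanned by the first $\ell$ standard basis vectors. For a random tessellation $\mathcal T$ of $\mathbb R^d$, $\mathcal T\cap\mathbb R^\ell$ denotes the random tessellation of $\mathbb R^\ell$ whose cells are the non-empty sets $c\cap\mathbb R^\ell$, $c\in\mathcal T$. *)

(* Defs.v *)
From HB Require Import structures.
From mathcomp Require Import all_boot all_order all_algebra.
From mathcomp Require Import all_classical all_reals all_analysis.
From mathcomp Require Import measurable_realfun.

Set Implicit Arguments.
Unset Strict Implicit.
Unset Printing Implicit Defensive.

Import Order.TTheory GRing.Theory Num.Theory.
Import numFieldNormedType.Exports.

Local Open Scope classical_set_scope.
Local Open Scope ring_scope.

Definition measure_rV_display : measure_display -> measure_display.
Proof. exact. Qed.

(* 'rV[R]_n carries the product sigma-algebra, as the library's n.-tuple R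
   does; it is the Borel sigma-algebra of R^n. *)
Section measurable_rV.
Context {R : realType} (n : nat).

Let coord (i : 'I_n) (v : 'rV[R]_n) : R := v ord0 i.

Let rV_set0 : g_sigma_preimage coord set0.
Proof. exact: sigma_algebra0. Qed.

Let rV_setC A : g_sigma_preimage coord A -> g_sigma_preimage coord (~` A).
Proof. exact: sigma_algebraC. Qed.

Let rV_bigcup (F : (set 'rV[R]_n)^nat) :
  (forall i, g_sigma_preimage coord (F i)) ->
  g_sigma_preimage coord (\bigcup_i (F i)).
Proof. exact: sigma_algebra_bigcup. Qed.

HB.instance Definition _ :=
  @isMeasurable.Build (measure_rV_display default_measure_display) 'rV[R]_n
    (g_sigma_preimage coord) rV_set0 rV_setC rV_bigcup.

End measurable_rV.

Section lebesgue_rV.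
Context {R : realType}.

Definition cons_rV n (p : measurableTypeR R * 'rV[R]_n) : 'rV[R]_n.+1 :=
  row_mx (\row_(_ < 1) (p.1 : R)) p.2.

Fixpoint lebesgue_rV n : set 'rV[R]_n -> \bar R :=
  match n with
  | 0 => \d_(0 : 'rV[R]_0)
  | n'.+1 => pushforward (lebesgue_measure \x @lebesgue_rV n')%E (@cons_rV n')
  end.

Lemma measurable_coord n (i : 'I_n) :
  measurable_fun [set: 'rV[R]_n] (fun v => v ord0 i : R).
Proof.
move=> _ Y mY; rewrite setTI; apply: sub_sigma_algebra => /=.
rewrite -bigcup_seq/=; exists i => /=; first by rewrite mem_index_enum.
by exists Y => //; rewrite setTI.
Qed.

Lemma cons_rV0 n p : @cons_rV n p ord0 ord0 = p.1.
Proof.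
have e : ord0 = lshift n (ord0 : 'I_1) by exact: val_inj.
have := row_mxEl (\row_(_ < 1) (p.1 : R)) p.2 ord0 (ord0 : 'I_1).
by rewrite -e mxE.
Qed.

Lemma cons_rVS n p (i : 'I_n) : @cons_rV n p ord0 (lift ord0 i) = p.2 ord0 i.
Proof.
have e : lift ord0 i = rshift 1 i by exact: val_inj.
have := row_mxEr (\row_(_ < 1) (p.1 : R)) p.2 ord0 i.
by rewrite -e.
Qed.

Lemma measurable_fun_rV d (T : measurableType d) n (f : T -> 'rV[R]_n) :
  (forall i, measurable_fun [set: T] (fun x => f x ord0 i : R)) ->
  measurable_fun [set: T] f.
Proof.
move=> mf _ Y mY; rewrite setTI.
suff : (g_sigma_preimage (fun i (v : 'rV[R]_n) => v ord0 i : R))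
    `<=` [set A | measurable (f @^-1` A)] by apply.
apply: smallest_sub.
  split=> /=.
  - by rewrite preimage_set0.
  - by move=> A mA; rewrite setTD preimage_setC; exact: measurableC.
  - by move=> F mF; rewrite preimage_bigcup; exact: bigcupT_measurable.
move=> A; rewrite -bigcup_seq/= => -[i _ [B mB <-]] /=.
by rewrite setTI -comp_preimage -[X in measurable X]setTI; exact: mf.
Qed.

Lemma measurable_cons_rV n : measurable_fun setT (@cons_rV n).
Proof.
apply: measurable_fun_rV => i; have [j ->|->] := unliftP ord0 i; last first.
  under eq_fun do rewrite cons_rV0.
  by move=> mT Y mY; exact: (@measurable_fst _ _ (measurableTypeR R) _ mT Y mY).
under eq_fun do rewrite cons_rVS.
apply: (measurableT_comp (measurable_coord j)).
exact: measurable_snd.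
Qed.

Let box n (k : nat) : set 'rV[R]_n :=
  [set v | forall i, `](- k%:R), k%:R]%classic (v ord0 i : R)].

Let measurable_box n k : measurable (@box n k).
Proof.
rewrite (_ : box k =
    \bigcap_(i in [set: 'I_n]) (fun v : 'rV[R]_n => v ord0 i : R) @^-1`
      `](- k%:R), k%:R]%classic); last first.
  by apply/seteqP; split=> [v bv i _|v bv i]; [exact: bv|exact: bv].
apply: fin_bigcap_measurable => // i _.
by rewrite -[X in measurable X]setTI; exact: measurable_coord.
Qed.

Let bigcup_box n : [set: 'rV[R]_n] = \bigcup_k @box n k.
Proof.
apply/esym/seteqP; split=> // v _.
exists (Num.truncn (\sum_(i < n) `|v ord0 i|)).+1 => // i /=.
have vi : `|v ord0 i| < (Num.truncn (\sum_(i < n) `|v ord0 i|)).+1%:R.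
  apply: le_lt_trans (truncnS_gt _).
  by rewrite (bigD1 i)//= lerDl sumr_ge0.
by move: vi; rewrite ltr_norml in_itv/= => /andP[-> /ltW].
Qed.

Let lebesgue_rV_spec n :
  [/\ @lebesgue_rV n set0 = 0%E, forall A, (0 <= @lebesgue_rV n A)%E,
      semi_sigma_additive (@lebesgue_rV n) &
      forall k, (@lebesgue_rV n (box k) < +oo)%E].
Proof.
elim: n => [|n [m0 m_ge0 mS mfin]].
  pose d0 : {measure set 'rV[R]_0 -> \bar R} := [the measure _ _ of \d_(0 : 'rV[R]_0)].
  split; [exact: (measure0 d0)|by move=> A; exact: (measure_ge0 d0)| |move=> k].
    exact: (@measure_semi_sigma_additive _ _ _ d0).
  by rewrite /= diracE; case: (_ \in _); rewrite ltry.
have msf : sigma_finite setT (@lebesgue_rV n).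
  by exists (@box n) => [|k]; [exact: bigcup_box|split; [exact: measurable_box|exact: mfin]].
pose mM := isMeasure.Build _ _ _ (@lebesgue_rV n) m0 m_ge0 mS.
pose m : {measure set 'rV[R]_n -> \bar R} := HB.pack (@lebesgue_rV n) mM.
pose mF := @Measure_isSigmaFinite.Build _ _ _ m msf.
pose sm : {sigma_finite_measure set 'rV[R]_n -> \bar R} :=
  HB.pack (@lebesgue_rV n) mM mF.
pose p : {measure set _ -> \bar R} := [the measure _ _ of (lebesgue_measure \x sm)%E].
have mc := @measurable_cons_rV n.
have mcA A : measurable A -> measurable (@cons_rV n @^-1` A).
  by move=> mA; rewrite -[X in measurable X]setTI; exact: mc.
split.
- exact: (measure0 p).
- by move=> A; exact: (measure_ge0 p).
- move=> F mF' tF mUF; rewrite /= /pushforward preimage_bigcup.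
  apply: (@measure_semi_sigma_additive _ _ _ p).
  + by move=> i; exact: mcA.
  + apply/trivIsetP => /= i j _ _ ij; rewrite -preimage_setI.
    by move/trivIsetP : tF => /(_ _ _ _ _ ij) ->//; rewrite preimage_set0.
  + by rewrite -preimage_bigcup; exact: mcA.
- move=> k; rewrite /= /pushforward.
  have itv_fin : lebesgue_measure (`](- k%:R), k%:R]%classic : set R) \is a fin_num.
    by rewrite lebesgue_measure_itv/=; case: ifPn.
  have -> : @cons_rV n @^-1` box k =
      (`](- k%:R), k%:R]%classic : set (measurableTypeR R)) `*` box k.
    apply/seteqP; split=> [[x v] /= b|[x v] /= [bx bv] i].
      split=> [|i]; first by have := b ord0; rewrite cons_rV0.
      by have := b (lift ord0 i); rewrite cons_rVS.
    by have [j ->|->] := unliftP ord0 i; rewrite ?cons_rV0 ?cons_rVS//; exact: bv.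
  rewrite (@product_measure1E _ _ (measurableTypeR R) _ R lebesgue_measure sm).
  + apply: lte_mul_pinfty; last exact: mfin.
    * exact: measure_ge0.
    * exact: itv_fin.
  + exact: measurable_itv.
  + exact: measurable_box.
Qed.

HB.instance Definition _ n := isMeasure.Build _ _ _ (@lebesgue_rV n)
  (let: And4 m0 _ _ _ := lebesgue_rV_spec n in m0)
  (let: And4 _ m_ge0 _ _ := lebesgue_rV_spec n in m_ge0)
  (let: And4 _ _ mS _ := lebesgue_rV_spec n in mS).

Let sigma_finite_lebesgue_rV n : sigma_finite setT (@lebesgue_rV n).
Proof.
exists (@box n) => [|k]; first exact: bigcup_box.
by split; [exact: measurable_box|have [_ _ _ ->] := lebesgue_rV_spec n].
Qed.

HB.instance Definition _ n := @Measure_isSigmaFinite.Build _ _ _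
  (@lebesgue_rV n) (@sigma_finite_lebesgue_rV n).

End lebesgue_rV.
Arguments lebesgue_rV {R} n _.

Section poisson_process.
Context {R : realType}.

(* A point process on a subset E of T is given by its random support: in each
   realization a subset of E meeting every compact subset of E finitely often. *)
Definition locally_finite_in (T : topologicalType) (E X : set T) : Prop :=
  X `<=` E /\ forall K, compact K -> K `<=` E -> finite_set (X `&` K).

Definition independent_RVs d (Om : measurableType d) (P : probability Om R)
    m (N : 'I_m -> Om -> \bar R) : Prop :=
  forall A : 'I_m -> set (\bar R), (forall i, measurable (A i)) ->
    P (\bigcap_(i in [set: 'I_m]) (N i @^-1` A i)) =
    (\prod_(i < m) P (N i @^-1` A i))%E.

Definition poisson_distributed d (Om : measurableType d) (P : probability Om R)
    (N : Om -> \bar R) (r : \bar R) : Prop :=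
  if r is r'%:E then
    forall k : nat, P (N @^-1` [set k%:R%:E]) =
      (r' ^+ k / k`!%:R * expR (- r'))%:E
  else P (N @^-1` [set +oo%E]) = 1%E.

Definition is_poisson_process d (Om : measurableType d) (P : probability Om R)
    d' (S : measurableType d') (Lambda : set S -> \bar R)
    (X : Om -> set S) : Prop :=
  let N (B : set S) (w : Om) : \bar R := counting (X w `&` B) in
  [/\ forall B, measurable B -> measurable_fun setT (N B),
      forall B, measurable B -> poisson_distributed P (N B) (Lambda B) &
      forall m (B : 'I_m -> set S), (forall i, measurable (B i)) ->
        trivIset setT B -> independent_RVs P (fun i => N (B i))].

Definition density_measure n (E : set ('rV[R]_n * measurableTypeR R))
    (f : 'rV[R]_n -> R -> R) : set ('rV[R]_n * measurableTypeR R) -> \bar R :=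
  fun B => (\int[lebesgue_rV n \x lebesgue_measure]_(z in B `&` E)
              (f z.1 z.2)%:E)%E.

End poisson_process.

Section tessellations.
Context {R : realType}.

Definition enorm n (v : 'rV[R]_n) : R := Num.sqrt (\sum_i v ord0 i ^+ 2).

Definition laguerre_cell n (X : set ('rV[R]_n * R)) (p : 'rV[R]_n * R)
    : set 'rV[R]_n :=
  [set w | forall q, X q ->
     enorm (w - p.1) ^+ 2 + p.2 <= enorm (w - q.1) ^+ 2 + q.2].

Definition laguerre n (X : set ('rV[R]_n * R)) : set (set 'rV[R]_n) :=
  [set C | C !=set0 /\ exists2 p, X p & C = laguerre_cell X p].

Definition voronoi n (X : set 'rV[R]_n) : set (set 'rV[R]_n) :=
  [set C | exists2 v, X v &
     C = [set w | forall v', X v' -> enorm (w - v) <= enorm (w - v')]].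

(* v *m pid_mx l appends d - l zero coordinates to v, so the preimage of a cell
   is its intersection with R^l. *)
Definition sectional_tessellation d l (T : set (set 'rV[R]_d)) : set (set 'rV[R]_l) :=
  [set D | D !=set0 /\ exists2 C, T C &
     D = (fun v : 'rV[R]_l => v *m (pid_mx l : 'M[R]_(l, d))) @^-1` C].

Definition Gamma (x : R) : R :=
  \int[lebesgue_measure]_(t in `]0, +oo[) (t `^ (x - 1) * expR (- t)).

Definition beta_const (m : nat) (b : R) : R :=
  Gamma (m%:R / 2 + b + 1) / (pi `^ (m%:R / 2) * Gamma (b + 1)).

Definition beta'_const (m : nat) (b : R) : R :=
  Gamma b / (pi `^ (m%:R / 2) * Gamma (b - m%:R / 2)).

Section random_tessellations.
Context d (Om : measurableType d) (P : probability Om R) (n : nat).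
Implicit Types T : Om -> set (set 'rV[R]_n).

Definition is_poisson_voronoi (rate : R) T : Prop :=
  exists X : Om -> set 'rV[R]_n,
    [/\ forall w, locally_finite_in setT (X w),
        is_poisson_process P (fun B => rate%:E * lebesgue_rV n B)%E X &
        forall w, T w = voronoi (X w)].

Definition is_poisson_laguerre (E : set ('rV[R]_n * R))
    (f : 'rV[R]_n -> R -> R) T : Prop :=
  exists X : Om -> set ('rV[R]_n * measurableTypeR R),
    [/\ forall w, @locally_finite_in ('rV[R]_n * R)%type E (X w),
        is_poisson_process P (density_measure E f) X &
        forall w, T w = laguerre (X w)].

Definition is_beta_voronoi (b g : R) T : Prop :=
  if b == -1 then
    is_poisson_voronoi
      (Gamma (n.+1%:R / 2) * pi `^ (- (n.+1%:R / 2)) * g) T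
  else
    is_poisson_laguerre [set z | 0 <= z.2]
      (fun _ h => g * beta_const n.+1 b * h `^ b) T.

Definition is_beta'_voronoi (b g : R) T : Prop :=
  is_poisson_laguerre [set z | z.2 < 0]
    (fun _ h => g * beta'_const n.+1 b * (- h) `^ (- b)) T.

Definition is_gaussian_voronoi (lambda : R) T : Prop :=
  exists2 g : R, 0 < g &
    is_poisson_laguerre setT (fun _ h => g * expR (lambda * h)) T.

End random_tessellations.

End tessellations.
Arguments sectional_tessellation {R d} l _ _.

Section particle_processes.
Context {R : realType}.

Definition particles n : set (set 'rV[R]_n) := [set C | C !=set0 /\ compact C].

Definition hausdorff_dist n (C D : set 'rV[R]_n) : R :=
  inf [set e | [/\ 0 <= e,
    forall x, C x -> exists2 y, D y & enorm (x - y) <= e &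
    forall y, D y -> exists2 x, C x & enorm (x - y) <= e]].

Definition hausdorff_open n (U : set (set 'rV[R]_n)) : Prop :=
  U `<=` @particles n /\ forall C, U C -> exists2 e : R, 0 < e &
    forall D, @particles n D -> hausdorff_dist C D < e -> U D.

Definition particle_borel n : set (set (set 'rV[R]_n)) :=
  <<s @particles n, @hausdorff_open n >>.

(* The smallest sigma-algebra on collections of sets that makes all the counts
   #(T `&` A), A Borel in the space of particles, measurable. Members of T that
   are not non-empty compact sets are never counted. *)
Definition process_events n : set (set (set (set 'rV[R]_n))) :=
  <<s [set (fun T => counting (T `&` A) : \bar R) @^-1` B |
        A in @particle_borel n & B in measurable] >>.

Definition eq_distribution n
    d1 (O1 : measurableType d1) (P1 : probability O1 R)
    (T1 : O1 -> set (set 'rV[R]_n))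
    d2 (O2 : measurableType d2) (P2 : probability O2 R)
    (T2 : O2 -> set (set 'rV[R]_n)) : Prop :=
  forall E, process_events E ->
    [/\ measurable (T1 @^-1` E), measurable (T2 @^-1` E) &
        P1 (T1 @^-1` E) = P2 (T2 @^-1` E)].

End particle_processes.

(* Main.v *)
Require Import Defs.
From HB Require Import structures.
From mathcomp Require Import all_boot all_order all_algebra.
From mathcomp Require Import all_classical all_reals all_analysis.
From mathcomp Require Import measurable_realfun.
From mathcomp Require Import ring lra zify.

(** Taking a section folds the generators.  Let w lie in R^l and split a
    generator (v, h) as v = (v', v'') along R^l and its complement.  Then
    |w - v|^2 + h = |w - v'|^2 + (h + |v''|^2), so the section of a Laguerre
    diagram is the Laguerre diagram of the folded points (v', h + |v''|^2)
    ([sectional_laguerre]); a constant added to all heights changes no cell.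
    Folding maps a Poisson process to a Poisson process, and everything
    reduces to computing the folded intensity.

    The intensities depend on the height only.  Folding away one coordinate
    replaces the height profile f by its Abel transform, t being sent to the
    integral of f (t - x^2) over x ([intensity_fold]).  The three profiles are
    stable under this operation: h^b becomes a multiple of h^(b + 1/2)
    ([abel_ppow]), (-h)^(-b) a multiple of (-h)^(-(b - 1/2)) ([abel_npow]) and
    exp (lambda h) a multiple of itself ([abel_exp]).  In the first two cases
    the factors are quotients of Gamma values which telescope to the quotient
    of the normalising constants ([beta_const_section],
    [beta'_const_section]); in the Gaussian case the factor is absorbed by a
    shift of the heights.  For beta = -1 the generators all have height zero,
    and the first folding sends Lebesgue measure to the profile h^(-1/2)
    ([lebesgue_flat]), after which the case is an ordinary one.

    The passage from intensities to laws uses void probabilities only (the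
    idea of Renyi).  The events that a random set Y misses B are stable under
    intersection, so two random sets with equal void probabilities have equal
    laws on the sigma-algebra generated by these events ([eq_law_config]); for
    Poisson processes they are exp (- Lambda B).  It remains to see that the
    Laguerre tessellation is a measurable function of the set.  A countable
    family of measurable sets that separates points lets one enumerate
    measurably the points of a discrete set, as the unique points in members
    of the family ([measurable_pt]).  For measurably enumerated generators,
    the event that a cell meets a compact set is a countable combination of
    events on heights at rational points, and such events generate the Borel
    sets of the Hausdorff metric; hence all counts of cells are measurable
    ([measurable_laguerre]).

    Folding a beta'-process also produces points of nonnegative height, which
    the process in R^l does not have.  They are irrelevant: almost surely each
    w sees a point p with |w - p.1|^2 + p.2 < 0 ([ae_covered]), and then cells
    of points of nonnegative height are empty ([laguerre_restrict_neg]). *)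

Set Implicit Arguments.
Unset Strict Implicit.
Unset Printing Implicit Defensive.

Import Order.TTheory GRing.Theory Num.Theory.
Import numFieldNormedType.Exports.

Local Open Scope classical_set_scope.
Local Open Scope ring_scope.

(** * Measurability of the Laguerre tessellation *)
Section measurable_predicates.
Context d (T : measurableType d).
Implicit Types (P Q : T -> Prop).

Lemma measurable_not_pred P :
  measurable [set x | P x] -> measurable [set x | ~ P x].
Proof. exact: measurableC. Qed.

Lemma measurable_and_pred P Q : measurable [set x | P x] -> measurable [set x | Q x] ->
  measurable [set x | P x /\ Q x].
Proof. exact: measurableI. Qed.

Lemma measurable_or_pred P Q : measurable [set x | P x] -> measurable [set x | Q x] ->
  measurable [set x | P x \/ Q x].
Proof. exact: measurableU. Qed.

Lemma measurable_imply_pred P Q : measurable [set x | P x] -> measurable [set x | Q x] ->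
  measurable [set x | P x -> Q x].
Proof.
move=> mP mQ; rewrite (_ : [set x | P x -> Q x] = ~` [set x | P x] `|` [set x | Q x]).
  exact: measurableU (measurableC _) _.
apply/seteqP; split=> x /=; last by move=> [|? ?].
by have [|] := pselect (P x); [right; auto|left].
Qed.

Lemma measurable_const_pred (P : Prop) : measurable [set x : T | P].
Proof.
have [p|np] := pselect P.
  by rewrite (_ : [set _ | _] = setT)//; apply/seteqP; split.
by rewrite (_ : [set _ | _] = set0)//; apply/seteqP; split.
Qed.

Lemma measurable_exists_pred (I : countType) (P : I -> T -> Prop) :
  (forall i, measurable [set x | P i x]) -> measurable [set x | exists i, P i x].
Proof.
move=> mP; rewrite (_ : [set x | _] = \bigcup_i [set x | P i x]).
  by apply: countable_bigcupT_measurable; [exact: countableP|].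
by apply/seteqP; split=> x /= [i]; [exists i|move=> _; exists i].
Qed.

Lemma measurable_forall_pred (I : countType) (P : I -> T -> Prop) :
  (forall i, measurable [set x | P i x]) -> measurable [set x | forall i, P i x].
Proof.
move=> mP; rewrite (_ : [set x | _] = ~` [set x | exists i, ~ P i x]).
  by apply/measurableC/measurable_exists_pred => i; exact: measurable_not_pred.
apply/seteqP; split=> x /=; first by move=> Px [i]; apply.
by move/forallNP => + i => /(_ i) /contrapT.
Qed.

End measurable_predicates.

Section rational_points.
Context {R : realType} (n : nat).

Definition rational_point (r : 'rV[rat]_n) : 'rV[R]_n := map_mx ratr r.

Lemma rational_point_dense (w : 'rV[R]_n) e : 0 < e ->
  exists r, `|w - rational_point r| < e.
Proof.
move=> e0.
have h i : exists q : rat, `|w ord0 i - ratr q| < e.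
  have /rat_in_itvoo[q] : w ord0 i - e < w ord0 i + e.
    by rewrite ltrBlDr -addrA ltrDl addr_gt0.
  rewrite in_itv/= => /andP[q1 q2]; exists q.
  by rewrite distrC ltr_distl q1.
exists (\row_i sval (cid (h i))).
rewrite [ltLHS]/Num.norm/= mx_normrE; apply/bigmax_ltP; split=> // -[i j] _ /=.
by rewrite !mxE ord1; case: cid.
Qed.

End rational_points.

Section height.
Context {R : realType} (n : nat).

Lemma enorm_sqr (v : 'rV[R]_n) : enorm v ^+ 2 = \sum_i v ord0 i ^+ 2.
Proof. by rewrite /enorm sqr_sqrtr// sumr_ge0// => i _; rewrite sqr_ge0. Qed.

Definition height (w : 'rV[R]_n) (p : 'rV[R]_n * measurableTypeR R) : R :=
  enorm (w - p.1) ^+ 2 + p.2.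

Lemma measurable_height w : measurable_fun setT (height w).
Proof.
apply: measurable_funD; last exact: measurable_snd.
under eq_fun do rewrite enorm_sqr; apply: measurable_sum => i.
apply: measurable_funX; under eq_fun do rewrite !mxE.
apply: measurable_funB => //.
exact: measurableT_comp (measurable_coord i) measurable_fst.
Qed.

Lemma continuous_height p : continuous (height ^~ p).
Proof.
move=> w; rewrite /height; apply: (@cvgD _ _ _ (nbhs w)); last exact: (@cvg_cst R).
rewrite enorm_sqr; under eq_fun do rewrite enorm_sqr.
apply: (@cvg_big _ _ +%R 0 _ _ _ (nbhs w)) => [|i _]; first exact: add_continuous.
rewrite !mxE; under eq_fun do rewrite !mxE.
apply: (@continuous_comp _ _ _ (fun v : 'rV[R]_n => v ord0 i - p.1 ord0 i) (fun x => x ^+ 2)).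
  by apply: (@cvgB _ _ _ (nbhs w)); [exact: (@coord_continuous _ 1 n ord0 i w)|exact: cvg_cst].
exact: exprn_continuous.
Qed.

Definition cube m : set 'rV[R]_n := [set w | `|w| <= m%:R].

Lemma continuous_dist (f : 'rV[R]_n) : continuous (fun w : 'rV[R]_n => `|w - f|).
Proof.
move=> w; apply: (@cvg_norm _ _ _ (nbhs w)).
by apply: (@cvgB _ _ _ (nbhs w)); [exact: cvg_id|exact: cvg_cst].
Qed.

Lemma closed_norm_le (f : 'rV[R]_n) (r : R) : closed [set w | `|w - f| <= r].
Proof.
have := @closed_comp _ _ (fun w : 'rV[R]_n => `|w - f|) [set x | x <= r].
by apply=> [w _|]; [exact: continuous_dist|exact: closed_le].
Qed.

Lemma compact_cubeI m (G : set 'rV[R]_n) : closed G -> compact (cube m `&` G).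
Proof.
move=> cG; apply: bounded_closed_compact.
  exists m%:R; split=> // x mx w [wm _]/=; exact: le_trans wm (ltW mx).
apply: closedI => //; have := @closed_norm_le 0 m%:R.
by congr closed; apply/seteqP; split => w /=; rewrite subr0.
Qed.

End height.

Section enumerated_cells.
Context {R : realType} (n : nat) d (O : measurableType d).
Variables (D : nat -> set O) (q : nat -> O -> 'rV[R]_n * measurableTypeR R).
Hypothesis mD : forall i, measurable (D i).
Hypothesis mq : forall i, measurable_fun setT (q i).

Definition enumerated (o : O) : set ('rV[R]_n * R) := [set q i o | i in [set i | D i o]].

Definition cell i o : set 'rV[R]_n := laguerre_cell (enumerated o) (q i o).

Lemma cellE i o w :
  cell i o w <-> forall j, D j o -> height w (q i o) <= height w (q j o).
Proof.
split=> [c j Dj|c _ [j Dj <-]]; last exact: c.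
by apply: (c (q j o)); exists j.
Qed.

Lemma measurable_height_lt i j (w : 'rV[R]_n) e :
  measurable [set o | height w (q i o) < height w (q j o) + e].
Proof.
have mh k : measurable_fun setT (fun o => height w (q k o)).
  exact: measurableT_comp (measurable_height w) (mq k).
rewrite (_ : [set o | _] =
    setT `&` (fun o => height w (q i o) - height w (q j o)) @^-1` `]-oo, e[).
  exact: (measurable_funB (mh i) (mh j)).
by rewrite setTI; apply/seteqP; split=> o /=; rewrite in_itv/= ltrBlDl.
Qed.

(** Meeting a compact set is a closed condition, so it may be tested up to
    precision 1/(m+1) at rational points near K, against the first m + 1
    generators: near-witnesses for all m accumulate at a true witness. *)
Lemma cell_hit_compactE i K o : compact K ->
  (cell i o `&` K) !=set0 <-> forall m : nat, exists r : 'rV[rat]_n,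
    (exists2 k, K k & `|k - rational_point r| < m.+1%:R^-1) /\
    forall j : nat, (j <= m)%N -> D j o ->
      height (rational_point r) (q i o) <
      height (rational_point r) (q j o) + m.+1%:R^-1.
Proof.
move=> cK; split=> [[w [/cellE cw Kw]] m|H].
  have m0 : 0 < m.+1%:R^-1 :> R by rewrite invr_gt0.
  have : \forall v \near w, forall j : 'I_m.+1, D j o ->
      height v (q i o) < height v (q j o) + m.+1%:R^-1.
    apply: (@filter_forall _ _ (fun j : 'I_m.+1 => [set v | D j o ->
      height v (q i o) < height v (q j o) + m.+1%:R^-1]) (nbhs w)) => j.
    have [Dj|nDj] := pselect (D j o); last by near=> v.
    have c : {for w, continuous (fun v => height v (q i o) - height v (q j o))}.
      by apply: (@cvgB _ _ _ (nbhs w)); exact: continuous_height.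
    have : height w (q i o) - height w (q j o) < m.+1%:R^-1.
      by rewrite (le_lt_trans _ m0)// subr_le0 cw.
    move=> /(cvgr_lt _ c); apply: filterS => v hv _.
    by rewrite -ltrBlDl.
  move=> /nbhs_ballP[e /= e0 he].
  have [r wr] : exists r, `|w - rational_point r| < Num.min e m.+1%:R^-1.
    by apply: rational_point_dense; rewrite lt_min e0.
  move: wr; rewrite lt_min => /andP[we wm].
  exists r; split=> [|j jm Dj]; first by exists w.
  have : ball w e (rational_point r) by rewrite -ball_normE.
  by move=> /he /(_ (Ordinal (jm : (j < m.+1)%N))); exact.
have [r hr] := choice H.
have /choice[k hk] : forall m, exists k, K k /\ `|k - rational_point (r m)| < m.+1%:R^-1.
  by move=> m; have [[k Kk ?] _] := hr m; exists k.
(* A cluster point w of the witnesses lies in the cell: a generator j that won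
   at w by the margin 2 e would still win by e at all points close to w, where
   it can only win by 1/(m+1). *)
have [w [Kw clw]] : K `&` cluster (k m @[m --> \oo]) !=set0.
  by apply: cK; exists 0%N => // m _; exact: (hk m).1.
exists w; split=> //; apply/cellE => j Dj; rewrite leNgt; apply/negP => hji.
pose e := (height w (q i o) - height w (q j o)) / 2.
have e0 : 0 < e by rewrite divr_gt0// subr_gt0.
have c : {for w, continuous (fun v => height v (q i o) - height v (q j o))}.
  by apply: (@cvgB _ _ _ (nbhs w)); exact: continuous_height.
have : e < height w (q i o) - height w (q j o).
  by rewrite ltr_pdivrMr// mulr_natr mulr2n ltrDl subr_gt0.
move=> /(cvgr_gt _ c)/nbhs_ballP[e' /= e'0 he'].
have [M [Mj Me Me']] : exists M : nat,
    [/\ (j <= M)%N, M.+1%:R^-1 < e & M.+1%:R^-1 < e' / 2].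
  have e'20 : 0 < e' / 2 by rewrite divr_gt0.
  have : \forall M \near \oo, [/\ (j <= M)%N, M.+1%:R^-1 < e & M.+1%:R^-1 < e' / 2].
    near=> M; split; near: M; first exact: nbhs_infty_ge.
      exact: (near_infty_natSinv_lt (PosNum e0)).
    exact: (near_infty_natSinv_lt (PosNum e'20)).
  by case=> M _ /(_ M (leqnn M)); exists M.
have Fk : (k m @[m --> \oo]) (k @` [set m | (M <= m)%N]).
  by exists M => // m Mm; exists m.
have nw : nbhs w (ball w (e' / 2)) by apply: nbhsx_ballx; rewrite divr_gt0.
have [_ [[m /= Mm <-]]] := clw _ _ Fk nw.
rewrite -ball_normE/= => wk.
have mM : m.+1%:R^-1 <= M.+1%:R^-1 :> R by rewrite lef_pV2 ?posrE// ler_nat.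
have /he' : ball w e' (rational_point (r m)).
  rewrite -ball_normE/= [e']splitr.
  apply: le_lt_trans (ler_distD (k m) _ _) _; rewrite ltrD//.
  by rewrite (lt_trans (hk m).2)// (le_lt_trans mM).
have := (hr m).2 j (leq_trans Mj Mm) Dj.
rewrite -ltrBlDl => h1 /= h2; have := lt_trans h2 h1.
by apply/negP; rewrite -leNgt (le_trans mM)// ltW.
Unshelve. all: by end_near. Qed.

End enumerated_cells.

Section measurable_cells.
Context {R : realType} (n : nat) d (O : measurableType d).
Variables (D : nat -> set O) (q : nat -> O -> 'rV[R]_n * measurableTypeR R).
Hypothesis mD : forall i, measurable (D i).
Hypothesis mq : forall i, measurable_fun setT (q i).
Local Notation cell := (cell D q).

Lemma measurable_hit_compact i (K : set 'rV[R]_n) : compact K ->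
  measurable [set o | (cell i o `&` K) !=set0].
Proof.
move=> cK; rewrite (_ : [set o | _] = [set o | forall m : nat, exists r : 'rV[rat]_n,
    (exists2 k, K k & `|k - rational_point r| < m.+1%:R^-1) /\
    forall j : nat, (j <= m)%N -> D j o ->
      height (rational_point r) (q i o) <
      height (rational_point r) (q j o) + m.+1%:R^-1]); last first.
  by apply/seteqP; split=> o /(cell_hit_compactE _ _ _ _ cK).
apply: measurable_forall_pred => m; apply: measurable_exists_pred => r.
apply: measurable_and_pred; first exact: measurable_const_pred.
apply: measurable_forall_pred => j; apply: measurable_imply_pred; first exact: measurable_const_pred.
apply: measurable_imply_pred; first exact: mD.
exact: measurable_height_lt.
Qed.

Lemma bigcup_cube (w : 'rV[R]_n) : exists m, cube m w.
Proof.
by exists (Num.truncn `|w|).+1; rewrite /cube/= ltW// truncnS_gt.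
Qed.

Lemma measurable_hit_closed i (G : set 'rV[R]_n) : closed G ->
  measurable [set o | (cell i o `&` G) !=set0].
Proof.
move=> cG; rewrite (_ : [set o | _] =
    [set o | exists m : nat, (cell i o `&` (cube m `&` G)) !=set0]).
  by apply: measurable_exists_pred => m; apply/measurable_hit_compact/compact_cubeI.
apply/seteqP; split=> [ o [w [cw Gw]]|o [m [w [cw [_ Gw]]]]]; last by exists w.
by have [m cm] := bigcup_cube w; exists m, w.
Qed.

Lemma closed_dist_ge (f : 'rV[R]_n) (r : R) : closed [set w | r <= `|w - f|].
Proof.
have := @closed_comp _ _ (fun w : 'rV[R]_n => `|w - f|) [set x | r <= x].
by apply=> [w _|]; [exact: continuous_dist|exact: closed_ge].
Qed.

Lemma measurable_hit_ball i (f : 'rV[R]_n) r :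
  measurable [set o | exists2 w, cell i o w & `|w - f| < r].
Proof.
rewrite (_ : [set o | _] = [set o | exists m : nat,
    (cell i o `&` [set w | `|w - f| <= r - m.+1%:R^-1]) !=set0]).
  by apply: measurable_exists_pred => m; apply/measurable_hit_closed/closed_norm_le.
apply/seteqP; split=> [ o [w cw /= wr]|o [m [w [cw /= wm]]]]; last first.
  by exists w => //; rewrite (le_lt_trans wm)// ltrBlDr ltrDl invr_gt0.
have e0 : 0 < r - `|w - f| by rewrite subr_gt0.
have [M _ /(_ M (leqnn M)) /= h] := near_infty_natSinv_lt (PosNum e0).
by exists M, w; split=> //=; rewrite lerBrDl -lerBrDr ltW.
Qed.

Lemma closed_cell i o : closed (cell i o).
Proof.
rewrite (_ : cell i o = \bigcap_(j in [set j | D j o])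
    [set w | height w (q i o) - height w (q j o) <= 0]); last first.
  apply/seteqP; split=> w; first by move=> /cellE c j Dj /=; rewrite subr_le0; exact: c.
  by move=> c; apply/cellE => j Dj; have := c j Dj; rewrite /= subr_le0.
apply: closed_bigI => j _.
have := @closed_comp _ _ (fun w => height w (q i o) - height w (q j o)) [set x | x <= 0].
apply=> [w _|]; last exact: closed_le.
by apply: (@cvgB _ _ _ (nbhs w)); exact: continuous_height.
Qed.

(** Cells are closed, so a cell is compact once it avoids the complement of
    some large ball. *)
Lemma measurable_particles i : measurable [set o | particles (cell i o)].
Proof.
rewrite (_ : [set o | _] = [set o | (cell i o `&` setT) !=set0 /\ exists m : nat,
    ~ ((cell i o `&` [set w | m%:R <= `|w - 0|]) !=set0)]).
  apply: measurable_and_pred; first by apply: measurable_hit_closed; exact: closedT.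
  by apply: measurable_exists_pred => m; apply: measurable_not_pred; exact/measurable_hit_closed/closed_dist_ge.
apply/seteqP; split=> o; rewrite /particles/= setIT => -[c0 c1]; split=> //.
  have [M [_ cM]] := compact_bounded c1.
  exists (Num.truncn (M + 1)).+1 => -[w [cw]]/=; rewrite subr0; apply/negP.
  rewrite -ltNge (le_lt_trans _ (truncnS_gt _))//.
  by apply: cM => //; rewrite ltrDl.
have [m hm] := c1.
rewrite (_ : cell i o = cube m `&` cell i o); first exact/compact_cubeI/closed_cell.
apply/seteqP; split=> w; last by case.
move=> cw; split=> //; rewrite /cube/= leNgt; apply/negP => mw.
by apply: hm; exists w; split => //=; rewrite subr0 ltW.
Qed.

(** A closed set is determined by the rational balls that it meets. *)
Lemma measurable_eq_cell i j : measurable [set o | cell i o = cell j o].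
Proof.
pose hits i (f : 'rV[rat]_n) (k : nat) o :=
  exists2 w, cell i o w & `|w - rational_point f| < k.+1%:R^-1.
rewrite (_ : [set o | _] = [set o | forall f k,
    (hits i f k o -> hits j f k o) /\ (hits j f k o -> hits i f k o)]).
  by do 2! (apply: measurable_forall_pred => ?); apply: measurable_and_pred;
    apply: measurable_imply_pred; exact: measurable_hit_ball.
apply/seteqP; split=> o /=; first by rewrite /hits => -> f k; split.
have sub i' j' : (forall f k, hits i' f k o -> hits j' f k o) -> cell i' o `<=` cell j' o.
  move=> h w cw; have := @closed_cell j' o; rewrite closure_id => ->.
  move=> A /nbhs_ballP[e /= e0 eA].
  have e20 : 0 < e / 2 by rewrite divr_gt0.
  have [k _ /(_ k (leqnn k)) /= ke] := near_infty_natSinv_lt (PosNum e20).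
  have k0 : 0 < k.+1%:R^-1 :> R by rewrite invr_gt0.
  have [f wf] := rational_point_dense w k0.
  have [v cv vf] : hits j' f k o by apply: h; exists w.
  exists v; split=> //; apply: eA; rewrite -ball_normE/= [e]splitr.
  apply: le_lt_trans (ler_distD (rational_point f) _ _) _.
  by rewrite ltrD// ?(lt_trans wf)// distrC (lt_trans vf).
by move=> h; apply/seteqP; split; apply: sub => f k; [exact: (h f k).1|exact: (h f k).2].
Qed.

(** Two sets netted by the same F are close in Hausdorff distance, and there
    are countably many F: this is how countably many hit events generate the
    Borel sets of the Hausdorff metric. *)
Definition netted (F : seq 'rV[rat]_n) (k : nat) : set (set 'rV[R]_n) :=
  [set C | [/\ particles C,
    forall w, C w -> exists2 f, f \in F & `|w - rational_point f| < k.+1%:R^-1 &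
    forall f, f \in F -> exists2 w, C w & `|w - rational_point f| < k.+1%:R^-1]].

Lemma measurable_netted F k i : measurable [set o | netted F k (cell i o)].
Proof.
rewrite (_ : [set o | _] = [set o | (particles (cell i o) /\
   ~ ((cell i o `&` \bigcap_(f in [set f | f \in F])
       [set w | k.+1%:R^-1 <= `|w - rational_point f|]) !=set0)) /\
   forall f, f \in F ->
     exists2 w, cell i o w & `|w - rational_point f| < k.+1%:R^-1]).
  apply: measurable_and_pred.
    apply: measurable_and_pred; first exact: measurable_particles.
    apply: measurable_not_pred; apply: measurable_hit_closed; apply: closed_bigI => f _.
    exact: closed_dist_ge.
  apply: measurable_forall_pred => f; apply: measurable_imply_pred; first exact: measurable_const_pred.
  exact: measurable_hit_ball.
apply/seteqP; split=> o [].
  move=> pc c1 c2; split=> //; split=> // -[w [cw wF]].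
  have [f fF] := c1 _ cw; apply/negP; rewrite -leNgt; exact: wF.
move=> [pc c1] c2; split=> // w cw; apply: contrapT => nf; apply: c1.
exists w; split => // f /= fF; rewrite leNgt; apply/negP => wf.
by apply: nf; exists f.
Qed.

End measurable_cells.

Section hausdorff.
Context {R : realType} (n : nat).

Lemma enorm_le_norm (v : 'rV[R]_n) : enorm v <= n.+1%:R * `|v|.
Proof.
have n0 : 0 <= n.+1%:R * `|v| by rewrite mulr_ge0.
rewrite /enorm -[leRHS](ger0_norm n0) -sqrtr_sqr ler_wsqrtr//.
have vi i : v ord0 i ^+ 2 <= `|v| ^+ 2.
  rewrite -real_normK ?num_real// lerXn2r ?nnegrE//.
  rewrite [leRHS]/Num.norm/= mx_normrE.
  by apply/bigmax_geP; right; exists (ord0, i).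
apply: (@le_trans _ _ (\sum_(i < n) `|v| ^+ 2)); first exact: ler_sum.
rewrite sumr_const card_ord -[leLHS]mulr_natl exprMn ler_wpM2r ?sqr_ge0//.
by rewrite -natrX ler_nat (leq_trans (leqnSn n))// leq_pmulr.
Qed.

Lemma hausdorff_dist_netted F k (C D : set 'rV[R]_n) : netted F k C -> netted F k D ->
  hausdorff_dist C D <= n.+1%:R * (k.+1%:R^-1 + k.+1%:R^-1).
Proof.
have sub (A B : set 'rV[R]_n) x : netted F k A -> netted F k B -> A x ->
    exists2 y, B y & enorm (x - y) <= n.+1%:R * (k.+1%:R^-1 + k.+1%:R^-1).
  move=> [_ AF _] [_ _ FB] /AF[f /FB[y By yf] xf]; exists y => //.
  apply: le_trans (enorm_le_norm _) _; rewrite ler_wpM2l//.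
  by apply: le_trans (ler_distD (rational_point f) _ _) _; rewrite lerD// ?ltW// distrC.
have enormB (x y : 'rV[R]_n) : enorm (x - y) = enorm (y - x).
  by congr Num.sqrt; apply: eq_bigr => i _; rewrite !mxE -sqrrN opprB.
move=> FC FD; apply: ge_inf; first by exists 0 => e [].
split=> [|x Cx|y Dy]; first by rewrite mulr_ge0// addr_ge0.
  exact: sub Cx.
by have [x Cx xy] := sub _ _ _ FD FC Dy; exists x; rewrite // enormB.
Qed.

Lemma particles_netted k (C : set 'rV[R]_n) : particles C -> exists F, netted F k C.
Proof.
move=> pC; have [_] := pC; rewrite compact_cover => cC.
have k0 : 0 < k.+1%:R^-1 :> R by rewrite invr_gt0.
have [|w Cw|F _ CF] := cC _ [set: 'rV[rat]_n] (fun f => ball (rational_point f) k.+1%:R^-1).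
- by move=> f _; exact: ball_open.
- have [f wf] := rational_point_dense w k0.
  by exists f => //; rewrite -ball_normE/= distrC.
exists [seq f <- finmap.enum_fset F | `[< exists2 w, C w & `|w - rational_point f| < k.+1%:R^-1 >]].
split=> // [w Cw|f]; last by rewrite mem_filter => /andP[/asboolP].
have [f fF] := CF _ Cw; rewrite -ball_normE/= distrC => wf; exists f => //.
by rewrite mem_filter; apply/andP; split=> //; apply/asboolP; exists w.
Qed.

(** The netted classes form a countable basis of the space of particles. *)
Lemma hausdorff_open_netted (U : set (set 'rV[R]_n)) : hausdorff_open U ->
  U = [set C | exists F k, netted F k `<=` U /\ netted F k C].
Proof.
move=> [UP oU]; apply/seteqP; split=> C; last by move=> [F [k [FU /FU]]].
move=> UC; have [e e0 eU] := oU C UC.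
have e20 : 0 < e / (n.+1%:R * 2) by rewrite divr_gt0// mulr_gt0.
have [k _ /(_ k (leqnn k)) /= ke] := near_infty_natSinv_lt (PosNum e20).
have [F FC] := particles_netted k (UP _ UC).
exists F, k; split=> // D FD; apply: eU; first by case: FD.
apply: le_lt_trans (hausdorff_dist_netted FC FD) _.
by rewrite -mulr2n -[X in _ * X]mulr_natr mulrCA -ltr_pdivlMr // mulr_gt0.
Qed.

End hausdorff.

Section measurable_laguerre.
Context {R : realType} (n : nat) d (O : measurableType d).
Variables (D : nat -> set O) (q : nat -> O -> 'rV[R]_n * measurableTypeR R).
Hypothesis mD : forall i, measurable (D i).
Hypothesis mq : forall i, measurable_fun setT (q i).
Local Notation cell := (cell D q).

Lemma measurable_cell_borel i A : particle_borel A ->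
  measurable [set o | A (cell i o)].
Proof.
move: A; apply: smallest_sub.
  split=> /= [|A mA|F mF]; first exact: measurable_const_pred.
    apply: measurable_and_pred; first exact: measurable_particles.
    exact: measurable_not_pred.
  rewrite (_ : [set o | _] = [set o | exists k, F k (cell i o)]).
    exact: measurable_exists_pred.
  by apply/seteqP; split=> o [k]; [exists k|exists k].
move=> U /= /hausdorff_open_netted ->.
apply: measurable_exists_pred => F; apply: measurable_exists_pred => k.
apply: measurable_and_pred; first exact: measurable_const_pred.
exact: measurable_netted.
Qed.

(** Several indices may enumerate the same generator, and distinct generators
    may have the same cell; each cell is counted at its first index. *)
Definition leading (A : set (set 'rV[R]_n)) (o : O) : set nat :=
  [set i | [/\ D i o, (cell i o) !=set0, A (cell i o) &
    forall j, (j < i)%N -> D j o -> cell j o <> cell i o]].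

Lemma laguerre_leading A o :
  laguerre (enumerated D q o) `&` A = cell ^~ o @` leading A o.
Proof.
apply/seteqP; split=> [C [[C0 [_ [i Di <-] CE]] AC]|_ [i [Di c0 Ac _] <-]]; last first.
  by split=> //; split=> //; exists (q i o) => //; exists i.
have ex : exists i, `[< D i o /\ cell i o = C >] by exists i; apply/asboolP.
case: (ex_minnP ex) => m /asboolP[Dm mC] mmin; exists m => //.
split=> //; rewrite ?mC// => j jm Dj jC.
suff : (m <= j)%N by rewrite leqNgt jm.
by apply: mmin; apply/asboolP; split=> //; rewrite jC.
Qed.

Lemma leading_inj A o : {in leading A o &, injective (cell ^~ o)}.
Proof.
move=> i j /set_mem[Di _ _ hi] /set_mem[Dj _ _ hj] ij.
by have [ij'|ij'|//] := ltngtP i j; [case: (hj _ ij')|case: (hi _ ij')].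
Qed.

Lemma counting_card_eq (T U : choiceType) (A : set T) (B : set U) : (A #= B)%card ->
  counting A = counting B :> \bar R.
Proof.
move=> AB; rewrite /counting; have -> : `[< finite_set A >] = `[< finite_set B >].
  by apply: asbool_equiv_eq; split; rewrite (eq_finite_set AB).
case: asboolP => // /finite_setP[k Bk].
by rewrite !(card_fset_set (n := k))// (card_eq_trans AB).
Qed.

Lemma measurable_counting_cells A : particle_borel A ->
  measurable_fun setT
    (fun o => counting (laguerre (enumerated D q o) `&` A) : \bar R).
Proof.
move=> bA; under eq_fun do
  rewrite laguerre_leading (counting_card_eq (inj_card_eq (@leading_inj _ _))) counting_dirac.
apply: ge0_emeasurable_sum => // i _.
have mi : measurable [set o | leading A o i].
  rewrite (_ : [set o | _] = [set o | (D i o /\ (cell i o `&` setT) !=set0) /\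
      A (cell i o) /\ forall j, (j < i)%N -> D j o -> ~ cell j o = cell i o]).
    apply: measurable_and_pred.
      apply: measurable_and_pred; first exact: mD.
      by apply: measurable_hit_closed => //; exact: closedT.
    apply: measurable_and_pred; first exact: measurable_cell_borel.
    apply: measurable_forall_pred => j; apply: measurable_imply_pred.
      exact: measurable_const_pred.
    apply: measurable_imply_pred; first exact: mD.
    by apply: measurable_not_pred; exact: measurable_eq_cell.
  apply/seteqP; split=> o; rewrite /= setIT; first by move=> [? ? ? ?]; split; split.
  by move=> [[? ?] [? ?]]; split.
rewrite (_ : (fun o => _) = (EFin \o \1_[set o | leading A o i])).
  by apply/measurable_EFinP; exact: measurable_indic.
apply/funext => o; rewrite /= diracE indicE.
by congr (_%:R%:E); apply/idP/idP => /set_mem h; exact/mem_set.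
Qed.

Lemma measurable_laguerre (E : set (set (set 'rV[R]_n))) :
  process_events E -> measurable [set o | E (laguerre (enumerated D q o))].
Proof.
move: E; apply: smallest_sub.
  split=> /= [|A mA|F mF]; first exact: measurable_const_pred.
    rewrite (_ : [set o | _] = [set o | ~ A (laguerre (enumerated D q o))]).
      exact: measurable_not_pred.
    by apply/seteqP; split=> o //= -[].
  rewrite (_ : [set o | _] = [set o | exists k, F k (laguerre (enumerated D q o))]).
    exact: measurable_exists_pred.
  by apply/seteqP; split=> o [k]; [exists k|exists k].
move=> _ [A bA [B mB <-]] /=; rewrite -[X in measurable X]setTI.
exact: measurable_counting_cells.
Qed.

End measurable_laguerre.

(** * Void probabilities determine the law of a random set *)
Section configurations.
Context dT (T : measurableType dT).

(** Missing B and missing C is missing their union: the void events are a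
    pi-system, on which a law is determined. *)
Definition voids : set (set (set T)) :=
  [set [set Y | Y `&` B = set0] | B in measurable].

Definition config := g_sigma_algebraType voids.

Lemma measurable_hits (B : set T) : measurable B ->
  measurable [set Y : config | (Y `&` B) !=set0].
Proof.
move=> mB; rewrite (_ : [set Y | _] = ~` [set Y : config | Y `&` B = set0]).
  by apply: measurableC; apply: sub_sigma_algebra; exists B.
by apply/seteqP; split=> Y /=; [move=> /set0P/eqP|move=> /eqP/set0P].
Qed.

Section random_configuration.
Context {R : realType} d (O : measurableType d).
Variable X : O -> config.
Hypothesis mX : forall B, measurable B -> measurable [set o | X o `&` B = set0].

Lemma measurable_config : measurable_fun setT X.
Proof.
move=> _ V mV; rewrite setTI; move: V mV; apply: smallest_sub.
  split=> /= [|V mV|F mF]; first by rewrite preimage_set0.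
    by rewrite setTD preimage_setC; exact: measurableC.
  by rewrite preimage_bigcup; exact: bigcupT_measurable.
by move=> _ [B mB <-]; exact: mX.
Qed.

End random_configuration.

Lemma eq_law_config {R : realType} d1 (O1 : measurableType d1) (P1 : probability O1 R)
    d2 (O2 : measurableType d2) (P2 : probability O2 R)
    (X1 : O1 -> config) (X2 : O2 -> config) :
  (forall B, measurable B -> measurable [set o | X1 o `&` B = set0]) ->
  (forall B, measurable B -> measurable [set o | X2 o `&` B = set0]) ->
  (forall B, measurable B ->
    P1 [set o | X1 o `&` B = set0] = P2 [set o | X2 o `&` B = set0]) ->
  forall V : set config, measurable V -> P1 (X1 @^-1` V) = P2 (X2 @^-1` V).
Proof.
move=> m1 m2 P12 V mV.
have mX1 := measurable_config m1; have mX2 := measurable_config m2.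
apply: (@measure_unique _ R config voids (fun=> setT) erefl _ _ _
  (measure_function_pushforward__canonical__measure_function_Measure P1 mX1)
  (measure_function_pushforward__canonical__measure_function_Measure P2 mX2)) => //.
- move=> _ _ [B mB <-] [C mC <-]; exists (B `|` C); first exact: measurableU.
  apply/seteqP; split=> Y /=; first by rewrite setIUr setU_eq0.
  by rewrite setIUr setU_eq0.
- by exists set0 => //; apply/seteqP; split=> Y //= _; rewrite setI0.
- by rewrite bigcup_const.
- by move=> _ [B mB <-]; exact: P12.
- by move=> k; rewrite /= /pushforward preimage_setT probability_setT ltry.
Qed.

End configurations.

Section singled_out_points.
Context dT (T : measurableType dT).
Variable A : nat -> set T.

(** The points of Y that some A i isolates.  They depend measurably on Y for
    every Y, whereas Y itself can only be enumerated when it is discrete. *)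
Definition singled_out (Y : set T) : set T := [set p | exists i, Y `&` A i = [set p]].

Definition isolating (Y : set T) : Prop := Y `<=` singled_out Y.

Lemma singled_out_id Y : isolating Y -> singled_out Y = Y.
Proof.
move=> dY; apply/seteqP; split=> // p [i Yi].
by have [] : (Y `&` A i) p by rewrite Yi.
Qed.

Hypothesis mA : forall i, measurable (A i).
Hypothesis sepA : forall p q, p <> q ->
  exists i j, [/\ A i p, A j q & A i `&` A j = set0].

Definition single i : set (config T) := [set Y | exists p, Y `&` A i = [set p]].

Definition pt i (Y : config T) : T := get [set p | Y `&` A i = [set p]].

Lemma ptE i Y p : Y `&` A i = [set p] -> pt i Y = p.
Proof.
move=> Yp; have : single i Y by exists p.
by move=> /getPex /=; rewrite -/(pt i Y) Yp => /seteqP[_ /(_ _ erefl)] /esym.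
Qed.

(** Y has at most one point in A i if and only if no two disjoint members of
    the separating family both meet the part of Y in A i. *)
Lemma measurable_single i : measurable (single i).
Proof.
rewrite (_ : single i = [set Y : config T | (Y `&` A i) !=set0 /\
    forall j k, A j `&` A k = set0 ->
      ~ ((Y `&` (A i `&` A j)) !=set0 /\ (Y `&` (A i `&` A k)) !=set0)]).
  apply: measurable_and_pred; first exact: measurable_hits.
  do 2! apply: measurable_forall_pred => ?.
  apply: measurable_imply_pred; first exact: measurable_const_pred.
  apply: measurable_not_pred; apply: measurable_and_pred;
    by apply: measurable_hits; exact: measurableI.
apply/seteqP; split=> [Y [p Yp]|Y [[p Yp] sY]].
  split=> [|j k jk [[a]]]; first by exists p; rewrite Yp.
  rewrite setIA Yp => -[/= -> Ajp] [b]; rewrite setIA Yp => -[/= -> Akp].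
  by have : (A j `&` A k) p by []; rewrite jk.
exists p; apply/seteqP; split=> [q [Yq Aq]|_ ->//]; apply: contrapT => /= /sepA.
move=> [j [k [jq kp jk]]]; apply: (sY j k) => //; split; first by exists q.
by case: Yp => Yp Ap; exists p.
Qed.

(** On the event that A i isolates a point of Y, this point is in B exactly when
    Y meets both A i and B at once; elsewhere [pt] has a fixed default value. *)
Lemma measurable_pt i : measurable_fun setT (pt i).
Proof.
move=> _ B mB; rewrite setTI; rewrite (_ : _ @^-1` _ = [set Y |
    (single i Y /\ (Y `&` (A i `&` B)) !=set0) \/
    (~ single i Y /\ B point)]).
  apply: measurable_or_pred; apply: measurable_and_pred.
  - exact: measurable_single.
  - by apply: measurable_hits; exact: measurableI.
  - by apply: measurable_not_pred; exact: measurable_single.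
  - exact: measurable_const_pred.
apply/seteqP; split=> Y /=.
  have [[p Yp]|nY] := pselect (single i Y).
    rewrite (ptE Yp) => Bp; left; split; first by exists p.
    by exists p; rewrite setIA Yp.
  have -> : pt i Y = point by apply: getPN => p Yp; apply: nY; exists p.
  by right.
move=> [[[p Yp] [q]]|[nY Bp]]; last first.
  by have -> : pt i Y = point by apply: getPN => p Yp; apply: nY; exists p.
by rewrite setIA Yp (ptE Yp) => -[/= ->].
Qed.

Lemma singled_outE (Y : config T) : singled_out Y = [set pt i Y | i in [set i | single i Y]].
Proof.
apply/seteqP; split=> [p [i Yi]|_ [i [p Yi] <-]].
  by exists i; [exists p|exact: ptE].
by exists i; rewrite (ptE Yi).
Qed.

Context {R : realType} (n : nat) (phi : T -> 'rV[R]_n * measurableTypeR R).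
Hypothesis mphi : measurable_fun setT phi.

Lemma measurable_laguerre_singled_out E : process_events E ->
  measurable [set Y : config T | E (laguerre (phi @` singled_out Y))].
Proof.
move=> pE; rewrite (_ : [set Y : config T | _] =
    [set Y | E (laguerre (enumerated single (fun i => phi \o pt i) Y))]).
  apply: measurable_laguerre pE => i; first exact: measurable_single.
  exact: measurableT_comp mphi (measurable_pt i).
apply/seteqP; split=> Y /=; by rewrite singled_outE /enumerated image_comp.
Qed.

End singled_out_points.

Section law_of_laguerre.
Context {R : realType} (n : nat).
Local Notation S := ('rV[R]_n * measurableTypeR R)%type.
Context dT (T : measurableType dT) (A : nat -> set T) (A' : nat -> set S).
Hypothesis mA : forall i, measurable (A i).
Hypothesis sepA : forall p q, p <> q ->
  exists i j, [/\ A i p, A j q & A i `&` A j = set0].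
Hypothesis mA' : forall i, measurable (A' i).
Hypothesis sepA' : forall p q, p <> q ->
  exists i j, [/\ A' i p, A' j q & A' i `&` A' j = set0].
Variables (phi : T -> S) (E' : set S).
Hypothesis mphi : measurable_fun setT phi.
Hypothesis mE' : measurable E'.
Context d1 (O1 : measurableType d1) (P1 : probability O1 R).
Context d2 (O2 : measurableType d2) (P2 : probability O2 R).
Variables (X1 : O1 -> set T) (X2 : O2 -> set S).
Hypothesis mX1 : forall B, measurable B -> measurable [set o | X1 o `&` B = set0].
Hypothesis mX2 : forall B, measurable B -> measurable [set o | X2 o `&` B = set0].
Hypothesis isoX1 : forall o, isolating A (X1 o).
Hypothesis isoX2 : forall o, isolating A' (X2 o).
Hypothesis P12 : forall B, measurable B ->
  P1 [set o | X1 o `&` phi @^-1` (B `&` E') = set0] = P2 [set o | X2 o `&` B = set0].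
Hypothesis aeX1 : {ae P1, forall o, isolating A' (phi @` X1 o `&` E') /\
  laguerre (phi @` X1 o) = laguerre (phi @` X1 o `&` E')}.

(** The image of X1 under phi is compared with X2 after restriction to E', since
    only there must it be discrete and have the void probabilities of X2; points
    of the image outside E' are assumed to have no influence on the diagram. *)
Lemma laguerre_same_law (E : set (set (set 'rV[R]_n))) : process_events E ->
  [/\ measurable [set o | E (laguerre (phi @` X1 o))],
      measurable [set o | E (laguerre (X2 o))] &
      P1 [set o | E (laguerre (phi @` X1 o))] = P2 [set o | E (laguerre (X2 o))]].
Proof.
move=> pE.
have m1 : measurable [set o | E (laguerre (phi @` X1 o))].
  have := measurable_config mX1 measurableT (measurable_laguerre_singled_out mA sepA mphi pE).
  rewrite setTI; congr measurable; apply/seteqP; split=> o /=;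
    by rewrite singled_out_id.
pose V : set (config S) := [set Y | E (laguerre (idfun @` singled_out A' Y))].
have mV : measurable V by apply: (measurable_laguerre_singled_out mA' sepA' _ pE) => x; exact: measurable_id.
have VE (Y : set S) : isolating A' Y -> V Y = E (laguerre Y).
  by move=> iY; rewrite /V/= singled_out_id// image_id.
have m2E : [set o | E (laguerre (X2 o))] = X2 @^-1` V.
  by apply/seteqP; split=> o /=; rewrite VE.
have m2 : measurable [set o | E (laguerre (X2 o))].
  by rewrite m2E -[X in measurable X]setTI; exact: (measurable_config mX2).
split=> //.
pose Y o : config S := phi @` X1 o `&` E'.
have mphi' B : measurable B -> measurable (phi @^-1` B).
  by move=> mB; rewrite -[X in measurable X]setTI; exact: mphi.
have YE B : [set o | Y o `&` B = set0] = [set o | X1 o `&` phi @^-1` (B `&` E') = set0].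
  apply/seteqP; split=> o /=; rewrite /Y => YB.
    rewrite -subset0 => p [Xp [Bp Ep]].
    by have : (phi @` X1 o `&` E' `&` B) (phi p) by []; rewrite YB.
  rewrite -subset0 => _ [[[p Xp <-] Ep] Bp].
  by have : (X1 o `&` phi @^-1` (B `&` E')) p by []; rewrite YB.
have mY B : measurable B -> measurable [set o | Y o `&` B = set0].
  by move=> mB; rewrite YE; apply/mX1/mphi'/measurableI.
have PYV : P1 (Y @^-1` V) = P2 (X2 @^-1` V).
  by apply: eq_law_config mV => // B mB; rewrite YE P12.
have mYV : measurable (Y @^-1` V).
  by rewrite -[X in measurable X]setTI; exact: (measurable_config mY).
case: aeX1 => N [mN N0 hN].
have NE (B : set O1) : measurable B -> P1 B = P1 (B `\` N).
  move=> mB; rewrite (measureDI P1 mB mN).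
  rewrite (@subset_measure0 _ _ _ P1 (B `&` N) N) ?adde0//; exact: measurableI.
rewrite m2E -PYV (NE _ m1) (NE _ mYV); congr (P1 _).
have YL o : ~ N o -> V (Y o) = E (laguerre (phi @` X1 o)).
  move=> No; have [iY ->] : isolating A' (Y o) /\ laguerre (phi @` X1 o) = laguerre (Y o).
    by apply: contrapT => h; apply/No/hN.
  by rewrite VE.
by apply/seteqP; split=> o [h No]; split=> //; move: h; rewrite /= YL.
Qed.

End law_of_laguerre.

(** * A countable base of measurable neighbourhoods *)
Section base.
Context {R : realType} (n : nat).
Local Notation S := ('rV[R]_n * measurableTypeR R)%type.

Definition near_pt (p z : S) (r : R) : Prop := `|p.1 - z.1| < r /\ `|(p.2 : R) - z.2| < r.

Lemma near_pt_sym p z r : near_pt p z r -> near_pt z p r.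
Proof. by rewrite /near_pt !(distrC p.1) !(distrC (p.2 : R)). Qed.

Lemma near_pt_trans p z q r s : near_pt p z r -> near_pt z q s -> near_pt p q (r + s).
Proof.
move=> [pz1 pz2] [zq1 zq2]; split.
  by apply: le_lt_trans (ler_distD z.1 _ _) _; rewrite ltrD.
by apply: le_lt_trans (ler_distD (z.2 : R) _ _) _; rewrite ltrD.
Qed.

Lemma near_pt_le p z r s : r <= s -> near_pt p z r -> near_pt p z s.
Proof. by move=> rs [? ?]; split; apply: lt_le_trans rs. Qed.

Lemma near_pt_neq p q : p <> q -> exists2 r, 0 < r & ~ near_pt p q r.
Proof.
move=> pq; have [p1|p1] := eqVneq p.1 q.1; last first.
  exists `|p.1 - q.1|; first by rewrite normr_gt0 subr_eq0.
  by case; rewrite ltxx.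
exists `|(p.2 : R) - q.2|; last by case; rewrite ltxx.
rewrite normr_gt0 subr_eq0; apply/eqP => p2; apply: pq.
by case: p q p1 p2 => [? ?] [? ?] /= -> ->.
Qed.

Definition base (i : nat) : set S :=
  if unpickle i is Some (c, a, k) then
    [set z | near_pt (rational_point c, ratr a : R) z k.+1%:R^-1]
  else set0.

Lemma measurable_norm_lt (f : 'rV[R]_n) (r : R) : measurable [set w : 'rV[R]_n | `|f - w| < r].
Proof.
have [r0|r0] := ltP 0 r; last first.
  rewrite (_ : [set w | _] = set0)//; apply/seteqP; split=> // w /=.
  by rewrite ltNge (le_trans r0).
rewrite (_ : [set w | _] = [set w : 'rV[R]_n | forall i : 'I_n, `|f ord0 i - w ord0 i| < r]); last first.
  apply/seteqP; split=> w /=.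
    rewrite [X in X < _]/Num.norm/= mx_normrE => /bigmax_ltP[_ h] i.
    by have := h (ord0, i) isT; rewrite /= !mxE.
  move=> h; rewrite [X in X < _]/Num.norm/= mx_normrE; apply/bigmax_ltP; split=> // -[i j] _.
  by rewrite /= !mxE ord1.
apply: measurable_forall_pred => i.
have mf : measurable_fun setT (fun w : 'rV[R]_n => `|f ord0 i - w ord0 i|).
  apply: measurableT_comp; first exact: normr_measurable.
  by apply: measurable_funB => //; exact: measurable_coord.
rewrite (_ : [set w | _] = setT `&` (fun w : 'rV[R]_n => `|f ord0 i - w ord0 i|) @^-1` `]-oo, r[).
  exact: mf.
by rewrite setTI; apply/seteqP; split=> w /=; rewrite in_itv.
Qed.

Lemma measurable_near_pt p r : measurable [set z : S | near_pt p z r].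
Proof.
apply: measurable_and_pred.
  rewrite -[X in measurable X]setTI.
  by apply: (measurable_fst _ _ (measurable_norm_lt p.1 r)).
have mf : measurable_fun setT (fun z : S => `|(p.2 : R) - z.2|).
  apply: measurableT_comp; first exact: normr_measurable.
  by apply: measurable_funB => //; exact: measurable_snd.
rewrite (_ : [set z | _] = setT `&` (fun z : S => `|(p.2 : R) - z.2|) @^-1` `]-oo, r[).
  exact: mf.
by rewrite setTI; apply/seteqP; split=> w /=; rewrite in_itv.
Qed.

Lemma measurable_base i : measurable (base i).
Proof.
by rewrite /base; case: unpickle => [[[c a] k]|]; [exact: measurable_near_pt|].
Qed.

Lemma base_nbhs p r : 0 < r ->
  exists i, base i p /\ base i `<=` [set z | near_pt p z r].
Proof.
move=> r0; have r20 : 0 < r / 2 by rewrite divr_gt0.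
have [k _ /(_ k (leqnn k)) /= kr] := near_infty_natSinv_lt (PosNum r20).
have k0 : 0 < k.+1%:R^-1 :> R by rewrite invr_gt0.
have [c pc] := rational_point_dense p.1 k0.
have /rat_in_itvoo[a] : (p.2 : R) - k.+1%:R^-1 < (p.2 : R) + k.+1%:R^-1.
  by rewrite ltrBlDr -addrA ltrDl addr_gt0.
rewrite in_itv/= => /andP[a1 a2].
have pca : near_pt (rational_point c, ratr a : R) p k.+1%:R^-1.
  by split=> /=; [rewrite distrC|rewrite ltr_distl a2 andbT].
exists (pickle (c, a, k)); rewrite /base pickleK; split=> // z cz.
apply: near_pt_le (near_pt_trans (near_pt_sym pca) cz).
by rewrite [leRHS]splitr lerD// ltW.
Qed.

Lemma base_separates p q : p <> q ->
  exists i j, [/\ base i p, base j q & base i `&` base j = set0].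
Proof.
move=> /near_pt_neq[r r0 pq]; have r20 : 0 < r / 2 by rewrite divr_gt0.
have [i [ip ir]] := base_nbhs p r20; have [j [jq jr]] := base_nbhs q r20.
exists i, j; split=> //; rewrite -subset0 => z [/ir pz /jr qz]; apply: pq.
by rewrite [r]splitr; apply: near_pt_trans pz _; exact: near_pt_sym.
Qed.

Lemma isolating_base (X : set S) :
  (forall p, X p -> exists2 r, 0 < r & finite_set (X `&` [set z | near_pt p z r])) ->
  isolating base X.
Proof.
move=> hX p Xp; have [r r0 fX] := hX p Xp.
have [s s0 hs] : exists2 s, 0 < s & forall z, X z -> near_pt p z r -> near_pt p z s -> z = p.
  have [F FE] : exists F : seq S, forall z, X z -> near_pt p z r -> z \in F.
    move/finite_seqP : fX => [F FE]; exists F => z Xz pz.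
    by have : (X `&` [set z | near_pt p z r]) z by []; rewrite FE.
  suff [s s0 hs] : exists2 s, 0 < s & forall z, z \in F -> near_pt p z s -> z = p.
    by exists s => // z Xz pz; apply/hs/FE.
  elim: F {FE} => [|z F [s s0 hs]]; first by exists 1.
  have [->|zp] := pselect (z = p).
    by exists s => // y; rewrite inE => /orP[/eqP -> //|]; exact: hs.
  have [t t0 zt] := near_pt_neq zp.
  exists (Num.min s t); first by rewrite lt_min s0.
  move=> y; rewrite inE => /orP[/eqP -> yz|yF yz].
    exfalso; apply/zt/near_pt_sym; apply: near_pt_le yz.
    by rewrite ge_min lexx orbT.
  by apply: hs => //; apply: near_pt_le yz; rewrite ge_min lexx.
have rs0 : 0 < Num.min r s by rewrite lt_min r0.
have [i [ip iX]] := base_nbhs p rs0; exists i.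
apply/seteqP; split=> [z [Xz /iX pz]|_ ->//].
by apply: hs => //; apply: near_pt_le pz; rewrite ge_min lexx ?orbT.
Qed.

(** Local finiteness refers to compact sets of points with heights in J, so J
    has to be locally compact for each point to have a neighbourhood with
    finitely many others. *)
Lemma locally_finite_isolating (J : set R) (X : set S) :
  (forall t, J t -> exists2 r, 0 < r & compact (J `&` `[t - r, t + r])) ->
  @locally_finite_in ('rV[R]_n * R)%type [set z | J z.2] X ->
  isolating base X.
Proof.
move=> hJ [XJ fX]; apply: isolating_base => p Xp.
have [r r0 cJ] := hJ _ (XJ _ Xp); exists r => //.
pose K : set ('rV[R]_n * R)%type := [set w | `|w - p.1| <= r] `*` (J `&` `[(p.2 : R) - r, (p.2 : R) + r]).
have : finite_set (X `&` K).
  apply: fX => [|z [_ [Jz _]]//]; apply: compact_setX => //.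
  apply: bounded_closed_compact; last exact: closed_norm_le.
  exists (`|p.1| + r); split; first exact: num_real.
  move=> x rx w /= wp; apply: le_trans (ltW rx).
  by rewrite -[w](subrK p.1) addrC (le_trans (ler_normD _ _))// lerD2l.
apply: sub_finite_set => z [Xz [pz1 pz2]]; split=> //; split=> /=.
  by rewrite distrC ltW.
split; first exact: XJ.
by rewrite in_itv/= -ler_distl distrC ltW.
Qed.

End base.

(** * Sections as foldings of the generators *)
Section folding.
Context {R : realType}.
Local Notation S n := ('rV[R]_n * measurableTypeR R)%type.

Definition init n (v : 'rV[R]_n.+1) : 'rV[R]_n := \row_i v ord0 (widen_ord (leqnSn n) i).

Definition fold1 n (z : S n.+1) : S n := (init z.1, (z.2 : R) + z.1 ord0 ord_max ^+ 2).

(** Coordinates are dropped from the last one on, because R^l is embedded as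
    the span of the first l coordinates. *)
Fixpoint fold l k : S (k + l) -> S l :=
  if k is k'.+1 then fun z => fold (@fold1 (k' + l) z) else id.

Lemma measurable_init n : measurable_fun setT (@init n).
Proof.
apply: measurable_fun_rV => i; under eq_fun do rewrite mxE; exact: measurable_coord.
Qed.

Lemma measurable_fold1 n : measurable_fun setT (@fold1 n).
Proof.
apply/measurable_fun_pairP; split => /=.
  exact: measurableT_comp (@measurable_init n) measurable_fst.
apply: measurable_funD; first exact: measurable_snd.
apply: measurable_funX.
exact: measurableT_comp (measurable_coord ord_max) measurable_fst.
Qed.

Lemma measurable_fold l k : measurable_fun setT (@fold l k).
Proof.
elim: k => [|k ih]; first exact: measurable_id.
exact: measurableT_comp ih (@measurable_fold1 _).
Qed.

Lemma pid_widen l n (w : 'rV[R]_l) i :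
  (w *m (pid_mx l : 'M[R]_(l, n.+1))) ord0 (widen_ord (leqnSn n) i) =
  (w *m (pid_mx l : 'M[R]_(l, n))) ord0 i.
Proof. by rewrite !mxE; apply: eq_bigr => j _; rewrite !mxE. Qed.

Lemma pid_max l n (w : 'rV[R]_l) : (l <= n)%N ->
  (w *m (pid_mx l : 'M[R]_(l, n.+1))) ord0 ord_max = 0.
Proof.
move=> ln; rewrite !mxE big1// => j _; rewrite !mxE/= ltn_eqF ?mulr0//.
exact: leq_trans (ltn_ord j) ln.
Qed.

Lemma enorm_sqrB n (u v : 'rV[R]_n) :
  enorm (u - v) ^+ 2 = \sum_i (u ord0 i - v ord0 i) ^+ 2.
Proof. by rewrite enorm_sqr; apply: eq_bigr => i _; rewrite !mxE. Qed.

Lemma height_fold1 l n (w : 'rV[R]_l) (z : S n.+1) : (l <= n)%N ->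
  height (w *m pid_mx l) z = height (w *m pid_mx l) (fold1 z).
Proof.
move=> ln; rewrite /height/= !enorm_sqrB big_ord_recr/= pid_max// sub0r sqrrN -addrA.
congr (_ + _); last exact: addrC.
by apply: eq_bigr => i _; rewrite [init _ _ _]mxE -[in RHS]pid_widen.
Qed.

Lemma height_fold l k (w : 'rV[R]_l) (z : S (k + l)) :
  height (w *m pid_mx l) z = height w (fold z).
Proof.
elim: k z => [z|k ih z]; first by rewrite pid_mx_1 mulmx1.
by rewrite /= -ih -(@height_fold1 l (k + l))// leq_addl.
Qed.

(** The common constant s cancels in all comparisons between generators. *)
Lemma sectional_laguerre l k (X : set (S (k + l))) (s : R)
    (phi : S (k + l) -> S l) :
  (forall w z, height w (phi z) = height (w *m pid_mx l) z + s) ->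
  sectional_tessellation l (laguerre X) = laguerre (phi @` X).
Proof.
move=> hphi.
have cellE p : laguerre_cell (phi @` X) (phi p) =
    (fun v : 'rV[R]_l => v *m pid_mx l) @^-1` laguerre_cell X p.
  apply/seteqP; split=> w /=.
    move=> h q Xq; have : height w (phi p) <= height w (phi q) by apply: h; exists q.
    by rewrite !hphi lerD2r.
  move=> h _ [q Xq <-]; have := h q Xq.
  by rewrite -(lerD2r s) -!hphi.
apply/seteqP; split=> D [D0].
  by move=> [_ [_ [p Xp ->]] DE]; split=> //; exists (phi p); [exists p|rewrite cellE].
move=> [_ [p Xp <-] DE]; split=> //; exists (laguerre_cell X p); last by rewrite DE cellE.
split; last by exists p.
by move: D0; rewrite DE cellE => -[w hw]; exists (w *m pid_mx l).
Qed.

(** A Laguerre diagram discards empty cells, but a Voronoi cell contains its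
    generator. *)
Lemma voronoi_laguerre n (X : set 'rV[R]_n) :
  voronoi X = laguerre ((fun v => (v, 0)) @` X).
Proof.
have cellE v : laguerre_cell ((fun v => (v, 0)) @` X) (v, 0) =
    [set w | forall v', X v' -> enorm (w - v) <= enorm (w - v')].
  have e0 (u : 'rV[R]_n) : 0 <= enorm u by rewrite sqrtr_ge0.
  apply/seteqP; split=> w /= h.
    move=> v' Xv'; have := h (v', 0) (ex_intro2 _ _ v' Xv' erefl).
    by rewrite /= !addr0 ler_sqr ?nnegrE.
  by move=> _ [v' Xv' <-]; rewrite /= !addr0 ler_sqr ?nnegrE// h.
apply/seteqP; split=> C.
  move=> [v Xv ->]; split; last by exists (v, 0); [exists v|rewrite cellE].
  exists v => v' _; rewrite subrr (_ : enorm 0 = 0) ?sqrtr_ge0//.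
  by rewrite /enorm big1 ?sqrtr0// => i _; rewrite mxE expr0n.
by move=> [_ [_ [v Xv <-] ->]]; exists v => //; rewrite cellE.
Qed.

End folding.

(** * Void and finiteness events of a Poisson process *)
Section poisson.
Context {R : realType} d (O : measurableType d) (P : probability O R).
Context dT (T : measurableType dT) (Lambda : set T -> \bar R) (X : O -> set T).
Hypothesis poiX : is_poisson_process P Lambda X.

Lemma counting_eq0 (A : set T) : (counting A = 0%R%:E :> \bar R) <-> A = set0.
Proof.
split=> [|->]; last by rewrite /counting asboolT ?fset_set0.
rewrite /counting; case: asboolP => // fA [] /eqP; rewrite pnatr_eq0 finmap.cardfs_eq0 => /eqP.
by move=> A0; rewrite -(fset_setK fA) A0 set_fset0.
Qed.

Lemma measurable_poisson_void B : measurable B -> measurable [set o | X o `&` B = set0].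
Proof.
move=> mB; have [mN _ _] := poiX.
rewrite (_ : [set o | _] = setT `&` (fun o => counting (X o `&` B) : \bar R) @^-1` [set 0%E]).
  exact: mN.
by rewrite setTI; apply/seteqP; split=> o /= /counting_eq0.
Qed.

Lemma poisson_void B : measurable B -> (0 <= Lambda B)%E ->
  P [set o | X o `&` B = set0] = expeR (- Lambda B).
Proof.
move=> mB L0; have [mN PN _] := poiX; have := PN _ mB.
have -> : [set o | X o `&` B = set0] =
    (fun o => counting (X o `&` B) : \bar R) @^-1` [set 0%:R%:E].
  by apply/seteqP; split=> o /= /counting_eq0.
case: (Lambda B) L0 => [r _ /(_ 0%N)||//] /=; first by rewrite expr0 fact0 divr1 mul1r.
move=> _ Py; have mNy : measurable ((fun o => counting (X o `&` B) : \bar R) @^-1` [set +oo%E]).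
  by rewrite -[X in measurable X]setTI; exact: mN.
have PyC : P (~` ((fun o => counting (X o `&` B) : \bar R) @^-1` [set +oo%E])) = 0%E.
  by rewrite probability_setC// [X in (_ - X)%E]Py subee.
apply: (subset_measure0 _ (measurableC mNy) _ PyC) => [|o /= -> //].
by rewrite -[X in measurable X]setTI; exact: mN.
Qed.

Lemma poisson_finite B : measurable B -> (0 <= Lambda B)%E -> (Lambda B < +oo)%E ->
  {ae P, forall o, finite_set (X o `&` B)}.
Proof.
move=> mB L0 Loo; have [mN PN _] := poiX; have := PN _ mB.
case: (Lambda B) L0 Loo => [r r0 _||//] //= Pk.
pose N o : \bar R := counting (X o `&` B).
have mNk k : measurable (N @^-1` [set k%:R%:E]).
  by rewrite -[X in measurable X]setTI; exact: mN.
have mF : measurable (\bigcup_k (N @^-1` [set k%:R%:E])) by exact: bigcup_measurable.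
have P1 : P (\bigcup_k (N @^-1` [set k%:R%:E])) = 1%E.
  have [r_gt0|rle0] := ltP 0 r; last first.
    have r0E : r = 0 by apply/eqP; rewrite eq_le rle0 -lee_fin.
    apply/eqP; rewrite eq_le probability_le1//=.
    have <- : P (N @^-1` [set 0%:R%:E]) = 1%E.
      by rewrite Pk r0E expr0 fact0 divr1 mul1r oppr0 expR0.
    by apply: le_measure; rewrite ?inE//; exact: (bigcup_sup (i := 0%N)).
  rewrite measure_bigcup//; last first.
    apply/trivIsetP => i j _ _ ij; rewrite -subset0 => o /= [-> []] /eqP.
    by rewrite eqr_nat (negbTE ij).
  have := probability_setT (poisson_prob r 0%N); rewrite /= /poisson_prob r_gt0 => <-.
  rewrite -nneseries_esumT; last by move=> k; rewrite lee_fin poisson_pmf_ge0.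
  apply: congr_lim; apply/funext => m; apply: eq_big => k; first by rewrite in_setT.
  by rewrite Pk /poisson_pmf r_gt0.
exists (~` \bigcup_k (N @^-1` [set k%:R%:E])); split; first exact: measurableC.
  by rewrite probability_setC// P1 subee.
apply: subsetC => o [k _] /=; rewrite /N /counting; case: asboolP => //.
Qed.
End poisson.

(** * The Abel transform of a height profile *)
Section last_coordinate.
Context {R : realType}.
Local Open Scope ereal_scope.
Local Notation mu := (@lebesgue_measure R).

Definition rcons_rV n (p : 'rV[R]_n * measurableTypeR R) : 'rV[R]_n.+1 :=
  (\row_i (if unlift ord_max i is Some j then p.1 ord0 j else (p.2 : R)))%R.

Lemma rcons_rV_max n p : @rcons_rV n p ord0 ord_max = p.2.
Proof. by rewrite mxE unlift_none. Qed.

Lemma init_rcons n p : init (@rcons_rV n p) = p.1.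
Proof.
apply/rowP => i; rewrite !mxE (_ : widen_ord _ i = lift ord_max i) ?liftK//.
by apply/val_inj => /=; rewrite /bump leqNgt ltn_ord.
Qed.

Lemma rcons_cons n (y : measurableTypeR R) (u : 'rV[R]_n) x :
  rcons_rV (cons_rV (y, u), x) = cons_rV (y, rcons_rV (u, x)).
Proof.
apply/rowP => i; have [j ->|->] := unliftP ord_max i.
  rewrite mxE liftK; have [j' ->|->] := unliftP ord0 j.
    rewrite cons_rVS (_ : lift ord_max (lift ord0 j') = lift ord0 (lift ord_max j')).
      by rewrite cons_rVS mxE liftK.
    by apply/val_inj; rewrite /= /bump/= !add1n ltnS leqNgt ltn_ord.
  rewrite cons_rV0 (_ : lift ord_max ord0 = ord0) ?cons_rV0//.
  by apply/val_inj.
rewrite rcons_rV_max (_ : ord_max = lift ord0 ord_max) ?cons_rVS ?rcons_rV_max//.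
exact/val_inj.
Qed.

Lemma rcons_cons0 (u : 'rV[R]_0) (x : measurableTypeR R) : rcons_rV (u, x) = cons_rV (x, u).
Proof.
apply/rowP => i; rewrite (_ : i = ord_max) ?rcons_rV_max.
  by rewrite (_ : ord_max = ord0) ?cons_rV0//; exact/val_inj.
by apply/val_inj; case: i => -[].
Qed.

Lemma measurable_rcons_rV n : measurable_fun setT (@rcons_rV n).
Proof.
apply: measurable_fun_rV => i; have [j ->|->] := unliftP ord_max i; last first.
  under eq_fun do rewrite rcons_rV_max.
  by move=> mT Y mY; exact: (@measurable_snd _ _ _ (measurableTypeR R) mT Y mY).
under eq_fun do rewrite mxE liftK.
exact: measurableT_comp (measurable_coord j) measurable_fst.
Qed.

Lemma integral_lebesgue_rVS n (g : 'rV[R]_n.+1 -> \bar R) :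
  measurable_fun setT g -> (forall v, 0 <= g v) ->
  \int[lebesgue_rV n.+1]_v g v =
  \int[mu]_x \int[lebesgue_rV n]_u g (cons_rV (x, u)).
Proof.
move=> mg g0.
transitivity (\int[(mu \x lebesgue_rV n)]_p g (cons_rV p)).
  have := ge0_integral_pushforward (@measurable_cons_rV R n)
    [the measure _ _ of (mu \x lebesgue_rV n)] measurableT (f := g).
  by rewrite preimage_setT => <-.
rewrite (@fubini_tonelli1 _ _ (measurableTypeR R) 'rV[R]_n R mu (lebesgue_rV n)
  (g \o @cons_rV R n))//=.
exact: measurableT_comp mg (@measurable_cons_rV R n).
Qed.

(** Lebesgue measure is built by adding coordinates in front, while folding
    removes them at the back; the two ends are exchanged by Fubini and
    induction. *)
Lemma integral_lebesgue_rV_last n (g : 'rV[R]_n.+1 -> \bar R) :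
  measurable_fun setT g -> (forall v, 0 <= g v) ->
  \int[lebesgue_rV n.+1]_v g v =
  \int[lebesgue_rV n]_u \int[mu]_x g (rcons_rV (u, x)).
Proof.
have mint m (h : 'rV[R]_m.+1 -> \bar R) : measurable_fun setT h ->
    (forall v, 0 <= h v) ->
    measurable_fun setT (fun w => \int[mu]_x h (rcons_rV (w, x))).
  move=> mh h0; have := @measurable_fun_fubini_tonelli_F _ _ 'rV[R]_m (measurableTypeR R) R mu
    (h \o @rcons_rV m).
  apply=> [|p]; last exact: h0.
  exact: (measurableT_comp mh (@measurable_rcons_rV m)).
have mcons m (h : 'rV[R]_m.+1 -> \bar R) y : measurable_fun setT h ->
    measurable_fun setT (fun w => h (cons_rV (y, w))).
  move=> mh; apply: (measurableT_comp mh).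
  have mp := @pair1_measurable _ _ (measurableTypeR R) 'rV[R]_m y.
  exact: (measurableT_comp (@measurable_cons_rV R m) mp).
elim: n g => [|n ih] g mg g0; rewrite integral_lebesgue_rVS//.
  rewrite [RHS]integral_dirac//; last exact: mint.
  rewrite diracT mul1e; apply: eq_integral => x _.
  rewrite [LHS]integral_dirac//; last exact: mcons.
  by rewrite diracT mul1e rcons_cons0.
rewrite [RHS](@integral_lebesgue_rVS n (fun w => \int[mu]_x g (rcons_rV (w, x)))).
- apply: eq_integral => y _; rewrite ih//; last exact: mcons.
  by apply: eq_integral => u _; apply: eq_integral => x _; rewrite rcons_cons.
- exact: mint.
- by move=> w; exact: integral_ge0.
Qed.

End last_coordinate.

Section lebesgue_affine.
Context {R : realType}.
Local Open Scope ereal_scope.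
Local Notation mu := (@lebesgue_measure R).

Lemma ge0_integral_shift (c : R) (f : measurableTypeR R -> \bar R) :
  measurable_fun setT f -> (forall x, 0 <= f x) ->
  \int[mu]_x f (x + c)%R = \int[mu]_x f x.
Proof.
move=> mf f0.
have mc : measurable_fun setT (fun x : measurableTypeR R => (x + c)%R : measurableTypeR R).
  exact: measurable_funD.
have := ge0_integral_pushforward mc mu measurableT mf; rewrite preimage_setT => <-; last by [].
pose m : {measure set (measurableTypeR R) -> \bar R} :=
  (measure_function_pushforward__canonical__measure_function_Measure mu mc).
suff mu_m X : ocitv X -> mu X = m X.
  by apply: eq_measure_integral => A mA _; rewrite [RHS](lebesgue_measure_unique mu_m mA).
move=> [[a b]] _ <-; rewrite /m/= /pushforward.
rewrite (_ : _ @^-1` _ = `](a - c)%R, (b - c)%R]%classic); last first.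
  by apply/seteqP; split=> x /=; rewrite !in_itv/= ltrBlDr lerBrDr.
by rewrite !lebesgue_measure_itv/= !lte_fin ltrD2r -!EFinB opprB addrA subrK.
Qed.

Lemma ge0_integral_scale (c : R) (f : measurableTypeR R -> \bar R) : (0 < c)%R ->
  measurable_fun setT f -> (forall x, 0 <= f x) ->
  c%:E * \int[mu]_x f (c * x)%R = \int[mu]_x f x.
Proof.
move=> c0 mf f0.
have mc : measurable_fun setT (fun x : measurableTypeR R => (c * x)%R : measurableTypeR R).
  exact: measurable_funM.
have := ge0_integral_pushforward mc mu measurableT mf; rewrite preimage_setT => <-; last by [].
pose m : {measure set (measurableTypeR R) -> \bar R} :=
  (measure_function_pushforward__canonical__measure_function_Measure mu mc).
have := @ge0_integral_mscale _ _ R m setT measurableT (NngNum (ltW c0)) f mf (fun x _ => f0 x).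
move=> /= <-.
suff mu_m X : ocitv X -> mu X = mscale (NngNum (ltW c0)) m X.
  by apply: eq_measure_integral => A mA _; rewrite [RHS](lebesgue_measure_unique mu_m mA).
move=> [[a b]] _ <-; rewrite /mscale/m/= /pushforward.
rewrite (_ : _ @^-1` _ = `](a / c)%R, (b / c)%R]%classic); last first.
  by apply/seteqP; split=> x /=; rewrite !in_itv/= ltr_pdivrMr// ler_pdivlMr// [(x * c)%R]mulrC.
rewrite !lebesgue_measure_itv/= !lte_fin ltr_pM2r ?invr_gt0//; case: ifPn => _; last by rewrite mule0.
by rewrite -!EFinB -EFinM -mulrBl mulrC divfK ?gt_eqF.
Qed.

End lebesgue_affine.

Section abel_transform.
Context {R : realType}.
Local Open Scope ereal_scope.
Local Notation mu := (@lebesgue_measure R).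
Local Notation S n := ('rV[R]_n * measurableTypeR R)%type.
Implicit Types f : measurableTypeR R -> \bar R.

(** With r = x^2 this is the integral of f (t - r) r^(-1/2) over r > 0, the
    classical Abel (half-order fractional) integral up to a constant. *)
Definition abel f (t : measurableTypeR R) : \bar R := \int[mu]_x f (t - x ^+ 2)%R.

Lemma abel_ge0 f : (forall x, 0 <= f x) -> forall t, 0 <= abel f t.
Proof. by move=> f0 t; exact: integral_ge0. Qed.

Lemma measurable_subsqr f : measurable_fun setT f ->
  measurable_fun setT (fun p : measurableTypeR R * measurableTypeR R => f (p.1 - p.2 ^+ 2)%R).
Proof.
move=> mf; apply: (measurableT_comp mf); apply: measurable_funB; first exact: measurable_fst.
apply: measurable_funX; exact: measurable_snd.
Qed.

Lemma measurable_abel f : measurable_fun setT f -> (forall x, 0 <= f x) ->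
  measurable_fun setT (abel f).
Proof.
move=> mf f0; apply: (@measurable_fun_fubini_tonelli_F _ _ (measurableTypeR R)
  (measurableTypeR R) R mu (fun p => f (p.1 - p.2 ^+ 2)%R)) => //.
exact: measurable_subsqr.
Qed.

(** For a fixed last coordinate x the height is shifted by x^2, which moves the
    shift to the profile; Tonelli then integrates x out. *)
Lemma abel_fold1 n (g : S n -> \bar R) f :
  measurable_fun setT g -> (forall z, 0 <= g z) ->
  measurable_fun setT f -> (forall x, 0 <= f x) ->
  \int[lebesgue_rV n.+1 \x mu]_z (g (fold1 z) * f z.2) =
  \int[lebesgue_rV n \x mu]_z (g z * abel f z.2).
Proof.
move=> mg g0 mf f0.
have mf2 : measurable_fun setT (fun z : S n.+1 => f z.2).
  exact: measurableT_comp mf measurable_snd.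
have mgf : measurable_fun setT (fun z : S n.+1 => g (fold1 z) * f z.2).
  by apply: emeasurable_funM => //; exact: measurableT_comp mg (@measurable_fold1 _ _).
have mgn (u : 'rV[R]_n) : measurable_fun setT (fun t => g (u, t)).
  exact: measurable_fun_pair2.
rewrite fubini_tonelli1//; last by move=> z; rewrite mule_ge0.
rewrite /fubini_F/= integral_lebesgue_rV_last; last 2 first.
- apply: (@measurable_fun_fubini_tonelli_F _ _ _ (measurableTypeR R) R mu
    (fun z : S n.+1 => g (fold1 z) * f z.2)) => //.
  by move=> z; rewrite mule_ge0.
- by move=> v; apply: integral_ge0 => h _; rewrite mule_ge0.
rewrite [RHS]fubini_tonelli1//; last 2 first.
- apply: emeasurable_funM => //; apply: measurableT_comp measurable_snd.
  exact: measurable_abel.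
- by move=> z; rewrite mule_ge0// abel_ge0.
apply: eq_integral => u _; rewrite /fubini_F/=.
transitivity (\int[mu]_x \int[mu]_t (g (u, t) * f (t - x ^+ 2)%R)).
  apply: eq_integral => x _.
  rewrite -[RHS](@ge0_integral_shift _ (x ^+ 2)%R); last 2 first.
  - by apply: emeasurable_funM => //; exact: (measurable_fun_pair1 x (measurable_subsqr mf)).
  - by move=> t; rewrite mule_ge0.
  apply: eq_integral => h _; rewrite /fold1/= init_rcons rcons_rV_max/=.
  by rewrite addrK.
pose F (p : measurableTypeR R * measurableTypeR R) := g (u, p.1) * f (p.1 - p.2 ^+ 2)%R.
have mF : measurable_fun setT F.
  apply: emeasurable_funM; last exact: measurable_subsqr.
  exact: measurableT_comp (mgn u) measurable_fst.
have F0 p : 0 <= F p by rewrite mule_ge0.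
rewrite -(@fubini_tonelli _ _ (measurableTypeR R) (measurableTypeR R) R mu mu F mF F0).
apply: eq_integral => t _; rewrite /fubini_F/F/= ge0_integralZl//.
exact: (measurable_fun_pair2 t (measurable_subsqr mf)).
Qed.

Lemma iter_abel_ge0 k f : (forall x, 0 <= f x) -> forall t, 0 <= iter k abel f t.
Proof. by move=> f0; elim: k => [//|k ih] t; exact: abel_ge0. Qed.

Lemma measurable_iter_abel k f : measurable_fun setT f -> (forall x, 0 <= f x) ->
  measurable_fun setT (iter k abel f).
Proof.
by move=> mf f0; elim: k => [//|k ih]; apply: measurable_abel => //; exact: iter_abel_ge0.
Qed.

Lemma abel_fold l k (g : S l -> \bar R) f :
  measurable_fun setT g -> (forall z, 0 <= g z) ->
  measurable_fun setT f -> (forall x, 0 <= f x) ->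
  \int[lebesgue_rV (k + l) \x mu]_z (g (fold z) * f z.2) =
  \int[lebesgue_rV l \x mu]_z (g z * iter k abel f z.2).
Proof.
move=> mg g0; elim: k f => [//|k ih] f mf f0.
rewrite -[LHS]/(\int[lebesgue_rV (k + l).+1 \x mu]_z (g (@fold _ l k (fold1 z)) * f z.2)).
rewrite (@abel_fold1 (k + l) (g \o @fold _ l k))//; last 2 first.
- exact: (measurableT_comp mg (@measurable_fold _ l k)).
- by move=> z; exact: g0.
by rewrite iterSr -ih; [|exact: measurable_abel|exact: abel_ge0].
Qed.

End abel_transform.

(** * Powers and the Gamma function *)
Section power_image.
Context {R : realType}.
Local Open Scope ereal_scope.
Local Notation mu := (@lebesgue_measure R).
(** Truncating at zero turns the power into a nonnegative density on the whole
    line, so that profiles and their Abel transforms need no domain. *)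
Definition ppow (b t : R) : R := (if 0 < t then t `^ b else 0)%R.

Lemma ppow_ge0 b t : (0 <= ppow b t)%R.
Proof. by rewrite /ppow; case: ifP => // _; exact: powR_ge0. Qed.

Lemma measurable_ppow b : measurable_fun setT (ppow b : measurableTypeR R -> R).
Proof.
apply: measurable_fun_if => //; first exact: measurable_fun_ltr.
by apply: measurable_funTS; exact: measurable_powR.
Qed.

Variable p : R.
Hypothesis p0 : (0 < p)%R.

Definition power_density (A : set (measurableTypeR R)) : \bar R :=
  \int[mu]_(t in A) (p * ppow (p - 1) t)%:E.

Lemma power_density_ge0 t : 0 <= (p * ppow (p - 1) t)%:E.
Proof. by rewrite lee_fin mulr_ge0// ?ppow_ge0// ltW. Qed.

Lemma measurable_power_density D :
  measurable_fun D (fun t : measurableTypeR R => (p * ppow (p - 1) t)%:E).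
Proof.
by apply: measurable_funTS; apply/measurable_EFinP/measurable_funM => //; exact: measurable_ppow.
Qed.

Let power_density0 : power_density set0 = 0.
Proof. exact: integral_set0. Qed.

Let power_density_measure_ge0 A : 0 <= power_density A.
Proof. by apply: integral_ge0 => t _; exact: power_density_ge0. Qed.

Let power_density_sigma_additive : semi_sigma_additive power_density.
Proof.
move=> /= F mF tF mUF; rewrite /power_density; apply: cvg_toP.
  apply: ereal_nondecreasing_is_cvgn => m n mn.
  by apply: lee_sum_nneg_natr => // k _ _; exact: power_density_measure_ge0.
rewrite ge0_integral_bigcup//=; first exact: measurable_power_density.
by move=> x _; exact: power_density_ge0.
Qed.

HB.instance Definition _ := isMeasure.Build _ _ _ power_density
  power_density0 power_density_measure_ge0 power_density_sigma_additive.

(** The image of Lebesgue measure on the positive half-line under s |-> s^(1/p). *)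
Definition power_image (A : set (measurableTypeR R)) : \bar R :=
  mu (`]0%R, +oo[ `&` (fun s => s `^ p^-1)%R @^-1` A).

Let mpos : measurable (`]0%R, +oo[%classic : set (measurableTypeR R)).
Proof. exact: measurable_itv. Qed.

Let mpow : measurable_fun setT (fun s : measurableTypeR R => (s `^ p^-1)%R : measurableTypeR R).
Proof. exact: measurable_powR. Qed.

Let power_imageE : power_image = pushforward (mrestr mu mpos) (fun s => (s `^ p^-1)%R).
Proof. by apply/funext => A; rewrite /power_image /pushforward /mrestr setIC. Qed.

Let power_image0 : power_image set0 = 0.
Proof. by rewrite /power_image preimage_set0 setI0 measure0. Qed.

Let power_image_measure_ge0 A : 0 <= power_image A.
Proof. exact: measure_ge0. Qed.

Let power_image_sigma_additive : semi_sigma_additive power_image.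
Proof.
rewrite power_imageE; exact: (@measure_semi_sigma_additive _ _ _
 (measure_function_pushforward__canonical__measure_function_Measure (mrestr mu mpos) mpow)).
Qed.

HB.instance Definition _ := isMeasure.Build _ _ _ power_image
  power_image0 power_image_measure_ge0 power_image_sigma_additive.

(** Both sides equal b^p - a^p.  Away from zero the density is continuous, even
    for p < 1, which is why a is positive here. *)
Lemma power_image_itv (a b : R) : (0 < a)%R ->
  power_image `]a, b]%classic = power_density `]a, b]%classic.
Proof.
move=> a0; have [ba|ab] := leP b a.
  rewrite set_itv_ge ?bnd_simp -?leNgt//.
  by rewrite power_density0 power_image0.
have b0 := lt_trans a0 ab.
have pK x : (0 < x)%R -> ((x `^ p) `^ p^-1 = x)%R.
  by move=> x0; rewrite -powRrM divff ?gt_eqF// powRr1// ltW.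
transitivity ((b `^ p)%:E - (a `^ p)%:E).
  rewrite /power_image (_ : _ `&` _ = `](a `^ p)%R, (b `^ p)%R]%classic); last first.
    apply/seteqP; split=> s /=; rewrite !in_itv/= ?andbT.
      move=> [s0 /andP[as1 sb]].
      have sE : s = ((s `^ p^-1) `^ p)%R by rewrite -powRrM mulVf ?gt_eqF// powRr1// ltW.
      apply/andP; split; rewrite sE.
        by apply: gt0_ltr_powR; rewrite ?nnegrE ?powR_ge0// ltW.
      by apply: ge0_ler_powR; rewrite ?nnegrE ?powR_ge0// ltW.
    move=> /andP[as1 sb]; have s0 : (0 < s)%R by rewrite (le_lt_trans _ as1)// powR_ge0.
    split=> //; apply/andP; split.
      by rewrite -[X in (X < _)%R](pK a)//; apply: gt0_ltr_powR;
        rewrite ?nnegrE ?powR_ge0 ?invr_gt0// ltW.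
    by rewrite -[X in (_ <= X)%R](pK b)//; apply: ge0_ler_powR;
      rewrite ?nnegrE ?powR_ge0 ?invr_ge0// ltW.
  rewrite lebesgue_measure_itv/= lte_fin gt0_ltr_powR ?nnegrE ?ltW//.
rewrite /power_density integral_itv_obnd_cbnd; last exact: measurable_power_density.
apply/esym; transitivity (\int[mu]_(t in `[a, b]) (p * t `^ (p - 1))%:E).
  apply: eq_integral => t /set_mem/=; rewrite in_itv/= => /andP[at1 _].
  by rewrite /ppow (lt_le_trans a0 at1).
rewrite (@continuous_FTC2 _ _ (fun t => t `^ p)%R)//.
- apply: derivable_within_continuous => t; rewrite in_itv/= => /andP[at1 _].
  apply: derivableM => //; apply: derivable_powR.
  by rewrite in_itv/= andbT (lt_le_trans a0).
- have dp t : (a <= t)%R -> derivable (fun x : R => x `^ p)%R t 1.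
    by move=> at1; apply: derivable_powR; rewrite in_itv/= andbT (lt_le_trans a0).
  have cp t : (a <= t)%R -> {for t, continuous (fun x : R => x `^ p)%R}.
    by move=> at1; apply/differentiable_continuous/derivable1_diffP/dp.
  split.
  + by move=> t; rewrite in_itv/= => /andP[at1 _]; apply/dp/ltW.
  + exact/cvg_at_right_filter/cp.
  + by apply/cvg_at_left_filter/cp; exact: ltW.
- move=> t; rewrite in_itv/= => /andP[at1 _].
  by rewrite powR_derive1// in_itv/= andbT (lt_trans a0).
Qed.

Lemma power_image_neg (A : set (measurableTypeR R)) : A `<=` `]-oo, 0%R] -> power_image A = 0.
Proof.
move=> A0; rewrite /power_image (_ : _ `&` _ = set0) ?measure0//.
rewrite -subset0 => s /=; rewrite in_itv/= andbT => -[s0 /A0]/=.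
by rewrite in_itv/= leNgt powR_gt0.
Qed.

Lemma power_density_neg (A : set (measurableTypeR R)) : A `<=` `]-oo, 0%R] -> power_density A = 0.
Proof.
move=> A0; apply: integral0_eq => t /A0 /=; rewrite in_itv/= => t0.
by rewrite /ppow ltNge t0/= mulr0.
Qed.

(** The agreement on intervals away from zero passes to intervals ]0, b] by
    continuity from below, and to all sets by uniqueness of measures. *)
Lemma lebesgue_power_image A : measurable A -> power_image A = power_density A.
Proof.
have eq0 (b : R) : power_image `]0%R, b]%classic = power_density `]0%R, b]%classic.
  pose F n := `](n.+1%:R^-1)%R, b]%classic : set (measurableTypeR R).
  have mF n : measurable (F n) by exact: measurable_itv.
  have UF : `]0%R, b]%classic = \bigcup_n F n.
    apply/seteqP; split=> t /=; rewrite in_itv/=.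
      move=> /andP[t0 tb].
      have [n _ /(_ n (leqnn n)) /= nt] := near_infty_natSinv_lt (PosNum t0).
      by exists n => //=; rewrite /F/= in_itv/= nt.
    move=> [n _]; rewrite /F/= in_itv/= => /andP[nt ->]; rewrite andbT.
    by rewrite (lt_trans _ nt)// invr_gt0.
  have ndF : nondecreasing_seq F.
    move=> m n mn; apply/subsetPset => t; rewrite /F/= !in_itv/= => /andP[mt ->].
    by rewrite andbT (le_lt_trans _ mt)// lef_pV2 ?posrE// ler_nat.
  have mUF : measurable (\bigcup_n F n) by exact: bigcupT_measurable.
  have c1 := @nondecreasing_cvg_mu _ _ R power_image F mF mUF ndF.
  have c2 := @nondecreasing_cvg_mu _ _ R power_density F mF mUF ndF.
  rewrite UF -(cvg_lim _ c1)// -(cvg_lim _ c2)//.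
  by apply: congr_lim; apply/funext => n; apply: power_image_itv; rewrite invr_gt0.
apply: (@measure_unique _ R (measurableTypeR R) (@ocitv R) (fun n => `](- n%:R)%R, n%:R]%classic)).
- by [].
- exact: ocitvI.
- by move=> n; exists (- n%:R, n%:R)%R.
- apply/seteqP; split=> // t _; exists (Num.truncn `|t|).+1 => //=.
  by have := truncnS_gt `|t|; rewrite ltr_norml in_itv/= => /andP[-> /ltW].
- move=> _ [[a b]] _ <- /=.
  have [a0|a0] := ltP 0%R a; first exact: power_image_itv.
  have [b0|b0] := leP b 0%R.
    have ab0 : `]a, b] `<=` `]-oo, 0%R].
      by move=> t /=; rewrite !in_itv/= => /andP[_ tb]; exact: le_trans b0.
    by rewrite power_image_neg// power_density_neg.
  have abE : `]a, b]%classic = `]a, 0%R] `|` `]0%R, b] :> set (measurableTypeR R).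
    rewrite -itv_bndbnd_setU// ?bnd_simp//; exact: ltW.
  have disj : `]a, 0%R]%classic `&` `]0%R, b] = set0 :> set (measurableTypeR R).
    rewrite -subset0 => t [/=]; rewrite !in_itv/= => /andP[_ t0] /andP[].
    by rewrite ltNge t0.
  have a00 : (`]a, 0%R]%classic : set (measurableTypeR R)) `<=` `]-oo, 0%R].
    by move=> t /=; rewrite !in_itv/= => /andP[].
  rewrite abE [LHS]measureU//.
  rewrite [RHS]measureU//.
  congr (_ + _); last exact: eq0.
  by rewrite [LHS]power_image_neg// [RHS]power_density_neg.
- move=> k; apply: (@le_lt_trans _ _ (mu `]0%R, (k%:R `^ p)%R])).
    apply: le_measure; rewrite ?inE.
    + apply: measurableI => //; rewrite -[X in measurable X]setTI.
      by apply: mpow => //; exact: measurable_itv.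
    + exact: measurable_itv.
    + move=> s /= [/[!in_itv]/= /[!andbT] s0 /andP[_ sk]]; rewrite s0/=.
      have -> : s = ((s `^ p^-1) `^ p)%R by rewrite -powRrM mulVf ?gt_eqF// powRr1// ltW.
      by apply: ge0_ler_powR; rewrite ?nnegrE ?powR_ge0// ltW.
  by rewrite lebesgue_measure_itv/=; case: ifP => _; rewrite ?ltry.
Qed.

End power_image.

Section gamma.
Context {R : realType}.
Local Open Scope ereal_scope.
Local Notation mu := (@lebesgue_measure R).
Implicit Types a b s t : R.

Definition gamma_fun a t : R := (ppow (a - 1) t * expR (- t))%R.

Lemma gamma_fun_ge0 a t : (0 <= gamma_fun a t)%R.
Proof. by rewrite mulr_ge0 ?ppow_ge0 ?expR_ge0. Qed.

Lemma measurable_gamma_fun a : measurable_fun setT (gamma_fun a : measurableTypeR R -> R).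
Proof.
apply: measurable_funM; first exact: measurable_ppow.
by apply: measurableT_comp => //; exact: measurable_funN.
Qed.

(** Since a t^(a-1) is the density of the image measure under s |-> s^(1/a), its
    mass below 1 is the length of ]0, 1], whatever the singularity at zero. *)
Lemma integral_ppow_near0 a : (0 < a)%R ->
  \int[mu]_(t in `]-oo, 1%R]) (ppow (a - 1) t)%:E < +oo.
Proof.
move=> a0.
have : a%:E * \int[mu]_(t in `]-oo, 1%R]) (ppow (a - 1) t)%:E < +oo.
  rewrite -ge0_integralZl_EFin//; [|by move=> t _; rewrite lee_fin ppow_ge0| |exact: ltW].
    have := @lebesgue_power_image R a a0 `]-oo, 1%R]%classic (measurable_itv _).
    rewrite /power_density /= => <-.
    apply: (@le_lt_trans _ _ (mu `]0%R, 1%R])).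
      apply: le_measure; rewrite ?inE.
      - apply: measurableI; first exact: measurable_itv.
        rewrite -[X in measurable X]setTI.
        by apply: (measurable_powR (a^-1)) => //; exact: measurable_itv.
      - exact: measurable_itv.
      - move=> s /= [/[!in_itv]/= /[!andbT] s0 s1]; rewrite s0/=.
        have -> : s = ((s `^ a^-1) `^ a)%R by rewrite -powRrM mulVf ?gt_eqF// powRr1// ltW.
        by rewrite (le_trans (ge0_ler_powR (ltW a0) _ _ s1)) ?powR1 ?nnegrE ?powR_ge0.
    by rewrite lebesgue_measure_itv/=; case: ifP => _; rewrite ?ltry.
  by apply: measurable_funTS; apply/measurable_EFinP; exact: measurable_ppow.
case: (integral _ _ _) => [r _| |//]; first exact: ltry.
by rewrite mulry gtr0_sg// mul1e ltxx.
Qed.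

(** A power of t is dominated by exp (t/2), by one term of the exponential
    series, and the rest is an exponential density. *)
Lemma gamma_fun_le_exp a : exists2 C : R, (0 <= C)%R &
  forall t, (1 < t)%R -> (gamma_fun a t <= C * exponential_pdf 2^-1 t)%R.
Proof.
pose m := (Num.truncn `|a|).+1.
exists (2 * (m`!%:R * 2 ^+ m))%R; first by rewrite !mulr_ge0// exprn_ge0.
move=> t t1; have t0 : (0 < t)%R by rewrite (lt_trans _ t1).
rewrite exponential_pdfE; last exact: ltW.
rewrite /gamma_fun /ppow t0.
have tm : (t `^ (a - 1) <= t ^+ m)%R.
  rewrite -powR_mulrn; last exact: ltW.
apply: (ler_powR (ltW t1)).
  rewrite (le_trans _ (ltW (truncnS_gt _)))// (le_trans _ (ler_norm _))//.
  by rewrite gerBl.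
have te : ((t / 2) ^+ m / m`!%:R <= expR (t / 2))%R.
  have t20 : (0 <= t / 2)%R by rewrite divr_ge0// ltW.
  by apply: le_trans (expR_ge1Dxn (Num.truncn `|a|) t20); rewrite -/m lerDr.
have tE : (t ^+ m <= m`!%:R * 2 ^+ m * expR (t / 2))%R.
  rewrite (_ : t ^+ m = m`!%:R * 2 ^+ m * ((t / 2) ^+ m / m`!%:R))%R.
    by rewrite ler_wpM2l// mulr_ge0// exprn_ge0.
  have mf0 : (m`!%:R != 0 :> R)%R by rewrite pnatr_eq0 -lt0n fact_gt0.
  have m20 : (2 ^+ m != 0 :> R)%R by rewrite expf_neq0.
  by rewrite expr_div_n; move: (t ^+ m)%R (2 ^+ m)%R m20 => x y y0; field; exact/andP.
apply: (@le_trans _ _ (m`!%:R * 2 ^+ m * expR (t / 2) * expR (- t))%R).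
  by rewrite ler_wpM2r ?expR_ge0// (le_trans tm).
rewrite -mulrA -expRD mulrACA divff// mul1r ler_wpM2l ?mulr_ge0 ?exprn_ge0//.
rewrite ler_expR mulNr [(2^-1 * t)%R]mulrC; have := splitr t; lra.
Qed.

Lemma gamma_fun_integral_lty a : (0 < a)%R -> \int[mu]_t (gamma_fun a t)%:E < +oo.
Proof.
move=> a0; have [C C0 hC] := gamma_fun_le_exp a.
pose g1 t : \bar R := (ppow (a - 1) t * \1_`]-oo, 1%R] t)%:E.
pose g2 t : \bar R := C%:E * (exponential_pdf 2^-1 t)%:E.
have mg1 : measurable_fun setT (g1 : measurableTypeR R -> \bar R).
  by apply/measurable_EFinP/measurable_funM; [exact: measurable_ppow|exact: measurable_indic].
have mexp : measurable_fun setT (fun t : measurableTypeR R => (exponential_pdf 2^-1 t)%:E).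
  by apply/measurable_EFinP; exact: measurable_exponential_pdf.
have exp0 t : 0 <= (exponential_pdf 2^-1 t)%:E.
  by rewrite lee_fin exponential_pdf_ge0.
have mg2 : measurable_fun setT (g2 : measurableTypeR R -> \bar R) by exact: measurable_funeM.
have g10 t : 0 <= g1 t by rewrite lee_fin mulr_ge0 ?ppow_ge0.
have g20 t : 0 <= g2 t by rewrite mule_ge0.
apply: (@le_lt_trans _ _ (\int[mu]_t (g1 t + g2 t))).
  apply: ge0_le_integral => //.
  - by move=> t _; rewrite lee_fin gamma_fun_ge0.
  - by apply/measurable_EFinP; exact: measurable_gamma_fun.
  - exact: emeasurable_funD.
  - move=> t _; have [t1|t1] := leP t 1%R.
      rewrite -[leLHS]adde0 leeD// lee_fin indicE mem_set/= ?in_itv//= mulr1.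
      have [t0|t0] := ltP 0%R t; last by rewrite /gamma_fun /ppow ltNge t0/= mul0r.
      by rewrite ler_piMr ?ppow_ge0// -expR0 ler_expR oppr_le0 ltW.
    by rewrite -[leLHS]add0e leeD// /g2 -EFinM lee_fin hC.
rewrite ge0_integralD//; apply: lte_add_pinfty.
  rewrite (_ : \int[mu]_t g1 t = \int[mu]_(t in `]-oo, 1%R]) (ppow (a - 1) t)%:E).
    exact: integral_ppow_near0.
  rewrite [RHS]integral_mkcond; apply: eq_integral => t _; rewrite /g1 patchE indicE.
  by case: ifP => _; rewrite ?mulr1 ?mulr0.
by rewrite ge0_integralZl// integral_exponential_pdf ?mule1 ?ltry// invr_gt0.
Qed.

(** [Gamma] is a real-valued integral, zero by convention when the integral
    diverges; this is where its finiteness enters. *)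
Lemma GammaE a : (0 < a)%R -> \int[mu]_t (gamma_fun a t)%:E = (Gamma a)%:E.
Proof.
move=> a0; rewrite /Gamma /Rintegral.
have -> : \int[mu]_(t in `]0%R, +oo[) ((t `^ (a - 1) * expR (- t))%R)%:E =
    \int[mu]_t (gamma_fun a t)%:E.
  rewrite integral_mkcond; apply: eq_integral => t _; rewrite patchE /gamma_fun /ppow.
  have [t0|t0] := ltP 0%R t; first by rewrite mem_set//= in_itv/= t0.
  by rewrite memNset/= ?mul0r// in_itv/= andbT ltNge t0.
rewrite fineK// ge0_fin_numE ?gamma_fun_integral_lty//.
by apply: integral_ge0 => t _; rewrite lee_fin gamma_fun_ge0.
Qed.

Lemma Gamma_gt0 a : (0 < a)%R -> (0 < Gamma a)%R.
Proof.
move=> a0; rewrite -lte_fin -GammaE//.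
apply: (@lt_le_trans _ _ ((expR (- 2) / 2)%:E * mu `[1%R, 2%R])).
  rewrite lebesgue_measure_itv/= lte_fin ltr1n -EFinB -EFinM lte_fin.
  by rewrite mulr_gt0 ?subr_gt0 ?ltr1n// mulr_gt0 ?expR_gt0 ?invr_gt0.
rewrite -integral_cst//.
apply: (@le_trans _ _ (\int[mu]_(t in `[1%R, 2%R]) (gamma_fun a t)%:E)).
  apply: ge0_le_integral => //.
  - by move=> t _; rewrite lee_fin divr_ge0 ?expR_ge0.
  - by apply: measurable_funTS; apply/measurable_EFinP; exact: measurable_gamma_fun.
  - move=> t /=; rewrite in_itv/= => /andP[t1 t2]; rewrite lee_fin /gamma_fun mulrC.
    have t0 : (0 < t)%R by rewrite (lt_le_trans _ t1).
    rewrite /ppow t0 ler_pM ?expR_ge0 ?invr_ge0//; last by rewrite ler_expR lerN2.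
    apply: (@le_trans _ _ (t^-1)%R); first by rewrite lef_pV2 ?posrE.
    rewrite -powR_inv1; last exact: ltW.
    by apply: (ler_powR t1); rewrite lerBrDr addNr ltW.
apply: ge0_subset_integral => //.
  by apply/measurable_EFinP; exact: measurable_gamma_fun.
by move=> t _; rewrite lee_fin gamma_fun_ge0.
Qed.

End gamma.

(** * The three profiles are stable under the Abel transform *)
Section abel_profiles.
Context {R : realType}.
Local Open Scope ereal_scope.
Local Notation mu := (@lebesgue_measure R).
Implicit Types a b s t y : R.

Lemma ppow_scale b y s : (0 < y)%R -> ppow b (y * s) = (y `^ b * ppow b s)%R.
Proof.
move=> y0; rewrite /ppow pmulr_rgt0//; case: ifP => s0; last by rewrite mulr0.
by rewrite powRM// ltW.
Qed.

Lemma ppowD b c t : (ppow b t * ppow c t = ppow (b + c) t)%R.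
Proof.
rewrite /ppow; case: ifP => t0; last by rewrite mul0r.
by rewrite powRD ?(gt_eqF t0) ?implybT.
Qed.

Lemma sqr_powR_half s : (0 < s)%R -> ((s `^ 2^-1) ^+ 2 = s)%R.
Proof. by move=> s0; rewrite -powR_mulrn ?powR_ge0// -powRrM mulVf// powRr1// ltW. Qed.

Lemma measurable_laplace b y : measurable_fun setT
  (fun s : measurableTypeR R => (ppow b s * expR (- (s * y)))%:E).
Proof.
apply/measurable_EFinP/measurable_funM; first exact: measurable_ppow.
by apply: measurableT_comp => //; apply: measurableT_comp => //; exact: measurable_funM.
Qed.

Lemma laplace_ge0 b y s : 0 <= (ppow b s * expR (- (s * y)))%:E.
Proof. by rewrite lee_fin mulr_ge0 ?ppow_ge0 ?expR_ge0. Qed.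

Lemma integral_laplace_ppow a y : (0 < a)%R -> (0 < y)%R ->
  \int[mu]_s (ppow (a - 1) s * expR (- (s * y)))%:E = (Gamma a * y `^ (- a))%:E.
Proof.
move=> a0 y0; have ya0 : (y `^ a != 0)%R by rewrite gt_eqF// powR_gt0.
suff : (y `^ a)%:E * \int[mu]_s (ppow (a - 1) s * expR (- (s * y)))%:E = (Gamma a)%:E.
  move=> /(congr1 (fun u => ((y `^ a)^-1)%:E * u)); rewrite muleA -EFinM mulVf// mul1e => ->.
  by rewrite -EFinM powRN mulrC.
rewrite -GammaE// -[RHS](@ge0_integral_scale _ y (fun t => (gamma_fun a t)%:E) y0); last 2 first.
- by apply/measurable_EFinP; exact: measurable_gamma_fun.
- by move=> x; rewrite lee_fin gamma_fun_ge0.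
have -> : (y `^ a = y * y `^ (a - 1))%R by rewrite mulr_powRB1// ltW.
rewrite EFinM -muleA; congr (_ * _).
rewrite -ge0_integralZl_EFin ?powR_ge0//.
- by apply: eq_integral => s _; rewrite /gamma_fun ppow_scale// -EFinM mulrA [(y * s)%R]mulrC.
- by move=> s _; exact: laplace_ge0.
- exact: measurable_laplace.
Qed.

Lemma integral_gauss_scale s : (0 < s)%R ->
  \int[mu]_x (expR (- (s * x ^+ 2)))%:E = (Num.sqrt pi * s `^ (- 2^-1))%:E.
Proof.
move=> s0; have c0 : (0 < s `^ 2^-1)%R by rewrite powR_gt0.
suff : (s `^ 2^-1)%:E * \int[mu]_x (expR (- (s * x ^+ 2)))%:E = (Num.sqrt pi)%:E.
  move=> /(congr1 (fun u => ((s `^ 2^-1)^-1)%:E * u)); rewrite muleA -EFinM mulVf ?gt_eqF// mul1e => ->.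
  by rewrite -EFinM powRN mulrC.
rewrite -integralT_gauss -[RHS](@ge0_integral_scale _ (s `^ 2^-1) (fun x => (gauss_fun x)%:E) c0); last 2 first.
- by apply/measurable_EFinP; exact: measurable_gauss_fun.
- by move=> x; rewrite lee_fin gauss_fun_ge0.
by congr (_ * _); apply: eq_integral => x _; rewrite /gauss_fun exprMn sqr_powR_half.
Qed.

Lemma abel_exp C y t : (0 <= C)%R -> (0 < y)%R ->
  abel (fun h => (C * expR (y * h))%:E) t =
  (C * (Num.sqrt pi * y `^ (- 2^-1)) * expR (y * t))%:E.
Proof.
move=> C0 y0; rewrite /abel.
transitivity (\int[mu]_x ((C * expR (y * t))%:E * (expR (- (y * x ^+ 2)))%:E)).
  by apply: eq_integral => x _; rewrite -EFinM -mulrA -expRD mulrBr.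
rewrite ge0_integralZl_EFin//.
- by rewrite integral_gauss_scale// -EFinM mulrAC.
- apply/measurable_EFinP; apply: measurableT_comp => //; apply: measurableT_comp => //.
  by apply: measurable_funM => //; exact: measurable_funX.
- by rewrite mulr_ge0// expR_ge0.
Qed.

Lemma measurable_subsqr1 t : measurable_fun setT (fun x : measurableTypeR R => (t - x ^+ 2)%R : measurableTypeR R).
Proof. by apply: measurable_funB => //; exact: measurable_funX. Qed.

(** Homogeneity: substitute x = t^(1/2) x'. *)
Lemma abel_ppow_scale b t : (0 < t)%R ->
  abel (fun h => (ppow b h)%:E) t =
  (t `^ (b + 2^-1))%:E * abel (fun h => (ppow b h)%:E) 1%R.
Proof.
move=> t0; have c0 : (0 < t `^ 2^-1)%R by rewrite powR_gt0.
have mp : measurable_fun setT (fun h : measurableTypeR R => (ppow b h)%:E).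
  by apply/measurable_EFinP; exact: measurable_ppow.
rewrite {1}/abel -[LHS](@ge0_integral_scale _ (t `^ 2^-1) (fun x => (ppow b (t - x ^+ 2))%:E) c0); last 2 first.
- exact: (measurableT_comp mp (measurable_subsqr1 t)).
- by move=> x; rewrite lee_fin ppow_ge0.
have tE : (t `^ (b + 2^-1) = t `^ 2^-1 * t `^ b)%R.
  by rewrite addrC powRD ?(gt_eqF t0) ?implybT.
rewrite tE EFinM -muleA; congr (_ * _).
rewrite -ge0_integralZl_EFin ?powR_ge0//.
- apply: eq_integral => x _; rewrite -EFinM -ppow_scale//; congr (ppow b _)%:E.
  by rewrite exprMn mulrBr mulr1 sqr_powR_half.
- by move=> x _; rewrite lee_fin ppow_ge0.
- exact: (measurableT_comp mp (measurable_subsqr1 1%R)).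
Qed.

Lemma abel_ppow_neg b t : (t <= 0)%R -> abel (fun h => (ppow b h)%:E) t = 0.
Proof.
move=> t0; apply: integral0_eq => x _; rewrite /ppow ltNge.
by rewrite (le_trans _ t0)// gerBl sqr_ge0.
Qed.

Lemma integral_gamma_fun_mul c (k : \bar R) : (0 < c)%R -> 0 <= k ->
  \int[mu]_t ((gamma_fun c t)%:E * k) = (Gamma c)%:E * k.
Proof.
move=> c0 k0; rewrite -GammaE// ge0_integralZr//.
  by apply/measurable_EFinP; exact: measurable_gamma_fun.
by move=> t _; rewrite lee_fin gamma_fun_ge0.
Qed.

(** By homogeneity the transform of the b-th power is K t^(b + 1/2) for a
    constant K.  Integrating it against exp (- t) gives K Gamma (b + 3/2), and,
    in the other order, Gamma (b + 1) times the Gauss integral. *)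
Lemma abel_ppow1 b : (-1 < b)%R ->
  abel (fun h => (ppow b h)%:E) 1%R = (Num.sqrt pi * Gamma (b + 1) / Gamma (b + 2^-1 + 1))%:E.
Proof.
move=> b1; set K := abel _ _.
have KE : abel (fun h => (ppow b h)%:E) 1%R = K by [].
have K0 : 0 <= K by apply: abel_ge0 => h; rewrite lee_fin ppow_ge0.
clearbody K; have b10 : (0 < b + 1)%R by lra.
have b20 : (0 < b + 2^-1 + 1)%R by lra.
have G1 := Gamma_gt0 b10; have G2 := Gamma_gt0 b20.
have mp : measurable_fun setT (fun h : measurableTypeR R => (ppow b h)%:E).
  by apply/measurable_EFinP; exact: measurable_ppow.
have me : measurable_fun setT (fun h : measurableTypeR R => (expR (- h))%:E).
  by apply/measurable_EFinP; apply: measurableT_comp => //; exact: measurable_funN.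
suff : (Gamma (b + 2^-1 + 1))%:E * K = (Num.sqrt pi * Gamma (b + 1))%:E.
  move=> /(congr1 (fun u => ((Gamma (b + 2^-1 + 1))^-1)%:E * u)).
  by rewrite muleA -EFinM mulVf ?gt_eqF// mul1e => ->; rewrite -EFinM mulrC.
pose F (p : measurableTypeR R * measurableTypeR R) : \bar R :=
  (ppow b (p.1 - p.2 ^+ 2))%:E * (expR (- (p.1 : R)))%:E.
have mF : measurable_fun setT F.
  apply: emeasurable_funM; first exact: (measurable_subsqr mp).
  exact: (measurableT_comp me measurable_fst).
have F0 p : 0 <= F p by rewrite mule_ge0// lee_fin ?ppow_ge0 ?expR_ge0.
transitivity (\int[mu]_t ((gamma_fun (b + 2^-1 + 1) t)%:E * K)).
  by rewrite integral_gamma_fun_mul.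
transitivity (\int[mu]_t \int[mu]_x ((ppow b (t - x ^+ 2))%:E * (expR (- t))%:E)).
  apply: eq_integral => t _; rewrite ge0_integralZr; last 4 first.
  - exact: measurableT.
  - exact: (measurableT_comp mp (measurable_subsqr1 t)).
  - by move=> x _; rewrite lee_fin ppow_ge0.
  - by rewrite lee_fin expR_ge0.
  rewrite /gamma_fun addrK EFinM muleAC; congr (_ * _).
  rewrite -/(abel (fun h => (ppow b h)%:E) t) [in LHS]/ppow.
  have [t0|t0] := ltP 0%R t; first by rewrite abel_ppow_scale// KE.
  by rewrite abel_ppow_neg// mul0e.
rewrite [LHS](@fubini_tonelli _ _ (measurableTypeR R) (measurableTypeR R) R mu mu F mF F0).
transitivity (\int[mu]_x ((Gamma (b + 1))%:E * (gauss_fun x)%:E)).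
  apply: eq_integral => x _.
  have gx0 : 0 <= (gauss_fun x)%:E by rewrite lee_fin gauss_fun_ge0.
  rewrite -[RHS](integral_gamma_fun_mul b10 gx0).
  rewrite -[LHS](@ge0_integral_shift _ (x ^+ 2)%R
    (fun t => (ppow b (t - x ^+ 2))%:E * (expR (- t))%:E)); last 2 first.
  - apply: emeasurable_funM => //; apply: (measurable_fun_pair1 x (measurable_subsqr mp)).
  - by move=> t; rewrite mule_ge0// lee_fin ?ppow_ge0 ?expR_ge0.
  apply: eq_integral => h _; rewrite addrK /gamma_fun addrK /gauss_fun.
  by rewrite -!EFinM -mulrA -expRD opprD.
rewrite ge0_integralZl_EFin; last 4 first.
- exact: measurableT.
- by move=> x _; rewrite lee_fin gauss_fun_ge0.
- by apply/measurable_EFinP; exact: measurable_gauss_fun.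
- exact: (ltW G1).
by rewrite integralT_gauss -EFinM mulrC.
Qed.

Lemma abel_ppow C b : (0 <= C)%R -> (-1 < b)%R ->
  abel (fun h => (C * ppow b h)%:E) =
  (fun t => (C * (Num.sqrt pi * Gamma (b + 1) / Gamma (b + 2^-1 + 1)) * ppow (b + 2^-1) t)%:E).
Proof.
move=> C0 b1; apply/funext => t.
have mp : measurable_fun setT (fun h : measurableTypeR R => (ppow b h)%:E).
  by apply/measurable_EFinP; exact: measurable_ppow.
transitivity (C%:E * abel (fun h => (ppow b h)%:E) t).
  rewrite /abel -ge0_integralZl_EFin//.
  - by move=> x _; rewrite lee_fin ppow_ge0.
  - exact: (measurableT_comp mp (measurable_subsqr1 t)).
rewrite -mulrA EFinM; congr (_ * _); rewrite {2}/ppow.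
have [t0|t0] := ltP 0%R t; last by rewrite abel_ppow_neg// mulr0.
by rewrite abel_ppow_scale// abel_ppow1// -EFinM mulrC.
Qed.

(** Writing Gamma b u^(-b) as the Laplace transform of s^(b-1) at u turns the
    integral over x into a Gauss integral, of value (pi / s)^(1/2), and
    leaves the Laplace transform of s^(b - 1/2 - 1).  Only negative heights are
    used, since t - x^2 < 0 when t < 0. *)
Lemma abel_npow C b (g : measurableTypeR R -> \bar R) : (0 <= C)%R -> (2^-1 < b)%R ->
  (forall h, (h < 0)%R -> g h = (C * (- h) `^ (- b))%:E) ->
  forall t, (t < 0)%R ->
  abel g t = (C * (Num.sqrt pi * Gamma (b - 2^-1) / Gamma b) * (- t) `^ (- (b - 2^-1)))%:E.
Proof.
move=> C0 b2 hg t t0.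
have G1 : (0 < Gamma b)%R by apply: Gamma_gt0; lra.
have b0 : (0 < b)%R by lra.
have nt0 : (0 < - t)%R by lra.
have xt x : (0 < x ^+ 2 - t)%R by have := sqr_ge0 x; lra.
have ml x : measurable_fun setT
    (fun s : measurableTypeR R => (ppow (b - 1) s * expR (- (s * (x ^+ 2 - t))))%:E).
  exact: measurable_laplace.
pose F (p : measurableTypeR R * measurableTypeR R) : \bar R :=
  (ppow (b - 1) p.2 * expR (- (p.2 * (p.1 ^+ 2 - t))))%:E.
have mF : measurable_fun setT F.
  apply/measurable_EFinP/measurable_funM; first exact: (measurableT_comp (measurable_ppow _) measurable_snd).
  apply: measurableT_comp => //; apply: measurable_funN; apply: measurable_funM; first exact: measurable_snd.
  by apply: measurable_funB => //; apply: measurable_funX; exact: measurable_fst.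
have F0 p : 0 <= F p by exact: laplace_ge0.
transitivity ((C / Gamma b)%:E * \int[mu]_x \int[mu]_s (ppow (b - 1) s * expR (- (s * (x ^+ 2 - t))))%:E).
  rewrite -ge0_integralZl_EFin//.
  - apply: eq_integral => x _; rewrite integral_laplace_ppow// -EFinM hg; last by have := xt x; lra.
    by rewrite opprB -mulrA mulKf ?gt_eqF.
  - by move=> x _; apply: integral_ge0 => s _; exact: laplace_ge0.
  - exact: (@measurable_fun_fubini_tonelli_F _ _ (measurableTypeR R) (measurableTypeR R) R mu F).
  - by rewrite divr_ge0// ltW.
rewrite [X in _ * X](@fubini_tonelli _ _ (measurableTypeR R) (measurableTypeR R) R mu mu F mF F0).
transitivity ((C / Gamma b)%:E * ((Num.sqrt pi)%:E * \int[mu]_s (ppow (b - 2^-1 - 1) s * expR (- (s * - t)))%:E)).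
  congr (_ * _); rewrite -ge0_integralZl_EFin ?sqrtr_ge0//; [|by move=> s _; exact: laplace_ge0|exact: measurable_laplace].
  apply: eq_integral => s _; rewrite /fubini_G /F/=.
  have [s0|s0] := ltP 0%R s; last first.
    rewrite /ppow ltNge s0/= !mul0r mule0; apply: integral0_eq => x _.
    by rewrite mul0r.
  transitivity (\int[mu]_x ((ppow (b - 1) s * expR (- (s * - t)))%:E * (expR (- (s * x ^+ 2)))%:E)).
    by apply: eq_integral => x _; rewrite -EFinM -mulrA -expRD; congr (_ * expR _)%:E; ring.
  rewrite ge0_integralZl_EFin//; last 2 first.
  - apply/measurable_EFinP; apply: measurableT_comp => //; apply: measurableT_comp => //.
    by apply: measurable_funM => //; exact: measurable_funX.
  - by have := laplace_ge0 (b - 1) (- t) s; rewrite lee_fin.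
  rewrite integral_gauss_scale// -!EFinM; congr EFin.
  have -> : ppow (b - 2^-1 - 1) s = (ppow (b - 1) s * s `^ (- 2^-1))%R.
    have -> : (s `^ (- 2^-1) = ppow (- 2^-1) s)%R by rewrite /ppow s0.
    by rewrite ppowD; congr ppow; ring.
  by ring.
rewrite integral_laplace_ppow//; last by lra.
by rewrite -!EFinM; congr EFin; ring.
Qed.

End abel_profiles.

(** * Intensities over space and height *)
Section intensity.
Context {R : realType}.
Local Open Scope ereal_scope.
Local Notation mu := (@lebesgue_measure R).
Local Notation S n := ('rV[R]_n * measurableTypeR R)%type.
Implicit Types (g : measurableTypeR R -> \bar R).

Definition intensity n g (B : set (S n)) : \bar R :=
  \int[lebesgue_rV n \x mu]_z ((\1_B z)%:E * g z.2).

Lemma indic_ge0 n (B : set (S n)) z : 0 <= (\1_B z)%:E :> \bar R.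
Proof. by rewrite lee_fin. Qed.

Lemma measurable_intensity n g (B : set (S n)) : measurable B -> measurable_fun setT g ->
  measurable_fun setT (fun z : S n => (\1_B z)%:E * g z.2).
Proof.
move=> mB mg; apply: emeasurable_funM; first by apply/measurable_EFinP; exact: measurable_indic.
exact: (measurableT_comp mg measurable_snd).
Qed.

Lemma intensity_ge0 n g (B : set (S n)) : (forall h, 0 <= g h) -> 0 <= intensity g B.
Proof. by move=> g0; apply: integral_ge0 => z _; rewrite mule_ge0// indic_ge0. Qed.

Lemma intensity_fold l k g (B : set (S l)) : measurable B ->
  measurable_fun setT g -> (forall h, 0 <= g h) ->
  intensity g (@fold R l k @^-1` B) = intensity (iter k abel g) B.
Proof.
move=> mB mg g0; apply: (@abel_fold _ l k (fun z => (\1_B z)%:E) g) => //.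
by apply/measurable_EFinP; exact: measurable_indic.
Qed.

Lemma intensity_prod n g (A : set 'rV[R]_n) (J : set (measurableTypeR R)) :
  measurable A -> measurable J -> measurable_fun setT g -> (forall h, 0 <= g h) ->
  intensity g (A `*` J) = lebesgue_rV n A * \int[mu]_(h in J) g h.
Proof.
move=> mA mJ mg g0; rewrite /intensity fubini_tonelli1//; last 2 first.
- exact: measurable_intensity (measurableX mA mJ) mg.
- by move=> z; rewrite mule_ge0// indic_ge0.
have mJg : measurable_fun setT (fun h : measurableTypeR R => (\1_J h)%:E * g h).
  by apply: emeasurable_funM => //; apply/measurable_EFinP; exact: measurable_indic.
have Jg0 h : 0 <= (\1_J h)%:E * g h by rewrite mule_ge0// lee_fin.
have -> : \int[mu]_(h in J) g h = \int[mu]_h ((\1_J h)%:E * g h).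
  rewrite integral_mkcond; apply: eq_integral => h _; rewrite patchE indicE.
  by case: ifP; rewrite ?mul1e ?mul0e.
transitivity (\int[lebesgue_rV n]_v ((\1_A v)%:E * \int[mu]_h ((\1_J h)%:E * g h))).
  apply: eq_integral => v _; rewrite /fubini_F/= -ge0_integralZl_EFin//.
  by apply: eq_integral => h _; rewrite muleA -EFinM !indicE in_setX -mulnb natrM.
rewrite ge0_integralZr//; last 2 first.
- by apply/measurable_EFinP; exact: measurable_indic.
- exact: integral_ge0.
by rewrite integral_indic// setIT.
Qed.

Definition box n (a : 'I_n -> R) (e : R) : set 'rV[R]_n :=
  [set v | forall i, `[a i, (a i + e)%R]%classic (v ord0 i : R)].

Lemma measurable_box n (a : 'I_n -> R) e : measurable (box a e).
Proof.
apply: measurable_forall_pred => i.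
rewrite -[X in measurable X]setTI; apply: (measurable_coord i measurableT).
exact: measurable_itv.
Qed.

Lemma lebesgue_box n (a : 'I_n -> R) e : (0 <= e)%R -> lebesgue_rV n (box a e) = (e ^+ n)%:E.
Proof.
move=> e0; elim: n a => [|n ih] a.
  by rewrite /lebesgue_rV diracE mem_set// => -[].
rewrite /= /pushforward.
have -> : @cons_rV R n @^-1` box a e =
    (`[a ord0, (a ord0 + e)%R]%classic : set (measurableTypeR R)) `*` box (a \o lift ord0) e.
  apply/seteqP; split=> [[x v] /= b|[x v] /= [bx bv] i].
    split=> [|i]; first by have := b ord0; rewrite cons_rV0.
    by have := b (lift ord0 i); rewrite cons_rVS.
  by have [j ->|->] := unliftP ord0 i; rewrite ?cons_rV0 ?cons_rVS//; exact: bv.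
transitivity (mu `[a ord0, (a ord0 + e)%R]%classic * lebesgue_rV n (box (a \o lift ord0) e)).
  apply: (@product_measure1E _ _ (measurableTypeR R) _ R mu (lebesgue_rV n)).
    exact: measurable_itv.
  exact: measurable_box.
rewrite ih lebesgue_measure_itv/= lte_fin ltrDl exprS EFinM.
case: ltP => [_|e1]; first by rewrite -EFinB addrAC subrr add0r.
by have -> : e = 0%R by apply/eqP; rewrite eq_le e1.
Qed.

Lemma cube_box n m : cube m = box (fun=> - m%:R)%R (m%:R + m%:R)%R :> set 'rV[R]_n.
Proof.
apply/seteqP; split=> v.
  rewrite /cube/= => vm i /=; rewrite in_itv/= addrA addNr add0r -ler_norml (le_trans _ vm)//.
  rewrite [leRHS]/Num.norm/= mx_normrE.
  by apply/bigmax_geP; right; exists (ord0, i).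
move=> bv; rewrite /cube/= [leLHS]/Num.norm/= mx_normrE; apply/bigmax_leP; split=> // -[i j] _ /=.
have := bv j; rewrite (ord1 i) /= in_itv/= addrA addNr add0r -ler_norml; exact.
Qed.

Lemma measurable_cube n m : measurable (cube m : set 'rV[R]_n).
Proof. by rewrite cube_box; exact: measurable_box. Qed.

Lemma lebesgue_cube_lty n m : lebesgue_rV n (cube m) < +oo :> \bar R.
Proof. by rewrite cube_box lebesgue_box ?ltry// addr_ge0. Qed.

End intensity.

(** * The law of a section, from void probabilities *)
Section density.
Context {R : realType}.
Local Open Scope ereal_scope.
Local Notation mu := (@lebesgue_measure R).
Local Notation S n := ('rV[R]_n * measurableTypeR R)%type.
Implicit Types (g : measurableTypeR R -> \bar R).

Lemma measurable_height_in n (J : set (measurableTypeR R)) :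
  measurable J -> measurable [set z : S n | J z.2].
Proof.
move=> mJ; rewrite -[X in measurable X]setTI.
exact: (@measurable_snd _ _ 'rV[R]_n (measurableTypeR R) measurableT J mJ).
Qed.

(** Height zero is exempted because 0 `^ b may be 1 or 0 there while the
    profile g vanishes; the hyperplane of height zero is a null set. *)
Lemma density_intensity n (J : set (measurableTypeR R)) (F : measurableTypeR R -> R) g (B : set (S n)) :
  measurable J -> measurable_fun setT F -> measurable_fun setT g -> measurable B ->
  (forall h, h != 0%R -> J h -> g h = (F h)%:E) ->
  (forall h, h != 0%R -> ~ J h -> g h = 0) ->
  density_measure [set z | J z.2] (fun _ h => F h) B = intensity g B.
Proof.
move=> mJ mF mg mB gF g0; rewrite /density_measure integral_mkcond /intensity.
have mJ2 := @measurable_height_in n J mJ.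
apply: ae_eq_integral => //.
- apply/(measurable_restrictT _ _).1; first exact: measurableI.
  apply: measurable_funTS; apply/measurable_EFinP.
  exact: (measurableT_comp mF measurable_snd).
- exact: measurable_intensity.
exists (setT `*` [set 0%R : measurableTypeR R]); split.
- by apply: measurableX => //; exact: measurable_set1.
- transitivity (lebesgue_rV n setT * mu [set (0%R : R)]).
    by apply: (@product_measure1E _ _ _ (measurableTypeR R) R (lebesgue_rV n) mu) => //; exact: measurable_set1.
  by rewrite lebesgue_measure_set1 mule0.
move=> z /= nz; split=> //; apply: contrapT => /eqP z0; apply: nz => _.
rewrite patchE indicE; have [zB|zB] := boolP (z \in B); last first.
  by rewrite mul0e ifF//; apply/negbTE; apply: contra zB => /set_mem[? _]; exact/mem_set.
rewrite mul1e; have [Jz|Jz] := pselect (J z.2).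
  by rewrite gF// mem_set//; split => //; exact: set_mem.
by rewrite g0// memNset// => -[].
Qed.

Definition shift n (s : R) (z : S n) : S n := (z.1, ((z.2 : R) + s)%R).

Lemma measurable_shift n s : measurable_fun setT (@shift n s).
Proof.
apply/measurable_fun_pairP; split => /=; first exact: measurable_fst.
by apply: measurable_funD => //; exact: measurable_snd.
Qed.

Lemma height_shift n s (w : 'rV[R]_n) z : height w (shift s z) = (height w z + s)%R.
Proof. exact: addrA. Qed.

Lemma intensity_shift n s g (B : set (S n)) : measurable B -> measurable_fun setT g ->
  (forall h, 0 <= g h) ->
  intensity g (shift s @^-1` B) = intensity (fun h => g (h - s)%R) B.
Proof.
move=> mB mg g0; rewrite /intensity.
have mB1 : measurable_fun setT (fun z : S n => (\1_B z)%:E : \bar R).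
  by apply/measurable_EFinP; exact: measurable_indic.
have mgs : measurable_fun setT (fun h : measurableTypeR R => g (h - s)%R).
  by apply: (measurableT_comp mg); exact: measurable_funB.
rewrite [LHS]fubini_tonelli1; last 2 first.
- apply: measurable_intensity => //.
  by rewrite -[X in measurable X]setTI; exact: (measurable_shift s).
- by move=> z; rewrite mule_ge0// indic_ge0.
rewrite [RHS]fubini_tonelli1; last 2 first.
- exact: (measurable_intensity mB mgs).
- by move=> z; rewrite mule_ge0// indic_ge0.
apply: eq_integral => v _; rewrite /fubini_F/=.
rewrite -[RHS](@ge0_integral_shift _ s (fun h => (\1_B (v, h))%:E * g (h - s)%R)).
- by apply: eq_integral => h _; rewrite addrK.
- apply: emeasurable_funM => //.
  exact: (measurable_fun_pair2 v mB1).
- by move=> h; rewrite mule_ge0// indic_ge0.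
Qed.

End density.

Section sectional_law.
Context {R : realType} (k l : nat).
Local Open Scope ereal_scope.
Local Notation mu := (@lebesgue_measure R).
Local Notation S n := ('rV[R]_n * measurableTypeR R)%type.
Context d1 (O1 : measurableType d1) (P1 : probability O1 R).
Context d2 (O2 : measurableType d2) (P2 : probability O2 R).
Variables (X1 : O1 -> set (S (k + l))) (X2 : O2 -> set (S l)).
Variables (phi : S (k + l) -> S l) (s : R) (g g' : measurableTypeR R -> \bar R).
Variables (J : set (measurableTypeR R)) (Jb : nat -> set (measurableTypeR R)).
Hypothesis mphi : measurable_fun setT phi.
Hypothesis height_phi : forall w z, height w (phi z) = (height (w *m pid_mx l) z + s)%R.
Hypothesis mg : measurable_fun setT g.
Hypothesis g0 : forall h, 0 <= g h.
Hypothesis mJ : measurable J.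
Hypothesis mJb : forall b, measurable (Jb b).
Hypothesis Jb_nbhs : forall t, J t -> exists r b,
  (0 < r)%R /\ forall u, J u -> (`|t - u| < r)%R -> Jb b u.
Hypothesis Jb_fin : forall b, \int[mu]_(h in Jb b) g h < +oo.
Hypothesis g'J : forall h, J h -> g' h = g h.
Hypothesis g'N : forall h, ~ J h -> g' h = 0.
Hypothesis mX1 : forall B, measurable B -> measurable [set o | X1 o `&` B = set0].
Hypothesis isoX1 : forall o, isolating (@base R (k + l)) (X1 o).
Hypothesis voidX1 : forall B, measurable B ->
  P1 [set o | X1 o `&` phi @^-1` B = set0] = expeR (- intensity g B).
Hypothesis finX1 : forall B, measurable B -> intensity g B < +oo ->
  {ae P1, forall o, finite_set (X1 o `&` phi @^-1` B)}.
Hypothesis mX2 : forall B, measurable B -> measurable [set o | X2 o `&` B = set0].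
Hypothesis isoX2 : forall o, isolating (@base R l) (X2 o).
Hypothesis voidX2 : forall B, measurable B ->
  P2 [set o | X2 o `&` B = set0] = expeR (- intensity g' B).
Hypothesis restrX1 : {ae P1, forall o,
  laguerre (phi @` X1 o) = laguerre (phi @` X1 o `&` [set z | J z.2])}.

Let E' : set (S l) := [set z | J z.2].

Let mE' : measurable E'.
Proof. exact: measurable_height_in. Qed.

Let ae_isolating : {ae P1, forall o, isolating (@base R l) (phi @` X1 o `&` E')}.
Proof.
have : {ae P1, forall o (a b : nat), finite_set (X1 o `&` phi @^-1` (cube a `*` Jb b))}.
  apply/ae_foralln => a; apply/ae_foralln => b; apply: finX1.
    by apply: measurableX => //; exact: measurable_cube.
  rewrite intensity_prod//; last exact: measurable_cube.
  apply: lte_mul_pinfty; rewrite ?measure_ge0//.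
  by rewrite ge0_fin_numE ?measure_ge0//; exact: lebesgue_cube_lty.
apply: filterS => o fin; apply: isolating_base => p [_ Jp].
have [r [b [r0 rb]]] := Jb_nbhs Jp.
exists (Num.min r 1%R); first by rewrite lt_min r0 ltr01.
pose a := (Num.truncn (`|p.1| + 1)).+1.
have pa : (`|p.1| + 1 < a%:R)%R := truncnS_gt _.
apply: (@sub_finite_set _ _ (phi @` (X1 o `&` phi @^-1` (cube a `*` Jb b)))); last exact: finite_image.
move=> _ [[[q Xq <-] Jq] [pq1 pq2]]; exists q => //; split=> //; split=> /=.
  rewrite /cube/= -[(phi q).1](subrK p.1) (le_trans (ler_normD _ _))//.
  rewrite addrC (le_trans _ (ltW pa))// lerD2l distrC ltW// (lt_le_trans pq1)//.
  by rewrite ge_min lexx orbT.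
apply: rb => //; apply: lt_le_trans pq2 _.
by rewrite ge_min lexx.
Qed.

(** The heights in J are exhausted by sets Jb of finite mass, so the folded
    points with heights in J are almost surely finite in number above each cube,
    hence isolated; this is what makes the folded process comparable with
    X2. *)
Lemma sectional_law (T1 : O1 -> set (set 'rV[R]_(k + l))) (T2 : O2 -> set (set 'rV[R]_l)) :
  (forall o, T1 o = laguerre (X1 o)) -> (forall o, T2 o = laguerre (X2 o)) ->
  eq_distribution P1 (fun w => sectional_tessellation l (T1 w)) P2 T2.
Proof.
move=> T1E T2E E pE.
have -> : (fun w => sectional_tessellation l (T1 w)) @^-1` E =
    [set o | E (laguerre (phi @` X1 o))].
  by apply/seteqP; split=> o /=; rewrite T1E (@sectional_laguerre R l k (X1 o) s phi height_phi).
have -> : T2 @^-1` E = [set o | E (laguerre (X2 o))].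
  by apply/seteqP; split=> o /=; rewrite T2E.
apply: (@laguerre_same_law R l _ _ (@base R (k + l)) (@base R l) (@measurable_base _ _)
  (@base_separates _ _)
  (@measurable_base _ _)
  (@base_separates _ _) phi E' mphi mE') => //.
- move=> B mB; rewrite voidX1 ?voidX2//; last exact: measurableI.
  congr (expeR (- _)); apply: eq_integral => z _; rewrite !indicE in_setI.
  have [Jz|Jz] := pselect (J z.2).
    by rewrite g'J// [z \in E']mem_set// andbT.
  by rewrite g'N// mule0 [z \in E']memNset// andbF mul0e.
- by apply: filterS2 ae_isolating restrX1 => o.
Qed.

End sectional_law.

(** * Covering by points of negative height *)
Section negative_heights.
Context {R : realType} (l : nat).
Local Notation S := ('rV[R]_l * measurableTypeR R)%type.

Lemma height_ge (w : 'rV[R]_l) (z : S) : (z.2 : R) <= height w z.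
Proof. by rewrite /height lerDr sqr_ge0. Qed.

(** A generator of nonnegative height never wins at w against one that brings
    the height function below zero there. *)
Lemma laguerre_restrict_neg (Y : set S) :
  (forall w, exists2 q, Y q & height w q < 0) ->
  laguerre Y = laguerre (Y `&` [set z | (z.2 : R) < 0]).
Proof.
move=> covY.
have cellE p : laguerre_cell Y p = laguerre_cell (Y `&` [set z | (z.2 : R) < 0]) p.
  apply/seteqP; split=> w h q; first by move=> [Yq _]; exact: h.
  move=> Yq; have [q0|q0] := ltP (q.2 : R) 0; first exact: h.
  have [q' Yq' q'w] := covY w.
  have : height w p <= height w q'.
    by apply: h; split=> //=; exact: le_lt_trans (height_ge w q') q'w.
  move=> /le_trans; apply; apply: le_trans (ltW q'w) (le_trans q0 _).
  exact: height_ge.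
apply/seteqP; split=> C [C0 [p Yp CE]]; split=> //; last first.
  by exists p; [case: Yp|rewrite CE cellE].
exists p; last by rewrite CE cellE.
split=> //=; have [w] := C0; rewrite CE => cw; have [q Yq qw] := covY w.
exact: le_lt_trans (height_ge w p) (le_lt_trans (cw q Yq) qw).
Qed.

End negative_heights.

Section finite_union_bound.
Local Open Scope ereal_scope.

Lemma measure_exists_in_le {R : realType} d (T : measurableType d)
    (mu : {measure set T -> \bar R}) (I : countType) (s : seq I) (F : I -> set T) (c : \bar R) :
  (forall i, measurable (F i)) -> (forall i, mu (F i) <= c) ->
  mu [set x | exists2 i, i \in s & F i x] <= (size s)%:R%:E * c.
Proof.
move=> mF Fc; have c0 (i : I) : 0 <= c by apply: le_trans (Fc i); exact: measure_ge0.
have mE (s' : seq I) : measurable [set x | exists2 i, i \in s' & F i x].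
  rewrite (_ : [set x | _] = [set x | exists i, i \in s' /\ F i x]); last first.
    by apply/seteqP; split=> x [i]; [exists i|move=> []; exists i].
  apply: measurable_exists_pred => i; apply: measurable_and_pred; last exact: mF.
  exact: measurable_const_pred.
elim: s => [|a s ih].
  rewrite (_ : [set x | _] = set0) ?measure0 /= ?mul0e//.
  by apply/seteqP; split=> x // -[].
rewrite (_ : [set x | _] = F a `|` [set x | exists2 i, i \in s & F i x]); last first.
  apply/seteqP; split=> x /=.
    by move=> [j]; rewrite inE => /orP[/eqP ->|js Fj]; [left|right; exists j].
  by move=> [Fi|[j js Fj]]; [exists a; rewrite ?inE ?eqxx|exists j => //; rewrite inE js orbT].
apply: le_trans (measureU2 mu (mF a) (mE s)) _.
rewrite /= -natr1 EFinD ge0_muleDl// mul1e addeC.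
exact: leeD.
Qed.

End finite_union_bound.

Section power_beats.
Context {R : realType}.

(** The term of order m of the exponential series, with m delta >= l + 1, beats
    the number of grid points, which is of order k^l. *)
Lemma exp_decay_grid (M l : nat) (C delta e : R) : 0 < C -> 0 < delta -> 0 < e ->
  exists k : nat, ((M * k.+1).+1 ^ l)%N%:R * expR (- (C * k.+1%:R `^ delta)) < e.
Proof.
move=> C0 d0 e0.
pose m := (Num.truncn (l.+1%:R / delta)).+1.
have md : l.+1%:R <= delta * m%:R.
  by rewrite mulrC -ler_pdivrMr//; exact/ltW/truncnS_gt.
(* With K = k + 1, the product is at most A / K. *)
pose A : R := (M.+1 ^ l)%N%:R * (m`!%:R / C ^+ m).
have A0 : 0 <= A by rewrite mulr_ge0// divr_ge0// exprn_ge0// ltW.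
pose k := Num.truncn (A / e).
exists k; set K : R := k.+1%:R.
have K0 : 0 < K by rewrite /K ltr0n.
have K1 : 1 <= K by rewrite /K ler1n.
have AK : A < e * K by rewrite mulrC -ltr_pdivrMr//; exact: truncnS_gt.
have h1 : ((M * k.+1).+1 ^ l)%N%:R <= (M.+1 ^ l)%N%:R * K ^+ l.
  rewrite /K -natrX -natrM ler_nat -expnMn; have [->|l0] := posnP l; first by rewrite !expn0.
  by rewrite leq_exp2r// mulSn -add1n leq_add2r.
have x0 : 0 <= C * K `^ delta by rewrite mulr_ge0 ?powR_ge0// ltW.
have h2 : (C * K `^ delta) ^+ m / m`!%:R <= expR (C * K `^ delta).
  have := expR_ge1Dxn (Num.truncn (l.+1%:R / delta)) x0; rewrite -/m => h.
  by rewrite (le_trans _ h)// lerDr.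
have h3 : C ^+ m * K ^+ l.+1 / m`!%:R <= expR (C * K `^ delta).
  apply: le_trans h2; rewrite ler_wpM2r ?invr_ge0// exprMn.
  apply: (ler_wpM2l (exprn_ge0 m (ltW C0))).
  rewrite -(@powR_mulrn _ K l.+1 (ltW K0)) -(@powR_mulrn _ (K `^ delta) m (powR_ge0 _ _)).
  by rewrite -powRrM; apply: (ler_powR K1).
have Cm0 : 0 < C ^+ m by rewrite exprn_gt0.
have mf0 : 0 < m`!%:R :> R by rewrite ltr0n fact_gt0.
have p0 : 0 < C ^+ m * K ^+ l.+1 / m`!%:R by rewrite divr_gt0// mulr_gt0// exprn_gt0.
rewrite expRN.
apply: (@le_lt_trans _ _ ((M.+1 ^ l)%N%:R * K ^+ l * (C ^+ m * K ^+ l.+1 / m`!%:R)^-1)).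
  by rewrite ler_pM// lef_pV2 ?posrE ?expR_gt0.
have -> : (M.+1 ^ l)%N%:R * K ^+ l * (C ^+ m * K ^+ l.+1 / m`!%:R)^-1 = A / K.
  have Kl0 : K ^+ l != 0 by rewrite expf_neq0// gt_eqF.
  have fieldE (f x a b c : R) : a != 0 -> x != 0 -> b != 0 -> c != 0 ->
      f * a * (b * (x * a) / c)^-1 = f * (c / b) / x.
    by move=> a0 x0' b0 c0; field; rewrite ?a0 ?x0' ?b0 ?c0.
  by rewrite /A exprS fieldE// gt_eqF.
by rewrite ltr_pdivrMr.
Qed.

End power_beats.

Section coverage.
Context {R : realType} (l : nat).
Local Notation mu := (@lebesgue_measure R).
Local Notation S := ('rV[R]_l * measurableTypeR R)%type.
Context d (O : measurableType d) (P : probability O R).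
Context dT (T : measurableType dT) (X : O -> set T) (phi : T -> S).
Variables (g : measurableTypeR R -> \bar R) (C b : R).
Hypothesis mphi : measurable_fun setT phi.
Hypothesis mX : forall B, measurable B -> measurable [set o | X o `&` B = set0].
Hypothesis mg : measurable_fun setT g.
Hypothesis g0 : forall h, (0 <= g h)%E.
Hypothesis C0 : 0 < C.
Hypothesis lb : l%:R / 2 + 1 < b.
Hypothesis gE : forall h : R, h < 0 -> g h = (C * (- h) `^ (- b))%:E.
Hypothesis voidX : forall B, measurable B ->
  P [set o | X o `&` phi @^-1` B = set0] = expeR (- intensity g B).

(** A cube of side e has squared diameter at most l e^2, so one point in the
    slab over it has negative height as seen from every w of the cube. *)
Definition slab (c : 'I_l -> R) (e : R) : set S :=
  box c e `*` `[- (2 * (l.+1%:R * e ^+ 2)), - (l.+1%:R * e ^+ 2)]%classic.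

Lemma measurable_slab c e : measurable (slab c e).
Proof. by apply: measurableX; [exact: measurable_box|exact: measurable_itv]. Qed.

Lemma slab_covers c e w q : 0 < e -> box c e w -> slab c e q -> height w q < 0.
Proof.
move=> e0 cw [cq]; rewrite /= in_itv/= => /andP[_ qe].
have le2 : 0 < e ^+ 2 by rewrite exprn_gt0.
have : enorm (w - q.1) ^+ 2 <= l%:R * e ^+ 2.
  rewrite enorm_sqrB -[X in X%:R](card_ord l) mulr_natl -sumr_const.
  apply: ler_sum => i _; have := cw i; have := cq i.
  rewrite /= !in_itv/= => /andP[q1 q2] /andP[w1 w2].
  rewrite -real_normK ?num_real// lerXn2r ?nnegrE//; first exact: ltW.
  rewrite ler_norml; apply/andP; split; lra.
rewrite /height -natr1 mulrDl mul1r in qe *; move: (q.2 : R) (enorm _ ^+ 2) qe => t u; lra.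
Qed.

(* With e = 1/K and u = (l + 1) e^2, C' K^delta is e^l * u * (C (2 u)^(-b)). *)
Let C' := C * (2 * l.+1%:R) `^ (- b) * l.+1%:R.
Let delta := 2 * b - 2 - l%:R.

(** A slab of side e = 1/(k+1) has volume of order e^(l+2) and heights of order
    e^2, hence mass of order e^(l + 2 - 2 b).  The exponent is negative because
    b > l/2 + 1: finer grids have heavier slabs. *)
Lemma intensity_slab c k :
  ((C' * k.+1%:R `^ delta)%:E <= intensity g (slab c (k.+1%:R^-1)))%E.
Proof.
set K : R := k.+1%:R; have K0 : 0 < K by rewrite ltr0n.
set e := K^-1; have e0 : 0 < e by rewrite invr_gt0.
rewrite intensity_prod//; last exact: measurable_box.
rewrite lebesgue_box; last exact: ltW.
set u := l.+1%:R * e ^+ 2; have u0 : 0 < u by rewrite mulr_gt0// exprn_gt0.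
apply: (@le_trans _ _ ((e ^+ l)%:E * \int[mu]_(h in `[(- (2 * u))%R, (- u)%R]) (C * (2 * u) `^ (- b))%R%:E)%E); last first.
  apply: lee_wpmul2l; first by rewrite lee_fin exprn_ge0// ltW.
  apply: ge0_le_integral => //.
  - by move=> h _; rewrite lee_fin mulr_ge0 ?powR_ge0// ltW.
  - exact: measurable_funTS.
  - move=> h /=; rewrite in_itv/= => /andP[h1 h2].
    have h0 : h < 0 by lra.
    rewrite gE// lee_fin (ler_wpM2l (ltW C0))// !powRN lef_pV2 ?posrE ?powR_gt0//; [|lra|lra].
    apply: ge0_ler_powR; rewrite ?nnegrE; [|lra|lra|lra].
    by apply/ltW/(le_lt_trans _ lb); rewrite addr_ge0// divr_ge0.
rewrite integral_cst//= lebesgue_measure_itv/= lte_fin ltrN2 ifT; last by lra.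
have eE n : e ^+ n = K `^ (- n%:R) by rewrite exprVn powR_invn// ltW.
have L0 : 0 < 2 * l.+1%:R :> R by rewrite mulr_gt0.
have uE : 2 * u = 2 * l.+1%:R * e ^+ 2 by rewrite mulrA.
have KD x y : K `^ x * K `^ y = K `^ (x + y).
  by rewrite powRD ?(gt_eqF K0) ?implybT.
rewrite -EFinB -!EFinM lee_fin le_eqVlt; apply/orP; left; apply/eqP.
rewrite uE powRM ?ltW ?exprn_gt0// /u !eE -powRrM.
have -> : delta = - l%:R + (- 2%:R * - b + - 2%:R) by rewrite /delta; ring.
rewrite -!KD /C'; ring.
Qed.

(** If all slabs over a grid of the cube are hit, the cube is covered.  The
    probability that some slab of side 1/(k+1) is missed is at most the
    number of grid cells times exp (- C' (k+1)^delta), which tends to 0. *)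
Lemma ae_cube_covered (N : nat) :
  {ae P, forall o, forall w, cube N w -> exists2 q, (phi @` X o) q & height w q < 0}.
Proof.
pose grid k := {ffun 'I_l -> 'I_(2 * N * k.+1).+1}.
pose corner k (j : grid k) (i : 'I_l) : R := - N%:R + (j i)%:R / k.+1%:R.
pose miss k (j : grid k) := [set o | X o `&` phi @^-1` slab (corner k j) k.+1%:R^-1 = set0].
have mphi' B : measurable B -> measurable (phi @^-1` B).
  by move=> mB; rewrite -[X in measurable X]setTI; exact: mphi.
have mmiss k j : measurable (miss k j) by apply: mX; apply: mphi'; exact: measurable_slab.
pose bad k := [set o | exists2 j, j \in enum (grid k) & miss k j o].
have mbad k : measurable (bad k).
  rewrite (_ : bad k = [set o | exists j, j \in enum (grid k) /\ miss k j o]).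
    apply: measurable_exists_pred => j; apply: measurable_and_pred; last exact: mmiss.
    exact: measurable_const_pred.
  by apply/seteqP; split=> o [j]; [exists j|move=> []; exists j].
have Cp0 : 0 < C' by rewrite /C' !mulr_gt0// powR_gt0 mulr_gt0.
have d0 : 0 < delta by rewrite /delta; move: (l%:R : R) lb => x xb; lra.
have Pbad k : (P (bad k) <= (((2 * N * k.+1).+1 ^ l)%N%:R * expR (- (C' * k.+1%:R `^ delta)))%:E)%E.
  have Pmiss j : (P (miss k j) <= (expR (- (C' * k.+1%:R `^ delta)))%:E)%E.
    have -> : P (miss k j) = expeR (- intensity g (slab (corner k j) k.+1%:R^-1)).
      by apply: voidX; exact: measurable_slab.
    rewrite -[X in (_ <= X)%E]/(expeR (- (C' * k.+1%:R `^ delta))%:E) lee_expeR EFinN leeN2.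
    exact: intensity_slab.
  have := @measure_exists_in_le R _ O P _ (enum (grid k)) (miss k) _ (mmiss k) Pmiss.
  by rewrite -cardE card_ffun !card_ord -EFinM.
have mcap : measurable (\bigcap_k bad k) by exact: bigcapT_measurable.
exists (\bigcap_k bad k); split => //.
  apply/eqP; rewrite eq_le measure_ge0 andbT; apply/lee_addgt0Pr => e e0.
  rewrite add0e; have [k hk] := exp_decay_grid (2 * N) l Cp0 d0 e0.
  apply: (@le_trans _ _ (P (bad k))).
    by apply: le_measure; rewrite ?inE//; exact: bigcap_inf.
  by apply: le_trans (Pbad k) _; rewrite lee_fin ltW.
move=> o; apply: contra_notP => /existsNP[k /= nbad] w Nw.
set K : R := k.+1%:R; have K0 : 0 < K by rewrite ltr0n.
have wN i : - N%:R <= w ord0 i <= N%:R.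
  by move: Nw; rewrite cube_box => /(_ i); rewrite /= in_itv/= addrA addNr add0r.
have x0 i : 0 <= (w ord0 i + N%:R) * K.
  by have /andP[w1 _] := wN i; apply: mulr_ge0; [rewrite -lerBlDr sub0r|exact: ltW].
have xN i : (Num.truncn ((w ord0 i + N%:R) * K) < (2 * N * k.+1).+1)%N.
  have /andP[_ w2] := wN i; rewrite ltnS -(ler_nat R).
  have /andP[t1 _] := truncn_itv (x0 i); apply: le_trans t1 _; rewrite natrM (ler_wpM2r (ltW K0))//.
  by rewrite mul2n -addnn natrD lerD2r.
pose j : grid k := [ffun i => Ordinal (xN i)].
have cw : box (corner k j) K^-1 w.
  move=> i; rewrite /= in_itv/= /corner ffunE/=.
  have /andP[t1 t2] := truncn_itv (x0 i); rewrite -/K.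
  set t := Num.truncn _ in t1 t2 *.
  have tK : t%:R / K <= w ord0 i + N%:R by rewrite ler_pdivrMr.
  have Kt : w ord0 i + N%:R < t%:R / K + K^-1.
    by rewrite (_ : _ / K + _ = t.+1%:R / K) ?ltr_pdivlMr// -natr1 mulrDl mul1r.
  by move: (t%:R / K) (K^-1) (N%:R : R) tK Kt => x y z xz zy; apply/andP; split; lra.
have : exists q, (X o `&` phi @^-1` slab (corner k j) K^-1) q.
  apply: contrapT => nq; apply: nbad => _; exists j; first by rewrite mem_enum.
  by rewrite /miss/= -subset0 => q Xq; apply: nq; exists q.
move=> [q [Xq sq]]; exists (phi q); first by exists q.
by apply: (slab_covers _ cw sq); rewrite invr_gt0.
Qed.

Lemma ae_covered :
  {ae P, forall o, forall w, exists2 q, (phi @` X o) q & height w q < 0}.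
Proof.
have := ae_foralln (fun N => ae_cube_covered N).
by apply: filterS => o covo w; have [N wN] := bigcup_cube w; exact: covo wN.
Qed.

End coverage.

(** * Iterated profiles and normalising constants *)

Lemma Gamma1 (R : realType) : Gamma (1 : R) = 1.
Proof.
rewrite /Gamma /Rintegral.
have -> : (\int[lebesgue_measure]_(t in `]0%R, +oo[) ((t : R) `^ (1 - 1) * expR (- t))%:E =
    \int[lebesgue_measure]_(t in `[0%R, +oo[) (expR (- (t : R)))%:E)%E.
  under eq_integral do rewrite subrr powRr0 mul1r.
  apply: integral_itv_obnd_cbnd; apply/measurable_EFinP.
  by apply: measurableT_comp => //; exact: measurable_funN.
rewrite (_ : integral _ _ _ = 1%E)//.
rewrite -(integral_exponential_pdf (rate := 1 : R))// integral_mkcond.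
apply: eq_integral => t _; rewrite /exponential_pdf !patchE.
by case: ifP => // _; rewrite mul1r mulN1r.
Qed.

(* Keeps unification from unfolding the integral that defines [Gamma]. *)
Local Opaque Gamma.

Section iterated_profiles.
Context {R : realType}.
Implicit Types (C b y : R) (k l : nat).

Let telescope_den (c p q x y z : R) : y != 0 ->
  c * (p * x / y) * (q * y / z) = c * (p * q * x / z).
Proof. by move=> y0; move: (z^-1) => u; field. Qed.

Let telescope_num (c p q x y z : R) : y != 0 ->
  c * (p * y / x) * (q * z / y) = c * (p * q * z / x).
Proof. by move=> y0; move: (x^-1) => u; field. Qed.

Lemma iter_abel_exp k C y : 0 <= C -> 0 < y ->
  iter k abel (fun h : measurableTypeR R => (C * expR (y * h))%:E) =
  (fun h => (C * (Num.sqrt pi * y `^ (- 2^-1)) ^+ k * expR (y * h))%:E).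
Proof.
move=> C0 y0; elim: k => [|k ih]; first by apply/funext => h; rewrite expr0 mulr1.
rewrite iterS ih; apply/funext => t; rewrite abel_exp//.
  by congr (_ * _)%:E; rewrite exprSr -[LHS]mulrA.
by rewrite mulr_ge0// exprn_ge0// mulr_ge0 ?sqrtr_ge0 ?powR_ge0.
Qed.

Lemma half_nat_ge0 k : 0 <= k%:R / 2 :> R.
Proof. by rewrite divr_ge0. Qed.

Lemma half_natS k : k.+1%:R / 2 = k%:R / 2 + 2^-1 :> R.
Proof. by rewrite -natr1 mulrDl mul1r. Qed.

Lemma Gamma_shift_gt0 b m : -1 < b -> 0 < Gamma (b + m%:R / 2 + 1).
Proof.
by move=> b1; apply: Gamma_gt0; have := half_nat_ge0 m; move: (m%:R / 2 : R) => x; lra.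
Qed.

Lemma iter_abel_ppow k C b : 0 <= C -> -1 < b ->
  iter k abel (fun h : measurableTypeR R => (C * ppow b h)%:E) =
  (fun h => (C * (Num.sqrt pi ^+ k * Gamma (b + 1) / Gamma (b + k%:R / 2 + 1)) *
    ppow (b + k%:R / 2) h)%:E).
Proof.
move=> C0 b1; have G0 := Gamma_shift_gt0 0 b1; rewrite mul0r addr0 in G0.
elim: k => [|k ih].
  apply/funext => h; rewrite mul0r addr0 expr0 mul1r divff ?mulr1//.
  exact: lt0r_neq0.
have Gk := Gamma_shift_gt0 k b1; rewrite iterS ih {ih}.
have bk : -1 < b + k%:R / 2.
  by have := half_nat_ge0 k; move: (k%:R / 2 : R) => x; lra.
have Ck : 0 <= C * (Num.sqrt pi ^+ k * Gamma (b + 1) / Gamma (b + k%:R / 2 + 1)).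
  apply: (mulr_ge0 C0); apply: divr_ge0; last exact: (ltW Gk).
  by apply: mulr_ge0; [exact/exprn_ge0/sqrtr_ge0|exact: (ltW G0)].
rewrite (abel_ppow Ck bk); apply/funext => h; rewrite half_natS addrA exprSr.
have := lt0r_neq0 Gk; clear G0 Gk Ck.
move: (Gamma (b + k%:R / 2 + 2^-1 + 1)) (Gamma (b + k%:R / 2 + 1)) (Gamma (b + 1)) => z y x.
move: (ppow _ h) => u y0.
by rewrite telescope_den.
Qed.

Lemma iter_abel_npow k C b (g : measurableTypeR R -> \bar R) : 0 <= C -> k%:R / 2 < b ->
  (forall h : R, h < 0 -> g h = (C * (- h) `^ (- b))%:E) ->
  forall t : R, t < 0 -> iter k abel g t =
    (C * (Num.sqrt pi ^+ k * Gamma (b - k%:R / 2) / Gamma b) * (- t) `^ (- (b - k%:R / 2)))%:E.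
Proof.
move=> C0; elim: k => [|k ih] kb gE t t0.
  rewrite mul0r in kb; have G0 := lt0r_neq0 (Gamma_gt0 kb).
  by rewrite mul0r subr0 expr0 mul1r (divff G0) mulr1 /= gE.
have k0 := half_nat_ge0 k; move: kb; rewrite half_natS => kb.
have b0 : 0 < b by lra.
have bk0 : 0 < b - k%:R / 2 by lra.
have bk1 : 2^-1 < b - k%:R / 2 by lra.
have bk2 : k%:R / 2 < b by lra.
have G0 := Gamma_gt0 b0; have Gk := Gamma_gt0 bk0.
have Ck : 0 <= C * (Num.sqrt pi ^+ k * Gamma (b - k%:R / 2) / Gamma b).
  apply: (mulr_ge0 C0); apply: divr_ge0; last exact: (ltW G0).
  by apply: mulr_ge0; [exact/exprn_ge0/sqrtr_ge0|exact: (ltW Gk)].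
rewrite iterS (abel_npow Ck bk1 (ih bk2 gE) t0) {ih}.
have -> : b - (k%:R / 2 + 2^-1) = b - k%:R / 2 - 2^-1 by rewrite opprD addrA.
rewrite exprSr; have := lt0r_neq0 Gk; clear G0 Gk Ck.
move: (Gamma (b - k%:R / 2 - 2^-1)) (Gamma (b - k%:R / 2)) (Gamma b) => z y x.
move: ((- t) `^ _) => u y0.
by rewrite telescope_num.
Qed.

Lemma sqrt_pi_exp k : Num.sqrt pi ^+ k = pi `^ (k%:R / 2) :> R.
Proof.
by rewrite -powR12_sqrt ?pi_ge0// -powR_mulrn ?powR_ge0// -powRrM mulrC.
Qed.

Lemma pi_powD k l : pi `^ ((k + l).+1%:R / 2) = pi `^ (l.+1%:R / 2) * Num.sqrt pi ^+ k :> R.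
Proof.
rewrite sqrt_pi_exp -powRD ?(gt_eqF (pi_gt0 R)) ?implybT//.
by congr (_ `^ _); rewrite -!natr1 natrD; field.
Qed.

Let beta_algebra (a p q x y : R) : x != 0 -> q != 0 ->
  a / (p * q * x) * (q * x / y) = a / (p * y).
Proof. by move=> x0 q0; rewrite !invfM; move: (p^-1) (y^-1) => u v; field; rewrite x0 q0. Qed.

Let beta'_algebra (a p q x y : R) : x != 0 -> q != 0 ->
  x / (p * q * y) * (q * a / x) = a / (p * y).
Proof. by move=> x0 q0; rewrite !invfM; move: (p^-1) (y^-1) => u v; field; rewrite x0 q0. Qed.

Lemma sqrt_pi_neq0 k : Num.sqrt pi ^+ k != 0 :> R.
Proof. by rewrite expf_neq0// gt_eqF// sqrtr_gt0 pi_gt0. Qed.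

(** The constants of dimensions k + l and l share the factor
    Gamma ((k + l + 1) / 2 + b + 1); the k factors sqrt pi complete the powers
    of pi. *)
Lemma beta_const_section k l b : -1 < b ->
  beta_const (k + l).+1 b * (Num.sqrt pi ^+ k * Gamma (b + 1) / Gamma (b + k%:R / 2 + 1)) =
  beta_const l.+1 (b + k%:R / 2).
Proof.
move=> b1; have b10 : 0 < b + 1 by lra.
rewrite /beta_const pi_powD.
have -> : (k + l).+1%:R / 2 + b + 1 = l.+1%:R / 2 + (b + k%:R / 2) + 1 :> R.
  by rewrite -!natr1 natrD; field.
exact: beta_algebra (lt0r_neq0 (Gamma_gt0 b10)) (sqrt_pi_neq0 k).
Qed.

Lemma beta'_const_section k l b : 0 < b ->
  beta'_const (k + l).+1 b * (Num.sqrt pi ^+ k * Gamma (b - k%:R / 2) / Gamma b) =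
  beta'_const l.+1 (b - k%:R / 2).
Proof.
move=> b0; rewrite /beta'_const pi_powD.
have -> : b - (k + l).+1%:R / 2 = b - k%:R / 2 - l.+1%:R / 2 :> R.
  by rewrite -addnS natrD; field.
exact: beta'_algebra (lt0r_neq0 (Gamma_gt0 b0)) (sqrt_pi_neq0 k).
Qed.

(** The profile (-h)^(-1) has the Abel transform of value pi at -1 (the
    Cauchy integral), which [abel_npow] also evaluates as sqrt pi times
    Gamma (1/2). *)
Lemma Gamma_half : Gamma (2^-1 : R) = Num.sqrt pi.
Proof.
pose g (h : measurableTypeR R) : \bar R := ((- h)^-1)%:E.
have gE (h : R) : h < 0 -> g h = (1 * (- h) `^ (- 1))%:E.
  by move=> h0; rewrite mul1r powR_inv1// oppr_ge0 ltW.
have half1 : 2^-1 < 1 :> R by lra.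
have N10 : - 1 < 0 :> R by rewrite oppr_lt0.
have := abel_npow ler01 half1 gE N10.
rewrite opprK powR1 mulr1 mul1r Gamma1 divr1.
have -> : abel g (- 1) = pi%:E.
  rewrite /abel (_ : (fun x => _) = (fun x => (oneDsqr x)^-1%:E)); last first.
    by apply/funext => x; rewrite /g /oneDsqr opprB opprK addrC.
  rewrite ge0_symfun_integralT//=.
  - rewrite (_ : [set x | _] = `[0, +oo[%classic); last first.
      by apply/seteqP; split => x/=; rewrite in_itv/= andbT.
    by rewrite integral0y_oneDsqr -EFinM mulrCA divff// mulr1.
  - exact: continuous_oneDsqrV.
  - by move=> x /=; rewrite /oneDsqr sqrrN.
move=> [] /esym; rewrite (_ : 1 - 2^-1 = 2^-1 :> R); last by lra.
rewrite -[X in _ = X](sqr_sqrtr (pi_ge0 R)) expr2 => /mulfI; apply.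
by rewrite gt_eqF// sqrtr_gt0 pi_gt0.
Qed.

Lemma locally_compact_ge0 (t : R) : 0 <= t -> exists2 r, 0 < r &
  compact ([set h : R | 0 <= h] `&` `[t - r, t + r]).
Proof.
move=> t0; exists 1 => //; rewrite setIC; apply: compact_closedI; first exact: segment_compact.
exact: closed_ge.
Qed.

Lemma locally_compact_lt0 (t : R) : t < 0 -> exists2 r, 0 < r &
  compact ([set h : R | h < 0] `&` `[t - r, t + r]).
Proof.
move=> t0; exists (- t / 2); first by rewrite divr_gt0// oppr_gt0.
rewrite setIidr; first exact: segment_compact.
move=> h /=; rewrite in_itv/= => /andP[_]; lra.
Qed.

Lemma locally_compact_setT (t : R) : setT t -> exists2 r, 0 < r &
  compact ([set: R] `&` `[t - r, t + r]).
Proof. by move=> _; exists 1 => //; rewrite setTI; exact: segment_compact. Qed.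

Lemma integral_itv_bounded_lty (a b M : R) (g : measurableTypeR R -> \bar R) :
  measurable_fun setT g -> (forall h, 0 <= g h)%E ->
  (forall h : R, (a <= h <= b)%R -> g h <= M%:E)%E ->
  (\int[lebesgue_measure]_(h in `[a, b]) g h < +oo)%E.
Proof.
move=> mg g0 gM.
apply: (@le_lt_trans _ _ (\int[lebesgue_measure]_(h in `[a, b]) M%:E)%E).
  apply: ge0_le_integral => //; first exact: measurable_funTS.
rewrite integral_cst//= lebesgue_measure_itv/=; case: ifP => _; last by rewrite mule0 ltry.
by rewrite -EFinB -EFinM ltry.
Qed.

(** On a bounded interval the power is at most a multiple of the integrand of
    Gamma (b + 1), whose integral is known to be finite. *)
Lemma integral_ppow_lty C b (m : nat) : 0 <= C -> -1 < b ->
  (\int[lebesgue_measure]_(h in `[0%R, m%:R]) (C * ppow b h)%:E < +oo)%E.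
Proof.
move=> C0 b1; have mb : measurable_fun setT (fun h : measurableTypeR R => (C * ppow b h)%:E).
  by apply/measurable_EFinP; apply: measurable_funM => //; exact: measurable_ppow.
have mG : measurable_fun setT (fun h : measurableTypeR R => (gamma_fun (b + 1) h)%:E).
  by apply/measurable_EFinP; exact: measurable_gamma_fun.
have b10 : 0 < b + 1 by lra.
apply: (@le_lt_trans _ _ (\int[lebesgue_measure]_h ((C * expR m%:R)%:E * (gamma_fun (b + 1) h)%:E))%E).
  rewrite integral_mkcond; apply: ge0_le_integral => //.
  - move=> h _; rewrite patchE; case: ifP => // _.
    by rewrite lee_fin mulr_ge0// ppow_ge0.
  - by apply/(measurable_restrictT _ _).1 => //; exact: measurable_funTS.
  - exact: measurable_funeM.
  - move=> h _; rewrite patchE -EFinM; case: ifP => [/set_mem/=|_]; last first.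
      by rewrite lee_fin mulr_ge0 ?gamma_fun_ge0// mulr_ge0// expR_ge0.
    rewrite in_itv/= => /andP[h0 hm]; rewrite lee_fin -mulrA ler_wpM2l//.
    rewrite /gamma_fun addrK mulrCA -expRD ler_peMr ?ppow_ge0//.
    by rewrite -[leLHS]expR0 ler_expR subr_ge0.
rewrite ge0_integralZl_EFin//; last 2 first.
- by move=> h _; rewrite lee_fin gamma_fun_ge0.
- by rewrite mulr_ge0// expR_ge0.
by rewrite GammaE// -EFinM ltry.
Qed.

End iterated_profiles.

(** * Sections of Poisson-Laguerre tessellations *)
Section poisson_with_density.
Context {R : realType} (n : nat).
Local Open Scope ereal_scope.
Local Notation S n := ('rV[R]_n * measurableTypeR R)%type.
Context d (O : measurableType d) (P : probability O R) (X : O -> set (S n)).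
Variables (J : set (measurableTypeR R)) (F : measurableTypeR R -> R).
Variable g : measurableTypeR R -> \bar R.
Hypothesis mJ : measurable J.
Hypothesis mF : measurable_fun setT F.
Hypothesis mg : measurable_fun setT g.
Hypothesis g0 : forall h, 0 <= g h.
Hypothesis gJ : forall h, h != 0%R -> J h -> g h = (F h)%:E.
Hypothesis gN : forall h, h != 0%R -> ~ J h -> g h = 0.
Hypothesis poiX : is_poisson_process P (density_measure [set z | J z.2] (fun _ h => F h)) X.

Lemma density_process_void B : measurable B ->
  P [set o | X o `&` B = set0] = expeR (- intensity g B).
Proof.
move=> mB; rewrite -(density_intensity mJ mF mg mB gJ gN).
apply: (poisson_void poiX mB).
by rewrite (density_intensity mJ mF mg mB gJ gN) intensity_ge0.
Qed.

Lemma density_process_finite B : measurable B -> intensity g B < +oo ->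
  {ae P, forall o, finite_set (X o `&` B)}.
Proof.
move=> mB gB; have e := density_intensity mJ mF mg mB gJ gN.
by apply: (poisson_finite poiX mB); rewrite e// intensity_ge0.
Qed.

End poisson_with_density.

Section section_of_poisson.
Context {R : realType} (k l : nat).
Local Open Scope ereal_scope.
Local Notation mu := (@lebesgue_measure R).
Local Notation S n := ('rV[R]_n * measurableTypeR R)%type.
Context d1 (O1 : measurableType d1) (P1 : probability O1 R).
Context d2 (O2 : measurableType d2) (P2 : probability O2 R).
Variables (X1 : O1 -> set (S (k + l))) (X2 : O2 -> set (S l)) (s : R).
Variables (J : set (measurableTypeR R)) (Jb : nat -> set (measurableTypeR R)).
Variable F : measurableTypeR R -> R.
Hypothesis mJ : measurable J.
Hypothesis J_loc : forall t, J t -> exists2 r, (0 < r)%R & compact ((J : set R) `&` `[(t - r)%R, (t + r)%R]).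
Hypothesis mF : measurable_fun setT F.
Hypothesis mJb : forall b, measurable (Jb b).
Hypothesis Jb_nbhs : forall t, J t -> exists r b,
  (0 < r)%R /\ forall u, J u -> (`|t - u| < r)%R -> Jb b u.
Hypothesis lfX2 : forall o, @locally_finite_in ('rV[R]_l * R)%type [set z | J z.2] (X2 o).
Hypothesis poiX2 : is_poisson_process P2 (density_measure [set z | J z.2] (fun _ h => F h)) X2.

Let phi : S (k + l) -> S l := shift s \o @fold R l k.

Let mphi : measurable_fun setT phi.
Proof. by apply: measurableT_comp; [exact: measurable_shift|exact: measurable_fold]. Qed.

Let height_phi w z : height w (phi z) = (height (w *m pid_mx l) z + s)%R.
Proof. by rewrite height_fold -height_shift. Qed.

Section known_intensity.
Variable g : measurableTypeR R -> \bar R.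
Hypothesis mg : measurable_fun setT g.
Hypothesis g0 : forall h, 0 <= g h.
Hypothesis gF : forall h, h != 0%R -> J h -> g h = (F h)%:E.
Hypothesis Jb_fin : forall b, \int[mu]_(h in Jb b) g h < +oo.
Hypothesis mX1 : forall B, measurable B -> measurable [set o | X1 o `&` B = set0].
Hypothesis isoX1 : forall o, isolating (@base R (k + l)) (X1 o).
Hypothesis voidX1 : forall B, measurable B ->
  P1 [set o | X1 o `&` phi @^-1` B = set0] = expeR (- intensity g B).
Hypothesis finX1 : forall B, measurable B -> intensity g B < +oo ->
  {ae P1, forall o, finite_set (X1 o `&` phi @^-1` B)}.
Hypothesis restrX1 : {ae P1, forall o,
  laguerre (phi @` X1 o) = laguerre (phi @` X1 o `&` [set z | J z.2])}.

(** The source enters through the void probabilities and the finiteness of its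
    folding, so that Voronoi generators, which have no density in height, are
    covered too. *)
Lemma section_to_poisson T1 T2 :
  (forall o, T1 o = laguerre (X1 o)) -> (forall o, T2 o = laguerre (X2 o)) ->
  eq_distribution P1 (fun w => sectional_tessellation l (T1 w)) P2 T2.
Proof.
have mg' : measurable_fun setT (g \_ J).
  by apply/(measurable_restrictT _ _).1 => //; exact: measurable_funTS.
have g'0 h : 0 <= (g \_ J) h by rewrite patchE; case: ifP.
apply: (sectional_law mphi height_phi mg g0 mJ mJb Jb_nbhs Jb_fin (g' := g \_ J)) => //.
- by move=> h Jh; rewrite patchE mem_set.
- by move=> h Jh; rewrite patchE memNset.
- exact: measurable_poisson_void poiX2.
- by move=> o; exact: locally_finite_isolating J_loc (lfX2 o).
- apply: (density_process_void mJ mF mg' g'0 _ _ poiX2).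
  + by move=> h h0 Jh; rewrite patchE mem_set// gF.
  + by move=> h h0 Jh; rewrite patchE memNset.
Qed.

End known_intensity.

Variables (J0 : set (measurableTypeR R)) (F0 : measurableTypeR R -> R).
Variable g0 : measurableTypeR R -> \bar R.
Hypothesis mJ0 : measurable J0.
Hypothesis J0_loc : forall t, J0 t -> exists2 r, (0 < r)%R & compact ((J0 : set R) `&` `[(t - r)%R, (t + r)%R]).
Hypothesis mF0 : measurable_fun setT F0.
Hypothesis mg0 : measurable_fun setT g0.
Hypothesis g0_ge0 : forall h, 0 <= g0 h.
Hypothesis g0J0 : forall h, h != 0%R -> J0 h -> g0 h = (F0 h)%:E.
Hypothesis g0N : forall h, h != 0%R -> ~ J0 h -> g0 h = 0.
Hypothesis lfX1 : forall o, @locally_finite_in ('rV[R]_(k + l) * R)%type [set z | J0 z.2] (X1 o).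
Hypothesis poiX1 : is_poisson_process P1 (density_measure [set z | J0 z.2] (fun _ h => F0 h)) X1.

Let g (h : measurableTypeR R) := iter k abel g0 (h - s)%R.

Let mg : measurable_fun setT g.
Proof.
by apply: (measurableT_comp (measurable_iter_abel k mg0 g0_ge0)); exact: measurable_funB.
Qed.

Let g_ge0 h : 0 <= g h.
Proof. exact: iter_abel_ge0. Qed.

Let intensity_phi B : measurable B -> intensity g0 (phi @^-1` B) = intensity g B.
Proof.
move=> mB; rewrite -(intensity_shift s mB (measurable_iter_abel k mg0 g0_ge0)); last first.
  exact: iter_abel_ge0.
rewrite -intensity_fold//.
by rewrite -[X in measurable X]setTI; exact: (measurable_shift s).
Qed.

Let mpre B : measurable B -> measurable (phi @^-1` B).
Proof. by move=> mB; rewrite -[X in measurable X]setTI; exact: mphi. Qed.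

Lemma density_section_void B : measurable B ->
  P1 [set o | X1 o `&` phi @^-1` B = set0] = expeR (- intensity g B).
Proof.
move=> mB; rewrite -intensity_phi//.
by apply: (density_process_void mJ0 mF0 mg0 g0_ge0 g0J0 g0N poiX1); exact: mpre.
Qed.

Hypothesis gF : forall h, h != 0%R -> J h -> g h = (F h)%:E.
Hypothesis Jb_fin : forall b, \int[mu]_(h in Jb b) g h < +oo.
Hypothesis restrX1 : {ae P1, forall o,
  laguerre (phi @` X1 o) = laguerre (phi @` X1 o `&` [set z | J z.2])}.

Lemma poisson_section T1 T2 :
  (forall o, T1 o = laguerre (X1 o)) -> (forall o, T2 o = laguerre (X2 o)) ->
  eq_distribution P1 (fun w => sectional_tessellation l (T1 w)) P2 T2.
Proof.
apply: (section_to_poisson mg g_ge0) => //.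
- exact: measurable_poisson_void poiX1.
- by move=> o; exact: locally_finite_isolating J0_loc (lfX1 o).
- exact: density_section_void.
- move=> B mB; rewrite -intensity_phi// => gB.
  by apply: (density_process_finite mJ0 mF0 mg0 g0_ge0 g0J0 g0N poiX1) => //; exact: mpre.
Qed.

End section_of_poisson.

(** * The three families *)
Section three_families.
Context {R : realType} (k l : nat).
Local Notation mu := (@lebesgue_measure R).
Context d1 (O1 : measurableType d1) (P1 : probability O1 R).
Context d2 (O2 : measurableType d2) (P2 : probability O2 R).
Variables (T1 : O1 -> set (set 'rV[R]_(k + l))) (T2 : O2 -> set (set 'rV[R]_l)).

Lemma fold_height_le n m (z : 'rV[R]_(m + n) * measurableTypeR R) :
  (z.2 : R) <= (@fold R n m z).2.
Proof.
elim: m z => [|m ih] z //=; apply: le_trans (ih _).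
by rewrite /= lerDl sqr_ge0.
Qed.

Lemma gaussian_section (lambda : R) : 0 < lambda ->
  is_gaussian_voronoi P1 lambda T1 -> is_gaussian_voronoi P2 lambda T2 ->
  eq_distribution P1 (fun w => sectional_tessellation l (T1 w)) P2 T2.
Proof.
move=> l0 [c1 c10 [X1 [lf1 poi1 T1E]]] [c2 c20 [X2 [lf2 poi2 T2E]]].
pose K := c1 * (Num.sqrt pi * lambda `^ (- 2^-1)) ^+ k.
have K0 : 0 < K.
  by rewrite mulr_gt0// exprn_gt0// mulr_gt0 ?powR_gt0// sqrtr_gt0 pi_gt0.
(* the shift that turns the folded intensity into the prescribed one *)
pose s := ln (K / c2) / lambda.
have sE : expR (lambda * s) = K / c2.
  by rewrite mulrC divfK ?gt_eqF// lnK// posrE divr_gt0.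
have mF c : measurable_fun setT (fun h : measurableTypeR R => c * expR (lambda * h)).
  by apply: measurable_funM => //; apply: measurableT_comp => //; exact: measurable_funM.
have KE h : iter k abel (fun h : measurableTypeR R => (c1 * expR (lambda * h))%:E) (h - s) =
    (c2 * expR (lambda * h))%:E.
  rewrite iter_abel_exp ?ltW// -/K mulrBr expRB sE.
  by rewrite invf_div mulrCA (mulrCA K) divff ?gt_eqF// mulr1 mulrC.
apply: (@poisson_section R k l _ _ P1 _ _ P2 X1 X2 s setT
  (fun m => `[- m%:R, m%:R]%classic) (fun h => c2 * expR (lambda * h))
  _ _ _ _ _ _ _ setT (fun h => c1 * expR (lambda * h))
  (fun h => (c1 * expR (lambda * h))%:E)) => //.
- exact: locally_compact_setT.
- move=> t _; exists 1, (Num.truncn (`|t| + 1)).+1; split=> // u _ tu.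
  rewrite /= in_itv/= -ler_norml (le_trans _ (ltW (truncnS_gt _)))//.
  by rewrite -[u](subKr t) (le_trans (ler_normB _ _))// lerD2l ltW.
- exact: locally_compact_setT.
- by apply/measurable_EFinP.
- by move=> h; rewrite lee_fin mulr_ge0 ?expR_ge0// ltW.
- by move=> h _ /(_ I).
- move=> m; under eq_integral do rewrite KE.
  apply: (@integral_itv_bounded_lty R _ _ (c2 * expR (lambda * m%:R))).
  + by apply/measurable_EFinP.
  + by move=> h; rewrite lee_fin mulr_ge0 ?expR_ge0// ltW.
  + by move=> h /andP[_ hm]; rewrite lee_fin ler_wpM2l ?(ltW c20)// ler_expR ler_wpM2l// ltW.
- by apply: aeW => o; rewrite setIT.
Qed.

Lemma beta'_section (b c : R) : (k + l)%:R / 2 + 1 < b -> 0 < c ->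
  is_beta'_voronoi P1 b c T1 -> is_beta'_voronoi P2 (b - k%:R / 2) c T2 ->
  eq_distribution P1 (fun w => sectional_tessellation l (T1 w)) P2 T2.
Proof.
move=> lb c0 [X1 [lf1 poi1 T1E]] [X2 [lf2 poi2 T2E]].
have kl : k%:R / 2 + l%:R / 2 + 1 < b by rewrite -mulrDl -natrD.
have k2 : 0 <= k%:R / 2 :> R := half_nat_ge0 k.
have l2 : 0 <= l%:R / 2 :> R := half_nat_ge0 l.
have b0 : 0 < b by lra.
have bk : 0 < b - k%:R / 2 by lra.
have kb : k%:R / 2 < b by lra.
have lb' : l%:R / 2 + 1 < b - k%:R / 2 by lra.
have mF C e : measurable_fun setT (fun h : measurableTypeR R => C * (- h) `^ e).
  by apply: measurable_funM => //; apply: measurableT_comp (measurable_powR _) _; exact: measurable_funN.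
pose C1 := c * beta'_const (k + l).+1 b.
pose C2 := c * beta'_const l.+1 (b - k%:R / 2).
have bl0 : 0 < b - k%:R / 2 - l.+1%:R / 2 by rewrite half_natS; lra.
have C20 : 0 < C2.
  rewrite mulr_gt0// divr_gt0 ?Gamma_gt0// mulr_gt0 ?Gamma_gt0// powR_gt0 ?pi_gt0//.
have kl0 : 0 < b - (k + l).+1%:R / 2 by rewrite half_natS natrD mulrDl; lra.
have C10 : 0 < C1.
  by rewrite mulr_gt0// divr_gt0 ?Gamma_gt0// mulr_gt0 ?Gamma_gt0// powR_gt0 ?pi_gt0.
pose J : set (measurableTypeR R) := [set h : R | h < 0].
have mJ : measurable J.
  rewrite (_ : J = `]-oo, 0%R[%classic); first exact: measurable_itv.
  by apply/seteqP; split=> h; rewrite /J/= in_itv.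
pose g0 : measurableTypeR R -> \bar R := (fun h => (C1 * (- h) `^ (- b))%:E) \_ J.
have mg0 : measurable_fun setT g0.
  by apply/(measurable_restrictT _ _).1 => //; apply: measurable_funTS; apply/measurable_EFinP; exact: mF.
have g00 h : (0 <= g0 h)%E.
  rewrite /g0 patchE; case: ifP => _; last exact: lexx.
  by rewrite lee_fin; apply: mulr_ge0; [exact: ltW|exact: powR_ge0].
have g0E (h : R) : h < 0 -> g0 h = (C1 * (- h) `^ (- b))%:E.
  by move=> h0; rewrite /g0 patchE mem_set.
have gE (h : R) : h < 0 -> iter k abel g0 (h - 0) = (C2 * (- h) `^ (- (b - k%:R / 2)))%:E.
  move=> h0; rewrite subr0 (iter_abel_npow (ltW C10) kb g0E h0).
  by rewrite /C1 -(mulrA c) (beta'_const_section k l b0) -/C2.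
(* The intervals exhaust the negative heights while avoiding the singularity of
   the profile at zero. *)
apply: (@poisson_section R k l _ _ P1 _ _ P2 X1 X2 0 J
  (fun m => `[- m%:R, - m.+1%:R^-1]%classic) (fun h => C2 * (- h) `^ (- (b - k%:R / 2)))
  _ _ _ _ _ _ _ J (fun h => C1 * (- h) `^ (- b)) g0) => //.
- exact: locally_compact_lt0.
- move=> t t0; have t20 : 0 < - t / 2 by rewrite divr_gt0// oppr_gt0.
  have [m1 _ /(_ m1 (leqnn m1)) /= m1t] := near_infty_natSinv_lt (PosNum t20).
  pose m2 := (Num.truncn (2 * `|t|)).+1.
  exists (- t / 2), (maxn m1 m2); split=> // u u0 tu.
  rewrite /= in_itv/=; apply/andP; split.
    have m2t : 2 * `|t| < m2%:R := truncnS_gt _.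
    have : m2%:R <= (maxn m1 m2)%:R :> R by rewrite ler_nat leq_maxr.
    move: tu m2t; rewrite ltr_norml (ltr0_norm t0) => /andP[]; lra.
  have : (maxn m1 m2).+1%:R^-1 <= m1.+1%:R^-1 :> R.
    by rewrite lef_pV2 ?posrE// ler_nat ltnS leq_maxl.
  move: tu m1t; rewrite ltr_norml => /andP[].
  move: (m1.+1%:R^-1 : R) ((maxn m1 m2).+1%:R^-1 : R) => x y; lra.
- exact: locally_compact_lt0.
- by move=> h _; exact: g0E.
- by move=> h _ h0; rewrite /g0 patchE memNset.
- move=> h _; exact: gE.
- move=> m; rewrite (eq_integral (fun h : measurableTypeR R => (C2 * (- h) `^ (- (b - k%:R / 2)))%:E)); last first.
    move=> h /set_mem/=; rewrite in_itv/= => /andP[_ hm]; apply: gE.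
    by apply: le_lt_trans hm _; rewrite oppr_lt0 invr_gt0.
  apply: (@integral_itv_bounded_lty R _ _ (C2 * (m.+1%:R^-1) `^ (- (b - k%:R / 2)))).
  + by apply/measurable_EFinP; exact: mF.
  + by move=> h; exact: (mulr_ge0 (ltW C20) (powR_ge0 _ _)).
  + move=> h /andP[_ hm]; rewrite lee_fin (ler_wpM2l (ltW C20))// !powRN.
    have m0 : 0 < m.+1%:R^-1 :> R by rewrite invr_gt0.
    have hm' : m.+1%:R^-1 <= - h by rewrite lerNr.
    have h0 := lt_le_trans m0 hm'.
    rewrite lef_pV2 ?posrE ?powR_gt0//.
    by apply: ge0_ler_powR; rewrite ?nnegrE ?(ltW h0) ?(ltW m0)// ltW.
- have mphi : measurable_fun setT (shift 0 \o @fold R l k).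
    by apply: measurableT_comp; [exact: measurable_shift|exact: measurable_fold].
  have gkE : (fun h : measurableTypeR R => iter k abel g0 (h - 0)) = iter k abel g0.
    by apply/funext => h; rewrite subr0.
  have gE' (h : R) : h < 0 -> iter k abel g0 h = (C2 * (- h) `^ (- (b - k%:R / 2)))%:E.
    by move=> h0; rewrite -gE// subr0.
  have voidX B : measurable B -> P1 [set o | X1 o `&` (shift 0 \o @fold R l k) @^-1` B = set0] =
      expeR (- intensity (iter k abel g0) B).
    move=> mB; rewrite -gkE; apply: (density_section_void 0 mJ (mF C1 (- b)) mg0 g00 _ _ poi1 mB).
      by move=> h _; exact: g0E.
    by move=> h _ h0; rewrite /g0 patchE memNset.
  have := ae_covered mphi (measurable_poisson_void poi1) (measurable_iter_abel k mg0 g00)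
    (iter_abel_ge0 k g00) C20 lb' gE' voidX.
  by apply: filterS => o /laguerre_restrict_neg.
Qed.

End three_families.

Section square_preimage.
Context {R : realType}.
Local Open Scope ereal_scope.
Local Notation mu := (@lebesgue_measure R).
Local Notation S n := ('rV[R]_n * measurableTypeR R)%type.

(** The two half-lines contribute equally, each with density r^(-1/2) / 2. *)
Lemma lebesgue_sqr_preimage (A : set (measurableTypeR R)) : measurable A ->
  mu ((fun x : measurableTypeR R => (x ^+ 2)%R : measurableTypeR R) @^-1` A) =
  \int[mu]_(t in A) (ppow (- 2^-1) t)%:E.
Proof.
move=> mA; set sq := (fun x : measurableTypeR R => (x ^+ 2)%R : measurableTypeR R).
have msq : measurable_fun setT sq by exact: measurable_funX.
have mS : measurable (sq @^-1` A) by rewrite -[X in measurable X]setTI; exact: msq.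
pose pos : set (measurableTypeR R) := `]0%R, +oo[%classic.
have mpos : measurable pos by exact: measurable_itv.
pose neg : set (measurableTypeR R) := (-%R : measurableTypeR R -> measurableTypeR R) @^-1` pos.
have mopp : measurable_fun setT (-%R : measurableTypeR R -> measurableTypeR R).
  exact: measurable_funN.
have mneg : measurable neg by rewrite -[X in measurable X]setTI; exact: mopp.
have posP x : pos x <-> (0 < x)%R by rewrite /pos/= in_itv/= andbT.
have negP x : neg x <-> (x < 0)%R by rewrite /neg/preimage/= posP oppr_gt0.
have half0 : (0 < 2^-1 :> R)%R by rewrite invr_gt0.
have posE : mu (pos `&` sq @^-1` A) = \int[mu]_(t in A) (2^-1 * ppow (- 2^-1) t)%:E.
  have := lebesgue_power_image half0 mA.
  rewrite /power_density (_ : 2^-1 - 1 = - 2^-1 :> R)%R; last by lra.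
  move=> <-; rewrite /power_image invrK; congr (mu _).
  apply/seteqP; split=> x [/posP x0]/=; rewrite powR_mulrn ?(ltW x0)// => Ax; split=> //; exact/posP.
have negE : mu (neg `&` sq @^-1` A) = mu (pos `&` sq @^-1` A).
  rewrite -[RHS]lebesgue_measureN; last exact: measurableI.
  by rewrite /pushforward preimage_setI; congr (mu (_ `&` _)); apply/seteqP; split=> x/=; rewrite /sq sqrrN.
have -> : sq @^-1` A = (pos `&` sq @^-1` A `|` neg `&` sq @^-1` A) `|` ([set 0%R : measurableTypeR R] `&` sq @^-1` A).
  rewrite -!setIUl (_ : _ `|` _ = setT) ?setTI//; apply/seteqP; split=> // x _.
  by have [/posP|/negP|->] := ltgtP 0%R (x : R); [left; left|left; right|right].
rewrite measureU0; last 3 first.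
- by apply: measurableU; exact: measurableI.
- by apply: measurableI => //; exact: measurable_set1.
- apply: (@subset_measure0 _ _ _ mu _ [set 0%R : measurableTypeR R]) => //.
  + by apply: measurableI => //; exact: measurable_set1.
  + exact: lebesgue_measure_set1.
rewrite measureU; last 3 first.
- exact: measurableI.
- exact: measurableI.
- rewrite -subset0 => x /= [[/posP x0 _] [/negP + _]].
  by rewrite ltNge ltW.
rewrite [X in _ + X]negE [X in X + _]posE [X in _ + X]posE -ge0_integralD//.
- by apply: eq_integral => t _; rewrite -EFinD; congr _%:E; move: (ppow _ t) => y; lra.
- by move=> t _; rewrite lee_fin mulr_ge0// ?ppow_ge0// ltW.
- by apply: measurable_funTS; apply/measurable_EFinP/measurable_funM => //; exact: measurable_ppow.
- by move=> t _; rewrite lee_fin mulr_ge0// ?ppow_ge0// ltW.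
- by apply: measurable_funTS; apply/measurable_EFinP/measurable_funM => //; exact: measurable_ppow.
Qed.

(** The generators of a Voronoi tessellation, seen as Laguerre generators. *)
Definition flat n (v : 'rV[R]_n) : S n := (v, 0%R).

Lemma measurable_flat n : measurable_fun setT (@flat n).
Proof. by apply/measurable_fun_pairP; split; [exact: measurable_id|exact: measurable_cst]. Qed.

(** Points of height zero carry no density, but after one folding they do: the
    height is the square of the last coordinate. *)
Lemma lebesgue_flat n (c : R) (A : set (S n)) : (0 <= c)%R -> measurable A ->
  c%:E * lebesgue_rV n.+1 ((fun v => fold1 (flat v)) @^-1` A) =
  intensity (fun h => (c * ppow (- 2^-1) h)%:E) A.
Proof.
move=> c0 mA.
have mpp : measurable_fun setT (fun h : measurableTypeR R => (ppow (- 2^-1) h)%:E).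
  by apply/measurable_EFinP; exact: measurable_ppow.
have mf : measurable_fun setT (fun v : 'rV[R]_n.+1 => fold1 (flat v)).
  by apply: measurableT_comp; [exact: measurable_fold1|exact: measurable_flat].
have mD : measurable ((fun v => fold1 (flat v)) @^-1` A).
  by rewrite -[X in measurable X]setTI; exact: mf.
have m1 : measurable_fun setT (fun z : S n => (\1_A z)%:E : \bar R).
  by apply/measurable_EFinP; exact: measurable_indic.
rewrite /intensity.
under [RHS]eq_integral do rewrite EFinM muleCA.
rewrite ge0_integralZl_EFin//; last 2 first.
- by move=> z _; rewrite mule_ge0// lee_fin// ppow_ge0.
- exact: (measurable_intensity mA mpp).
congr (_ * _); rewrite [RHS]fubini_tonelli1; last 2 first.
- exact: (measurable_intensity mA mpp).
- by move=> z; rewrite mule_ge0// lee_fin// ppow_ge0.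
rewrite -[X in lebesgue_rV _ X]setIT -integral_indic// integral_lebesgue_rV_last; last 2 first.
- by apply/measurable_EFinP; exact: measurable_indic.
- by move=> v; rewrite lee_fin.
apply: eq_integral => u _; rewrite /fubini_F/=.
have mAu : measurable (xsection A u) by exact: measurable_xsection.
transitivity (mu ((fun x : measurableTypeR R => (x ^+ 2)%R : measurableTypeR R) @^-1` xsection A u)).
  rewrite -[X in mu X]setIT -integral_indic//; last first.
    by rewrite -[X in measurable X]setTI; exact: measurable_funX.
  apply: eq_integral => x _; rewrite !indicE; congr ((_ : bool)%:R%:E).
  apply/idP/idP => /set_mem/= h; apply/mem_set => /=; move: h;
    by rewrite /xsection/= /fold1/= init_rcons rcons_rV_max add0r ?in_setE// => /mem_set.
rewrite lebesgue_sqr_preimage// integral_mkcond; apply: eq_integral => t _.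
rewrite patchE mem_xsection indicE.
by case: ifP => _; rewrite ?mul1e ?mul0e.
Qed.

End square_preimage.

Section beta_section.
Context {R : realType}.
Local Notation mu := (@lebesgue_measure R).
Local Notation S n := ('rV[R]_n * measurableTypeR R)%type.

Lemma shift0 n : @shift R n 0 = id.
Proof. by apply/funext => -[v h]; rewrite /shift/= addr0. Qed.

Lemma beta_const_ge0 m b : -1 < b -> 0 <= beta_const m b :> R.
Proof.
move=> b1; have m0 : 0 <= m%:R / 2 :> R := half_nat_ge0 m.
have [g1 g2] : 0 < m%:R / 2 + b + 1 /\ 0 < b + 1 by split; lra.
apply: divr_ge0; first exact: ltW (Gamma_gt0 g1).
by apply: mulr_ge0; [exact: powR_ge0|exact: ltW (Gamma_gt0 g2)].
Qed.

Lemma itv0_nbhs (t : R) : 0 <= t -> exists r b, 0 < r /\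
  forall u, 0 <= u -> `|t - u| < r -> `[0, b%:R : R]%classic u.
Proof.
move=> t0; exists 1, (Num.truncn (t + 1)).+1; split=> // u u0.
have := truncnS_gt (t + 1); move: ((Num.truncn _).+1%:R : R) => m mt.
by rewrite ltr_norml /= in_itv/= u0/= => /andP[]; lra.
Qed.

Lemma measurable_ge0 : measurable [set h : measurableTypeR R | (0 : R) <= h].
Proof.
rewrite (_ : [set _ | _] = `[0%R, +oo[%classic); first exact: measurable_itv.
by apply/seteqP; split=> h /=; rewrite in_itv/= andbT.
Qed.

Lemma laguerre_restrict_ge0 k l (X : set (S (k + l))) : (forall z, X z -> 0 <= (z.2 : R)) ->
  laguerre ((shift 0 \o @fold R l k) @` X) =
  laguerre ((shift 0 \o @fold R l k) @` X `&` [set z | 0 <= (z.2 : R)]).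
Proof.
move=> X0; rewrite setIidl// => _ [z /X0 z0 <-] /=; rewrite addr0.
exact: le_trans z0 (fold_height_le _).
Qed.

Section positive_exponent.
Context (k l : nat) d1 (O1 : measurableType d1) (P1 : probability O1 R).
Context d2 (O2 : measurableType d2) (P2 : probability O2 R).
Variables (T1 : O1 -> set (set 'rV[R]_(k + l))) (T2 : O2 -> set (set 'rV[R]_l)).

Lemma beta_section_gtN1 (b c : R) : -1 < b -> 0 < c ->
  is_beta_voronoi P1 b c T1 -> is_beta_voronoi P2 (b + k%:R / 2) c T2 ->
  eq_distribution P1 (fun w => sectional_tessellation l (T1 w)) P2 T2.
Proof.
move=> b1 c0; have k2 : 0 <= k%:R / 2 :> R := half_nat_ge0 k.
have bk : -1 < b + k%:R / 2 by move: (k%:R / 2) k2 => x x0; lra.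
rewrite /is_beta_voronoi (gt_eqF b1) (gt_eqF bk).
move=> [X1 [lf1 poi1 T1E]] [X2 [lf2 poi2 T2E]].
have mF C e : measurable_fun setT (fun h : measurableTypeR R => C * h `^ e).
  by apply: measurable_funM => //; exact: measurable_powR.
pose C1 := c * beta_const (k + l).+1 b.
pose C2 := c * beta_const l.+1 (b + k%:R / 2).
have C10 : 0 <= C1 := mulr_ge0 (ltW c0) (beta_const_ge0 _ b1).
have C20 : 0 <= C2 := mulr_ge0 (ltW c0) (beta_const_ge0 _ bk).
pose g0 (h : measurableTypeR R) := (C1 * ppow b h)%:E.
have mg0 : measurable_fun setT g0.
  by apply/measurable_EFinP; apply: measurable_funM => //; exact: measurable_ppow.
have g00 h : (0 <= g0 h)%E := mulr_ge0 C10 (ppow_ge0 b h).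
have gE : iter k abel g0 = (fun h => (C2 * ppow (b + k%:R / 2) h)%:E).
  by rewrite (iter_abel_ppow k C10 b1) /C1 -(mulrA c) (beta_const_section k l b1).
have ppowE C e (h : R) : h != 0 -> 0 <= h -> (C * ppow e h)%:E = (C * h `^ e)%:E.
  by move=> hn h0; rewrite /ppow lt_def hn h0.
apply: (@poisson_section R k l _ _ P1 _ _ P2 X1 X2 0 [set h : R | 0 <= h]
  (fun m => `[0, m%:R : R]%classic) (fun h => C2 * h `^ (b + k%:R / 2))
  measurable_ge0 (@locally_compact_ge0 R) (mF _ _) (fun m => measurable_itv _) itv0_nbhs lf2 poi2
  [set h : R | 0 <= h] (fun h => C1 * h `^ b) g0 measurable_ge0 (@locally_compact_ge0 R)
  (mF _ _) mg0 g00 _ _ lf1 poi1) => //.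
- by move=> h; exact: ppowE.
- by move=> h _ /negP h0; rewrite /g0 /ppow ifF ?mulr0//; apply/negbTE; apply: contra h0 => /ltW.
- by move=> h h0 Jh; rewrite subr0 gE ppowE.
- move=> m; under eq_integral do rewrite subr0 gE.
  exact: integral_ppow_lty.
- by apply: aeW => o; apply: laguerre_restrict_ge0 => z Xz; have [+ _] := lf1 o; exact.
Qed.

End positive_exponent.

Section flat_source.
Context (k l : nat) d1 (O1 : measurableType d1) (P1 : probability O1 R).
Context d2 (O2 : measurableType d2) (P2 : probability O2 R).
Variables (T1 : O1 -> set (set 'rV[R]_(k.+1 + l))) (T2 : O2 -> set (set 'rV[R]_l)).

Lemma flat_isolating n (X : set 'rV[R]_n) : locally_finite_in setT X ->
  isolating (@base R n) (@flat R n @` X).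
Proof.
move=> [_ Xfin]; apply: isolating_base => _ [v Xv <-]; exists 1 => //.
have [m vm] : exists m : nat, `|v| + 1 <= m%:R.
  by exists (Num.truncn (`|v| + 1)).+1; exact/ltW/truncnS_gt.
have cm : compact (cube m : set 'rV[R]_n).
  by rewrite -[X in compact X]setIT; exact: compact_cubeI.
apply: (@sub_finite_set _ _ (@flat R n @` (X `&` cube m))); last exact/finite_image/Xfin.
move=> _ [[u Xu <-] [/= vu _]]; exists u => //; split=> //.
rewrite /cube/= -[u](subrK v) (le_trans (ler_normD _ _))// addrC (le_trans _ vm)//.
by rewrite lerD2l distrC ltW.
Qed.

Let flat_algebra (a c p q y z : R) : p != 0 -> q != 0 ->
  a / (z * (p * q)) * c * (p * q / y) = c * (a / (z * y)).
Proof. by move=> p0 q0; rewrite !invfM; move: (z^-1) (y^-1) => u v; field; rewrite p0 q0. Qed.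

(** The factor missing from k foldings as compared to k + 1 is sqrt pi, which is
    the value Gamma (1/2) that enters with the profile h^(-1/2). *)
Lemma flat_rate (c : R) :
  Gamma ((k.+1 + l).+1%:R / 2) * pi `^ (- ((k.+1 + l).+1%:R / 2)) * c *
    (Num.sqrt pi ^+ k * Gamma (- 2^-1 + 1) / Gamma (- 2^-1 + k%:R / 2 + 1)) =
  c * beta_const l.+1 (-1 + k.+1%:R / 2).
Proof.
rewrite /beta_const powRN pi_powD exprSr (_ : - 2^-1 + 1 = 2^-1); last by lra.
rewrite Gamma_half (half_natS k).
have -> : (k.+1 + l).+1%:R / 2 = l.+1%:R / 2 + (-1 + (k%:R / 2 + 2^-1)) + 1 :> R.
  by rewrite -!natr1 natrD; field.
have -> : -1 + (k%:R / 2 + 2^-1) = - 2^-1 + k%:R / 2 :> R by field.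
exact: flat_algebra (sqrt_pi_neq0 k) (sqrt_pi_neq0 1).
Qed.

(** One folding produces the profile h^(-1/2), the k others act as on any
    positive power. *)
Lemma beta_section_N1 (c : R) : 0 < c ->
  is_beta_voronoi P1 (-1) c T1 -> is_beta_voronoi P2 (-1 + k.+1%:R / 2) c T2 ->
  eq_distribution P1 (fun w => sectional_tessellation l (T1 w)) P2 T2.
Proof.
move=> c0; have k2 : 0 <= k%:R / 2 :> R := half_nat_ge0 k.
have bk : -1 < -1 + k.+1%:R / 2 :> R by rewrite half_natS; move: (k%:R / 2) k2 => x x0; lra.
rewrite /is_beta_voronoi eqxx (gt_eqF bk).
move=> [X [lfX poiX T1E]] [X2 [lf2 poi2 T2E]].
set b' := -1 + _ in bk poi2.
set rho := (_ * _ * c) in poiX.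
have mF C e : measurable_fun setT (fun h : measurableTypeR R => C * h `^ e).
  by apply: measurable_funM => //; exact: measurable_powR.
pose C2 := c * beta_const l.+1 b'.
have C20 : 0 <= C2 := mulr_ge0 (ltW c0) (beta_const_ge0 _ bk).
have rho0 : 0 <= rho.
  have G0 : 0 < (k.+1 + l).+1%:R / 2 :> R by rewrite divr_gt0.
  by apply: (mulr_ge0 (mulr_ge0 (ltW (Gamma_gt0 G0)) (powR_ge0 _ _)) (ltW c0)).
pose g0 (h : measurableTypeR R) := (rho * ppow (- 2^-1) h)%:E.
have mg0 : measurable_fun setT g0.
  by apply/measurable_EFinP; apply: measurable_funM => //; exact: measurable_ppow.
have g00 h : (0 <= g0 h)%E := mulr_ge0 rho0 (ppow_ge0 _ h).
have halfN : -1 < - 2^-1 :> R by lra.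
have gE : iter k abel g0 = (fun h => (C2 * ppow b' h)%:E).
  rewrite (iter_abel_ppow k rho0 halfN) flat_rate; apply/funext => h.
  by congr (_ * ppow _ _)%:E; rewrite /b' half_natS; field.
pose X1 o : set (S (k.+1 + l)) := @flat R _ @` X o.
have ppowE C e (h : R) : h != 0 -> 0 <= h -> (C * ppow e h)%:E = (C * h `^ e)%:E.
  by move=> hn h0; rewrite /ppow lt_def hn h0.
have X1_void A o : (X1 o `&` A = set0) <-> (X o `&` @flat R _ @^-1` A = set0).
  split=> [h|h]; rewrite -subset0.
    move=> v [Xv Av]; have : (X1 o `&` A) (flat v) by split=> //; exists v.
    by rewrite h.
  by move=> _ [[v Xv <-] Av]; have : (X o `&` @flat R _ @^-1` A) v by []; rewrite h.
have mflat n (A : set (S n)) : measurable A -> measurable (@flat R n @^-1` A).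
  by move=> mA; rewrite -[X in measurable X]setTI; exact: measurable_flat.
have mfold n m (A : set (S n)) : measurable A -> measurable (@fold R n m @^-1` A).
  by move=> mA; rewrite -[X in measurable X]setTI; exact: measurable_fold.
have preE A : @flat R (k.+1 + l) @^-1` ((shift 0 \o @fold R l k.+1) @^-1` A) =
    (fun v => fold1 (flat v)) @^-1` (@fold R l k @^-1` A).
  by rewrite shift0.
have LE A : measurable A -> (rho%:E * lebesgue_rV (k.+1 + l)
    (@flat R (k.+1 + l) @^-1` ((shift 0 \o @fold R l k.+1) @^-1` A)))%E =
    intensity (iter k abel g0) A.
  move=> mA; rewrite preE (lebesgue_flat rho0 (mfold _ _ _ mA)).
  exact: intensity_fold.
have L0 A : (0 <= rho%:E * lebesgue_rV (k.+1 + l)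
    (@flat R (k.+1 + l) @^-1` ((shift 0 \o @fold R l k.+1) @^-1` A)))%E.
  by rewrite mule_ge0.
have I0 := iter_abel_ge0 k g00.
have mI := measurable_iter_abel k mg0 g00.
have mphi A : measurable A -> measurable ((shift 0 \o @fold R l k.+1) @^-1` A).
  by move=> mA; rewrite shift0; exact: mfold.
apply: (@section_to_poisson R k.+1 l _ _ P1 _ _ P2 X1 X2 0 [set h : R | 0 <= h]
  (fun m => `[0, m%:R : R]%classic) (fun h => C2 * h `^ b')
  measurable_ge0 (@locally_compact_ge0 R) (mF _ _) (fun m => measurable_itv _) itv0_nbhs lf2 poi2
  (iter k abel g0) mI I0) => //.
- by move=> h h0 Jh; rewrite gE ppowE.
- by move=> m; rewrite gE; exact: integral_ppow_lty.
- move=> A mA; have := measurable_poisson_void poiX (mflat _ _ mA).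
  by congr measurable; apply/seteqP; split=> o /=; rewrite X1_void.
- by move=> o; exact: flat_isolating.
- move=> A mA; rewrite -LE// -(poisson_void poiX (mflat _ _ (mphi _ mA)) (L0 A)).
  by congr (P1 _); apply/seteqP; split=> o /=; rewrite X1_void.
- move=> A mA; rewrite -LE// => fin.
  have := poisson_finite poiX (mflat _ _ (mphi _ mA)) (L0 A) fin.
  apply: filterS => o fX; apply: sub_finite_set (finite_image (@flat R _) fX).
  by move=> _ [[v Xv <-] Av]; exists v.
- apply: aeW => o; apply: laguerre_restrict_ge0 => _ [v _ <-]; exact: lexx.
- by move=> o; rewrite T1E voronoi_laguerre.
Qed.

End flat_source.

End beta_section.

Theorem theorem4p1 (R : realType) (d l : nat)
    (hd : (2 <= d)%N) (hl : (1 <= l <= d - 1)%N)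
    (dO dO' : measure_display)
    (Om : measurableType dO) (Om' : measurableType dO')
    (P : probability Om R) (P' : probability Om' R)
    (T : Om -> set (set 'rV[R]_d)) (T' : Om' -> set (set 'rV[R]_l)) :
  [/\ forall beta gamma : R, -1 <= beta -> 0 < gamma ->
        is_beta_voronoi P beta gamma T ->
        is_beta_voronoi P' (beta + (d%:R - l%:R) / 2) gamma T' ->
        eq_distribution P
          (fun w => sectional_tessellation l (T w)) P' T',
      forall beta gamma : R, d%:R / 2 + 1 < beta -> 0 < gamma ->
        is_beta'_voronoi P beta gamma T ->
        is_beta'_voronoi P' (beta - (d%:R - l%:R) / 2) gamma T' ->
        eq_distribution P
          (fun w => sectional_tessellation l (T w)) P' T' &
      forall lambda : R, 0 < lambda ->
        is_gaussian_voronoi P lambda T ->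
        is_gaussian_voronoi P' lambda T' ->
        eq_distribution P
          (fun w => sectional_tessellation l (T w)) P' T'].
Proof.
have [k dE] : exists k, d = (k.+1 + l)%N by exists (d - l).-1; lia.
subst d.
have -> : (k.+1 + l)%:R - l%:R = k.+1%:R :> R by rewrite natrD addrK.
split.
- move=> beta gamma; rewrite le_eqVlt => /orP[/eqP <-|b1] c0.
    exact: beta_section_N1 c0.
  exact: beta_section_gtN1 b1 c0.
- by move=> beta gamma lb c0; exact: beta'_section lb c0.
- by move=> lambda l0; exact: gaussian_section l0.
Qed.
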